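(* There is a constant $C$ such that, for every integer $n\geq 3$ and every non-zero $q\in\mathbb{Z}$, the set $\left(U_n(\mathbb{Z};q)\,L_n(\mathbb{Z};q)\right)^C$ is a finite-index subgroup of $\mathrm{SL}_n(\mathbb{Z})$.
   Context: $U_n(\mathbb{Z};q)$ is the group of unipotent upper triangular matrices in $\mathrm{SL}_n(\mathbb{Z})$ all of whose off-diagonal entries are divisible by $q$; $L_n(\mathbb{Z};q)$ is the group of unipotent lower triangular matrices in $\mathrm{SL}_n(\mathbb{Z})$ all of whose off-diagonal entries are divisible by $q$. For subsets $X,Y$ of a group, $XY=\{xy\mid x\in X,y\in Y\}$, and for a natural number $k$, $X^k=\{x_1\cdots x_k\mid x_i\in X\cup\{1\}\}$. *)

(* Defs.v *)
From HB Require Import structures.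
From mathcomp Require Import all_boot all_order all_algebra.
From mathcomp Require Import boolp classical_sets functions cardinality.

Set Implicit Arguments.
Unset Strict Implicit.
Unset Printing Implicit Defensive.

Import GRing.Theory.

Local Open Scope ring_scope.

Record SL (R : comUnitRingType) (n : nat) := MkSL {
  SLval :> 'M[R]_n;
  _ : \det SLval == 1 }.

HB.instance Definition _ (R : comUnitRingType) n := [isSub for @SLval R n].
HB.instance Definition _ (R : comUnitRingType) n := [Choice of SL R n by <:].

Section SLGroup.
Context {R : comUnitRingType} {n : nat}.
Implicit Types A B : SL R n.

Lemma SL_det A : \det A = 1.
Proof. exact/eqP/(valP A). Qed.

Lemma SL_unitmx A : (A : 'M[R]_n) \in unitmx.
Proof. by rewrite unitmxE SL_det unitr1. Qed.

Fact SL_mul_subproof A B : \det (A *m B) == 1.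
Proof. by rewrite det_mulmx !SL_det mulr1. Qed.

Fact SL_one_subproof : \det (1%:M : 'M[R]_n) == 1.
Proof. by rewrite det1. Qed.

Fact SL_inv_subproof A : \det (invmx A) == 1.
Proof. by rewrite det_inv SL_det invr1. Qed.

Definition SL_mul A B := MkSL (SL_mul_subproof A B).
Definition SL_one := MkSL SL_one_subproof.
Definition SL_inv A := MkSL (SL_inv_subproof A).

Fact SL_mulA : associative SL_mul.
Proof. by move=> A B D; apply/val_inj; rewrite /= mulmxA. Qed.

Fact SL_mul1 : left_id SL_one SL_mul.
Proof. by move=> A; apply/val_inj; rewrite /= mul1mx. Qed.

Fact SL_mulr1 : right_id SL_one SL_mul.
Proof. by move=> A; apply/val_inj; rewrite /= mulmx1. Qed.

Fact SL_mulV : left_inverse SL_one SL_inv SL_mul.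
Proof. by move=> A; apply/val_inj; rewrite /= mulVmx ?SL_unitmx. Qed.

Fact SL_mulrV : right_inverse SL_one SL_inv SL_mul.
Proof. by move=> A; apply/val_inj; rewrite /= mulmxV ?SL_unitmx. Qed.

HB.instance Definition _ :=
  isGroup.Build (SL R n) SL_mulA SL_mul1 SL_mulr1 SL_mulV SL_mulrV.

End SLGroup.

Local Open Scope classical_set_scope.

Section GroupSubsets.
Local Open Scope group_scope.
Context {G : groupType}.
Implicit Types X Y H : set G.

Definition mul_set X Y : set G := [set x * y | x in X & y in Y].

Definition exp_set X (k : nat) : set G :=
  [set g | exists2 x : 'I_k -> G,
     forall i, (X `|` [set 1]) (x i) & g = \prod_(i < k) x i].

Definition is_subgroup H : Prop := group_closed [in H].

Definition left_coset (g : G) H : set G := [set g * h | h in H].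

Definition finite_index H : Prop :=
  finite_set [set left_coset g H | g in [set: G]].

End GroupSubsets.

Definition U_group (n : nat) (q : int) : set (SL int n) :=
  [set A : SL int n |
     (forall i j : 'I_n, (j < i)%N -> A i j = 0)
     /\ (forall i : 'I_n, A i i = 1)
     /\ (forall i j : 'I_n, i != j -> (q %| A i j)%Z)].

Definition L_group (n : nat) (q : int) : set (SL int n) :=
  [set A : SL int n |
     (forall i j : 'I_n, (i < j)%N -> A i j = 0)
     /\ (forall i : 'I_n, A i i = 1)
     /\ (forall i j : 'I_n, i != j -> (q %| A i j)%Z)].

Arguments U_group : clear implicits.
Arguments L_group : clear implicits.

(* Main.v *)
(* The powers of U L stabilize to the group of matrices with off-diagonal entries divisible by q and diagonal entries congruent to 1 modulo q^2; it contains the principal congruence subgroup of level q^2, so it has finite index.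

Since Z has stable range 2, four row and column unipotents clear the first row and column, which reduces the dimension from n to 3 (without lengthening the word, as these unipotents are normalized by the remaining corner) and then to a matrix [[a, q b], [q c, d]] in a plane of dimension 3. Conjugates of row and column elements of SL_3 under the group {g | first row and column as above} are words of bounded length, and modulo a bounded number of them the class of [[a, q b], [q c, d]] behaves like a Mennicke symbol [a; b], multiplicative in b.

By Dirichlet's theorem one may take a = -p with p = 3 mod 4 prime; then b may be replaced by a square x^2 up to sign, so the matrix is close to N^2 where N has symbol [a; x]. An even power N^(2m) is bounded when a^(2m) = 1 modulo q^2 x or modulo q^2 c. A second prime, in the class of c modulo p, makes the gcd of two such exponents equal to 2, so that N^2 is bounded.

Dirichlet's theorem is proved by real methods: the operators sum_n T_n / n on functions of mean zero on the group G of units modulo N, where T_n translates by n, converge to an operator L. Chebyshev-type estimates show that a function killed by L is a multiple of a real character chi with sum chi(n)/n = 0, which Monsky's Lambert series argument excludes; hence L is invertible, and the prime sums sum_{p = h} log p / p differ boundedly among the classes h. *)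

Require Import Defs.
From HB Require Import structures.
From mathcomp Require Import all_boot all_order all_algebra all_fingroup all_solvable.
From mathcomp Require Import boolp classical_sets functions cardinality.
From mathcomp Require Import reals exp Rstruct.
From mathcomp Require Import ring lra zify.

Set Implicit Arguments.
Unset Strict Implicit.
Unset Printing Implicit Defensive.

Import Order.TTheory GRing.Theory Num.Theory.

Local Open Scope ring_scope.

(** * Dirichlet's theorem on primes in arithmetic progressions *)

(** The bound must be uniform in [q], whereas identities between Mennicke symbols usually hold
    modulo a normal subgroup: each is redone here as a matrix identity with a counted error.
    Counting conjugates under [Gam], rather than row and column elements, makes the balls invariant
    under conjugation, so that an error can be carried past any factor of [Gam] at no cost; the
    price, a factor 9, is paid once at the end. [Gam] contains all of SL_2(Z) in its corner. An
    elementary matrix of the corner commutes with a symbol up to a bounded error, because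
    commutators of row and column elements already give the multiples of q^2 there, and a is 1
    modulo q^2. The exponents that come from Euler's theorem grow with q and with the entries. They
    are harmless: a power of a 2 by 2 matrix is a linear combination of the matrix and the identity,
    so that its cost does not depend on the exponent. *)

Lemma perm_divisors_prime_mul (p n : nat) : prime p -> (0 < n)%N ->
  perm_eq (divisors (p * n))
    ([seq d <- divisors n | ~~ (p %| d)%N] ++ [seq (p * e)%N | e <- divisors n]).
Proof.
move=> pp n0; have p0 := prime_gt0 pp.
apply: uniq_perm; first exact: divisors_uniq.
  rewrite cat_uniq filter_uniq ?divisors_uniq //= map_inj_uniq ?divisors_uniq.
    rewrite andbT; apply/hasPn => _ /mapP[e _ ->].
    by rewrite mem_filter dvdn_mulr.
  by move=> a b /eqP; rewrite eqn_pmul2l // => /eqP.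
move=> d; rewrite mem_cat mem_filter -!dvdn_divisors ?muln_gt0 ?p0 //.
case: (boolP (p %| d)%N) => [/dvdnP[e ->]|npd] /=.
  rewrite mulnC dvdn_pmul2l //; apply/idP/mapP => [en|[e']].
    by exists e => //; rewrite -dvdn_divisors.
  rewrite -dvdn_divisors // => e'n /eqP; rewrite eqn_pmul2l // => /eqP ->.
  by [].
rewrite Gauss_dvdr; last by rewrite coprime_sym prime_coprime.
rewrite [X in _ = _ || X](_ : _ = false) ?orbF //.
by apply/negbTE/mapP => -[e _ de]; rewrite de dvdn_mulr in npd.
Qed.

Lemma sum_divisors_prime_mul (V : nmodType) (p n : nat) (F : nat -> V) :
  prime p -> (0 < n)%N ->
  \sum_(d <- divisors (p * n)) F d
    = \sum_(d <- divisors n | ~~ (p %| d)%N) F d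
      + \sum_(e <- divisors n) F (p * e)%N.
Proof.
move=> pp n0; rewrite (perm_big _ (perm_divisors_prime_mul pp n0)) /=.
by rewrite big_cat big_filter big_map.
Qed.

Lemma sum_divisors_range (V : nmodType) (k x : nat) (F : nat -> V) :
  (0 < k <= x)%N ->
  \sum_(d <- divisors k) F d = \sum_(1 <= d < x.+1 | (d %| k)%N) F d.
Proof.
move=> /andP[k0 kx]; rewrite -[RHS]big_filter; apply: perm_big.
apply: uniq_perm; rewrite ?divisors_uniq ?filter_uniq ?iota_uniq // => d.
rewrite mem_filter -dvdn_divisors // mem_index_iota ltnS.
case: (boolP (d %| k)%N) => //= dk; rewrite (dvdn_gt0 k0 dk) /=.
by rewrite (leq_trans (dvdn_leq k0 dk)).
Qed.

Lemma sum_multiples (V : nmodType) (d x : nat) (F : nat -> V) : (0 < d)%N ->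
  \sum_(1 <= k < x.+1 | (d %| k)%N) F (k %/ d)%N
    = \sum_(1 <= m < (x %/ d).+1) F m.
Proof.
move=> d0; rewrite -[LHS]big_filter.
rewrite (perm_big [seq (d * m)%N | m <- index_iota 1 (x %/ d).+1]).
  by rewrite big_map; apply: eq_bigr => m _; rewrite mulKn.
have inj : injective (muln d).
  by move=> a b /eqP; rewrite eqn_pmul2l // => /eqP.
apply: uniq_perm; rewrite ?filter_uniq ?map_inj_uniq ?iota_uniq // => k.
rewrite mem_filter mem_index_iota ltnS.
apply/andP/mapP => [[/dvdnP[m ->]] /andP[h1 h2]|[m]].
  exists m; rewrite ?(mulnC m) // mem_index_iota ltnS leq_divRL // h2 andbT.
  by case: m h1 {h2} => //; rewrite mul0n.
rewrite mem_index_iota ltnS leq_divRL // => /andP[m0 md] ->.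
by rewrite dvdn_mulr // muln_gt0 d0 m0 mulnC.
Qed.

(** Both sides run over the pairs (d, m) with d m <= x, grouped by the product or by the first
    factor. Convolution identities such as [sum_mangoldt] are summed up to x in this form. *)
Lemma sum_convolution (V : nmodType) (x : nat) (F : nat -> nat -> V) :
  \sum_(1 <= k < x.+1) \sum_(d <- divisors k) F d (k %/ d)%N
    = \sum_(1 <= d < x.+1) \sum_(1 <= m < (x %/ d).+1) F d m.
Proof.
transitivity (\sum_(1 <= k < x.+1) \sum_(1 <= d < x.+1 | (d %| k)%N)
                F d (k %/ d)%N).
  apply: eq_big_nat => k kx.
  exact: (sum_divisors_range (fun d => F d (k %/ d)%N)).
rewrite (exchange_big_dep xpredT) //=; apply: eq_big_nat => d /andP[d0 _].
exact: sum_multiples.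
Qed.

(** * The Moebius and von Mangoldt functions *)

Definition moebius (n : nat) : int :=
  \prod_(p <- primes n) (if logn p n == 1%N then -1 else 0).

Lemma normr_moebius (n : nat) : `|moebius n| <= 1.
Proof.
rewrite /moebius normr_prod; apply: prodr_ile1 => p _; rewrite normr_ge0.
by case: ifP; rewrite ?normrN ?normr1 ?normr0.
Qed.

Lemma moebius1 : moebius 1 = 1.
Proof. by rewrite /moebius big_nil. Qed.

Lemma perm_primes_mul (p e : nat) : prime p -> (0 < e)%N -> ~~ (p %| e)%N ->
  perm_eq (primes (p * e)) (p :: primes e).
Proof.
move=> pp e0 pe; apply: uniq_perm; rewrite /= ?primes_uniq ?andbT //.
  by rewrite mem_primes (negbTE pe) !andbF.
move=> r; rewrite primesM ?(prime_gt0 pp) //.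
by rewrite (primes_prime pp) !inE.
Qed.

Lemma moebius_prime_mul (p e : nat) : prime p -> (0 < e)%N ->
  moebius (p * e) = if (p %| e)%N then 0 else - moebius e.
Proof.
move=> pp e0; have p0 := prime_gt0 pp; case: ifPn => pe.
  rewrite /moebius (bigD1_seq p) ?primes_uniq //=; last first.
    by rewrite mem_primes pp muln_gt0 p0 e0 dvdn_mulr.
  rewrite lognM // (logn_prime _ pp) eqxx.
  have : (0 < logn p e)%N by rewrite logn_gt0 mem_primes pp e0.
  by case: (logn p e) => // k _; rewrite mul0r.
rewrite /moebius (perm_big _ (perm_primes_mul pp e0 pe)) big_cons.
rewrite lognM // (logn_prime _ pp) eqxx logn_coprime ?prime_coprime //=.
rewrite mulN1r; congr (- _); apply: eq_big_seq => r.
rewrite mem_primes => /and3P[rp _ re].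
have /negbTE rNp : r != p by apply: contraNneq pe => <-.
by rewrite lognM // (logn_prime _ pp) rNp add0n.
Qed.

(** For the least prime p of n, a divisor e prime to p cancels against [p * e], and the divisors
    [p * e] with p dividing e contribute 0. *)
Lemma sum_moebius (n : nat) : (0 < n)%N ->
  \sum_(d <- divisors n) moebius d = (n == 1%N)%:R.
Proof.
case: n => [//|[_|n _]]; first by rewrite big_seq1 moebius1.
have pp : prime (pdiv n.+2) by rewrite pdiv_prime.
move: (pdiv_dvd n.+2) pp; move: (pdiv _) => p /dvdnP[m nE] pp.
have p1 := prime_gt1 pp; have m0 : (0 < m)%N by case: m nE.
rewrite nE (mulnC m) sum_divisors_prime_mul //.
rewrite [X in _ + X](eq_big_seq
  (fun e => if (p %| e)%N then 0 else - moebius e)); last first.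
  move=> e; rewrite -dvdn_divisors // => /dvdn_gt0 h.
  by rewrite moebius_prime_mul ?h.
rewrite [X in _ + X](bigID (fun e => p %| e)%N) /=.
rewrite [X in _ + (X + _)]big1 ?add0r; last by move=> e ->.
rewrite -[X in _ + X]/(\sum_(e <- _ | _) _).
rewrite [X in _ + X](eq_bigr (fun e => - moebius e)); last first.
  by move=> e /negbTE ->.
rewrite sumrN subrr; case: eqP => //= /eqP.
by rewrite muln_eq1; case: eqP p1 => // ->.
Qed.

Section VonMangoldt.
Context {R : realType}.

(** The condition on the [(pdiv n)^']-part says that n is a power of its least prime divisor. *)
Definition mangoldt (n : nat) : R :=
  if (1 < n)%N && (n`_(pdiv n)^' == 1)%N then ln (pdiv n)%:R else 0.

Lemma mangoldt1 : mangoldt 1 = 0.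
Proof. by []. Qed.

Lemma mangoldt_prime_mul (p e : nat) : prime p -> (0 < e)%N ->
  mangoldt (p * e) = if (e`_p^' == 1)%N then ln p%:R else 0.
Proof.
move=> pp e0; have p1 := prime_gt1 pp; have p0 := prime_gt0 pp.
have pe1 : (1 < p * e)%N by rewrite (leq_trans p1) // leq_pmulr.
rewrite /mangoldt pe1 /=.
have Epart : ((p * e)`_p^' = e`_p^')%N.
  by rewrite partnM // (part_p'nat (pi := p^')) ?mul1n // pnatNK pnat_id.
have [ppe|npe] := eqVneq (pdiv (p * e)) p; first by rewrite ppe Epart.
have rp : prime (pdiv (p * e)) by rewrite pdiv_prime.
have /negbTE -> : ((p * e)`_(pdiv (p * e))^' != 1)%N.
  apply/eqP => h; move: (dvdn_part p (p * e)).
  have : (p %| (p * e)`_(pdiv (p * e))^')%N.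
    rewrite -{1}(part_pnat_id (pnat_id pp)).
    have -> : (p`_p = p`_(pdiv (p * e))^')%N.
      rewrite (part_pnat_id (pnat_id pp)) part_pnat_id //.
      by rewrite pnatE // !inE eq_sym.
    by apply: partn_dvd; rewrite ?muln_gt0 ?p0 // dvdn_mulr.
  by rewrite h dvdn1 => /eqP p1E; rewrite p1E in p1.
case: eqP => // h; case/negP: npe; rewrite eq_sym.
move: (pdiv_dvd (p * e)) rp; move: (pdiv _) => r rpe rp.
have eE : e = (p ^ logn p e)%N by rewrite -p_part -[LHS](partnC p e0) h muln1.
move: rpe; rewrite eE Euclid_dvdM // (dvdn_prime2 rp pp).
case/orP => [/eqP -> //|]; rewrite Euclid_dvdX // (dvdn_prime2 rp pp).
by case/andP => /eqP ->.
Qed.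

Lemma mangoldt_ge0 (n : nat) : 0 <= mangoldt n.
Proof.
rewrite /mangoldt; case: ifP => // _; apply: ln_ge0.
by rewrite ler1n pdiv_gt0.
Qed.

(** Induction on n = p m. When m is replaced by p m, the terms [p * e] with p dividing e reproduce
    those of e; among the other [p * e] only e = 1 contributes, namely ln p. *)
Lemma sum_mangoldt (n : nat) : (0 < n)%N ->
  \sum_(d <- divisors n) mangoldt d = ln n%:R.
Proof.
elim/ltn_ind: n => -[//|[_ _|n IH _]]; first by rewrite big_seq1 ln1.
have pp : prime (pdiv n.+2) by rewrite pdiv_prime.
move: (pdiv_dvd n.+2) pp; move: (pdiv _) => p /dvdnP[m nE] pp.
have p1 := prime_gt1 pp; have p0 := prime_gt0 pp.
have m0 : (0 < m)%N by case: m nE.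
have mn : (m < n.+2)%N by rewrite nE ltn_Pmulr.
rewrite nE (mulnC m) sum_divisors_prime_mul // natrM lnM ?posrE ?ltr0n //.
rewrite -(IH m mn m0) [in RHS](bigID (fun d => ~~ (p %| d)%N)) /=.
rewrite addrCA; congr (_ + _).
rewrite [LHS](bigID (fun e => p %| e)%N) /= addrC; congr (_ + _); last first.
  rewrite big_seq_cond [RHS]big_seq_cond.
  apply: eq_big => [e|e /andP[]]; first by rewrite negbK.
  rewrite -dvdn_divisors // => em /dvdnP[f eE].
  have f0 : (0 < f)%N by case: f eE (dvdn_gt0 m0 em) => // ->.
  have e0 := dvdn_gt0 m0 em.
  rewrite mangoldt_prime_mul // {1 2}eE (mulnC f) partnM //.
  rewrite (part_p'nat (pi := p^')) ?mul1n; last by rewrite pnatNK pnat_id.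
  by rewrite mangoldt_prime_mul.
rewrite big_mkcond /= (bigD1_seq 1%N) ?divisors_uniq //=; last first.
  by rewrite -dvdn_divisors.
rewrite dvdn1 (gtn_eqF p1) /= mangoldt_prime_mul // partn1 eqxx.
rewrite big_seq_cond big1 ?addr0 // => e /andP[].
rewrite -dvdn_divisors // => em e1; have e0 := dvdn_gt0 m0 em.
case: ifPn => // pe.
by rewrite mangoldt_prime_mul // part_pnat_id ?(negbTE e1) // p'natE.
Qed.

(** Pairing e with [p * e] leaves [- moebius e * ln p]. The e prime to p are the divisors of the
    p'-part of m, and their Moebius sum detects whether this part is 1. *)
Lemma mangoldt_moebius (k : nat) : (0 < k)%N ->
  mangoldt k = - \sum_(d <- divisors k) (moebius d)%:~R * ln d%:R.
Proof.
case: k => [//|[_|k _]]; first by rewrite big_seq1 ln1 mulr0 oppr0.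
have pp : prime (pdiv k.+2) by rewrite pdiv_prime.
move: (pdiv_dvd k.+2) pp; move: (pdiv _) => p /dvdnP[m nE] pp.
have p1 := prime_gt1 pp; have p0 := prime_gt0 pp.
have m0 : (0 < m)%N by case: m nE.
rewrite nE (mulnC m) sum_divisors_prime_mul // mangoldt_prime_mul //.
rewrite [X in _ + X](bigID (fun e => p %| e)%N) /=.
rewrite [X in _ + (X + _)]big_seq_cond [X in _ + (X + _)]big1 ?add0r; last first.
  move=> e /andP[]; rewrite -dvdn_divisors // => em pe.
  by rewrite moebius_prime_mul ?(dvdn_gt0 m0) // pe mul0r.
rewrite -big_split /= big_seq_cond.
rewrite (eq_bigr (fun e => - ((moebius e)%:~R * ln p%:R))); last first.
  move=> e /andP[]; rewrite -dvdn_divisors // => em pe.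
  have e0 := dvdn_gt0 m0 em.
  rewrite moebius_prime_mul // (negbTE pe) natrM lnM ?posrE ?ltr0n //.
  rewrite mulrNz; ring.
rewrite sumrN opprK -mulr_suml -big_seq_cond.
have -> : \sum_(e <- divisors m | ~~ (p %| e)%N) (moebius e)%:~R
    = (\sum_(e <- divisors (m`_p^')%N) moebius e)%:~R :> R.
  rewrite rmorph_sum /= -big_filter; apply: perm_big; apply: uniq_perm.
  - by rewrite filter_uniq ?divisors_uniq.
  - exact: divisors_uniq.
  move=> e; rewrite mem_filter -!dvdn_divisors ?part_gt0 //.
  apply/andP/idP => [[pe em]|em].
    rewrite -(part_pnat_id (pi := p^') (n := e)); first exact: partn_dvd.
    by rewrite p'natE // (dvdn_gt0 m0).
  split; last exact: dvdn_trans em (dvdn_part _ _).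
  rewrite -p'natE // ?(dvdn_gt0 (part_gt0 _ m)) //.
  exact: pnat_dvd em (part_pnat _ _).
rewrite sum_moebius ?part_gt0 //.
by case: eqP => _; rewrite ?mul1r ?mul0r.
Qed.

End VonMangoldt.

(** * Partial summation and the estimates of Chebyshev and Mertens *)

Section Analysis.
Context {R : realType}.
Implicit Types (a w u e : nat -> R) (C : R).

Lemma big_nat1_recr (V : nmodType) (x : nat) (F : nat -> V) :
  \sum_(1 <= n < x.+2) F n = \sum_(1 <= n < x.+1) F n + F x.+1.
Proof. by rewrite big_nat_recr. Qed.

Lemma sum_tail (x m : nat) (F : nat -> R) : (m <= x)%N ->
  \sum_(m.+1 <= n < x.+1) F n
    = \sum_(1 <= n < x.+1) F n - \sum_(1 <= n < m.+1) F n.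
Proof.
by move=> mx; rewrite [in RHS](@big_cat_nat _ _ _ m.+1) //= addrAC subrr add0r.
Qed.

(** Partial sums that start at m + 1 are differences of two sums that start at 1, hence the factor
    2; summation against a decreasing nonnegative weight costs nothing more. *)
Lemma abel_bound a w C (m x : nat) :
  (forall k, `|\sum_(1 <= n < k.+1) a n| <= C) ->
  (forall n, (0 < n)%N -> 0 <= w n) ->
  (forall n, (0 < n)%N -> w n.+1 <= w n) ->
  `|\sum_(m.+1 <= n < x.+1) a n * w n| <= C *+ 2 * w m.+1.
Proof.
move=> aC w0 wd.
have C0 : 0 <= C by apply: le_trans (aC 0%N).
have [xm|mx] := leqP x m.
  by rewrite big_geq ?normr0 ?mulr_ge0 ?mulrn_wge0 ?w0.
rewrite -(subnKC mx); move: (x - m.+1)%N => j {x mx}.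
pose S j := \sum_(m.+1 <= n < (m.+1 + j).+1) a n.
have SC k : `|S k| <= C *+ 2.
  rewrite /S sum_tail ?addSn ?leqW ?leq_addr // mulr2n.
  by apply: (le_trans (ler_normB _ _)); apply: lerD.
have H : `|\sum_(m.+1 <= n < (m.+1 + j).+1) a n * w n - S j * w (m.+1 + j)%N|
    <= C *+ 2 * (w m.+1 - w (m.+1 + j)%N).
  elim: j => [|j IH].
    by rewrite /S addn0 !big_nat1 !subrr normr0 mulr0.
  rewrite addnS /S addnS big_nat_recr /=; last by rewrite addSn ltnS ltnW // ltnS leq_addr.
  rewrite [in X in _ - X]big_nat_recr /=; last by rewrite addSn ltnS ltnW // ltnS leq_addr.
  set k := (m.+1 + j)%N in IH *; rewrite -/(S j).
  have -> : \sum_(m.+1 <= n < k.+1) a n * w n + a k.+1 * w k.+1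
      - (S j + a k.+1) * w k.+1
    = (\sum_(m.+1 <= n < k.+1) a n * w n - S j * w k) + S j * (w k - w k.+1).
    by ring.
  apply: (le_trans (ler_normD _ _)).
  have wk : 0 <= w k - w k.+1 by rewrite subr_ge0 wd // /k addSn.
  have -> : C *+ 2 * (w m.+1 - w k.+1)
     = C *+ 2 * (w m.+1 - w k) + C *+ 2 * (w k - w k.+1) by ring.
  apply: lerD => //; rewrite normrM (ger0_norm wk).
  exact: ler_wpM2r.
set T := \sum_(_ <= n < _) _ in H *.
have wj : 0 <= w (m.+1 + j)%N by rewrite w0 // addSn.
have -> : T = (T - S j * w (m.+1 + j)%N) + S j * w (m.+1 + j)%N by ring.
apply: (le_trans (ler_normD _ _)).
have -> : C *+ 2 * w m.+1
   = C *+ 2 * (w m.+1 - w (m.+1 + j)%N) + C *+ 2 * w (m.+1 + j)%N by ring.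
apply: lerD => //; rewrite normrM (ger0_norm wj).
exact: ler_wpM2r.
Qed.

(** The intervals of centre [u m] and radius [e m] meet pairwise, so the supremum of their left ends
    lies in each of them. *)
Lemma cauchy_limit u e :
  (forall m x, (m <= x)%N -> `|u x - u m| <= e m) ->
  exists L, forall m, `|u m - L| <= e m.
Proof.
move=> ue.
have key m k : u m - e m <= u k + e k.
  have := ue m _ (leq_maxl m k); have := ue k _ (leq_maxr m k).
  move: (u (maxn m k)) => v; rewrite !ler_norml; lra.
pose E := [set y | exists m, y = u m - e m]%classic.
have E0 : (E !=set0)%classic by exists (u 0%N - e 0%N), 0%N.
exists (sup E) => m; rewrite ler_norml; apply/andP; split.
  have : sup E <= u m + e m by apply: ge_sup => // _ [k ->].
  by lra.
have : u m - e m <= sup E.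
  apply: sup_upper_bound; last by exists m.
  by split=> //; exists (u m + e m) => _ [k ->].
by lra.
Qed.

Lemma ln_succ (n : nat) : (0 < n)%N ->
  ln (n.+1%:R : R) - ln n%:R <= n%:R^-1.
Proof.
move=> n0; have nR : 0 < n%:R :> R by rewrite ltr0n.
rewrite -ln_div ?posrE ?ltr0n //.
have -> : n.+1%:R / n%:R = 1 + n%:R^-1 :> R.
  by rewrite -natr1 mulrDl divff ?gt_eqF // mul1r.
by apply: le_ln1Dx; rewrite (lt_trans (ltrN10 _)) // invr_gt0.
Qed.

Lemma ln_nat_ge0 (n : nat) : 0 <= ln (n%:R : R).
Proof. by case: n => [|n]; [rewrite ln0|apply: ln_ge0; rewrite ler1n]. Qed.

Lemma ler_ln_nat (m n : nat) : (0 < m <= n)%N -> ln (m%:R : R) <= ln n%:R.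
Proof.
move=> /andP[m0 mn]; rewrite ler_ln ?posrE ?ltr0n ?ler_nat //.
exact: leq_trans mn.
Qed.

(** The quotient ln n / n increases up to n = 3. Adding 1 to the logarithm makes the weight decrease
    from n = 1 on, as [abel_bound] requires. *)
Lemma ln_over_decr (n : nat) : (0 < n)%N ->
  (1 + ln (n.+1%:R : R)) / n.+1%:R <= (1 + ln n%:R) / n%:R.
Proof.
move=> n0; have nR : 0 < n%:R :> R by rewrite ltr0n.
have n1R : 0 < n.+1%:R :> R by rewrite ltr0n.
rewrite ler_pdivrMr // mulrAC ler_pdivlMr //.
have h := ln_succ n0; have l0 := ln_nat_ge0 n.
have : (ln (n.+1%:R : R) - ln n%:R) * n%:R <= 1.
  by rewrite -ler_pdivlMr // div1r.
rewrite -natr1; nra.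
Qed.

Definition lnfact (x : nat) : R := \sum_(1 <= k < x.+1) ln k%:R.

Lemma lnfact_ge (x : nat) : x%:R * ln x%:R - x%:R <= lnfact x.
Proof.
rewrite /lnfact; elim: x => [|x IH]; first by rewrite mul0r subr0 big_nil.
rewrite big_nat1_recr; case: x IH => [|x] IH.
  by rewrite big_nil ln1; lra.
have h := @ln_succ x.+1 isT; have xR : 0 < x.+1%:R :> R by rewrite ltr0n.
have : (ln (x.+2%:R : R) - ln x.+1%:R) * x.+1%:R <= 1.
  by rewrite -ler_pdivlMr // div1r.
have x2R : x.+2%:R = x.+1%:R + 1 :> R by rewrite natr1.
move: (ln x.+2%:R) (ln x.+1%:R) (\sum_(1 <= k < x.+2) _) IH => k l T.
rewrite x2R; lra.
Qed.

Lemma lnfact_le (x : nat) : lnfact x <= x%:R * ln x%:R.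
Proof.
have -> : x%:R * ln x%:R = \sum_(1 <= k < x.+1) ln (x%:R : R).
  by rewrite sumr_const_nat subSS subn0 mulr_natl.
apply: ler_sum_nat => k kx; exact: ler_ln_nat.
Qed.

Lemma lnfact_mangoldt (x : nat) :
  lnfact x = \sum_(1 <= d < x.+1) mangoldt d * (x %/ d)%:R.
Proof.
transitivity (\sum_(1 <= k < x.+1) \sum_(d <- divisors k) @mangoldt R d).
  by apply: eq_big_nat => k /andP[k0 _]; rewrite sum_mangoldt.
rewrite (sum_convolution x (fun d _ => mangoldt d)); apply: eq_bigr => d _.
by rewrite sumr_const_nat subSS subn0 mulr_natr.
Qed.

Definition chebyshev (x : nat) : R := \sum_(1 <= d < x.+1) mangoldt d.

(** The left side is the logarithm of the central binomial coefficient, which each step of n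
    multiplies by at most 4, and ln 4 is at most 2. *)
Lemma lnfact_double (n : nat) : lnfact n.*2 - lnfact n *+ 2 <= n.*2%:R.
Proof.
rewrite /lnfact; elim: n => [|n IH]; first by rewrite !big_nil mul0rn subrr.
rewrite doubleS !big_nat1_recr.
have e1 : ln (n.*2.+2%:R : R) = ln 2 + ln n.+1%:R.
  by rewrite -lnM ?posrE ?ltr0n // -natrM -doubleS mul2n.
have e2 : ln (n.*2.+1%:R : R) <= ln 2 + ln n.+1%:R.
  by rewrite -e1 ler_ln_nat //=.
have e3 : ln (2 : R) <= 1.
  by have -> : 2 = 1 + 1 :> R by []; apply: le_ln1Dx; lra.
have e4 : n.*2.+2%:R = n.*2%:R + 2 :> R by rewrite -[n.*2.+2]addn2 natrD.
move: e1 e2 e3 IH; rewrite e4 !mulr2n => -> e2 e3 IH; lra.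
Qed.

(** In [lnfact n.*2 - lnfact n *+ 2] the coefficient of [mangoldt d] is floor(2n/d) - 2 floor(n/d),
    never negative, and at least 1 for n < d <= 2n. *)
Lemma chebyshev_le_double (n : nat) :
  chebyshev n.*2 - chebyshev n <= n.*2%:R.
Proof.
apply: le_trans (lnfact_double n); rewrite !lnfact_mangoldt.
have nn : (n <= n.*2)%N by rewrite -addnn leq_addr.
rewrite (@big_cat_nat _ _ _ n.+1 1 n.*2.+1) //=.
have -> : chebyshev n.*2 - chebyshev n = \sum_(n.+1 <= d < n.*2.+1) mangoldt d.
  by rewrite sum_tail.
rewrite -sumrMnl addrAC -sumrB; apply: ler_wpDl.
  rewrite big_nat; apply: sumr_ge0 => d /andP[d0 _].
  rewrite -mulrnAr -mulrBr mulr_ge0 ?mangoldt_ge0 // -mulrnA subr_ge0.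
  rewrite ler_nat leq_divRL // mulnAC -mul2n mulnC leq_mul2l /=.
  by rewrite leq_trunc_div.
apply: ler_sum_nat => d /andP[nd dn]; apply: ler_peMr (mangoldt_ge0 _) _.
by rewrite ler1n divn_gt0 // (leq_ltn_trans _ nd).
Qed.

Lemma ler_chebyshev (m n : nat) : (m <= n)%N -> chebyshev m <= chebyshev n.
Proof.
move=> mn; rewrite -subr_ge0 /chebyshev -sum_tail //.
by apply: sumr_ge0 => d _; exact: mangoldt_ge0.
Qed.

Lemma chebyshev_le (x : nat) : chebyshev x <= 4 * x%:R.
Proof.
elim/ltn_ind: x => x IH; case: (posnP x) => [->|x0].
  by rewrite /chebyshev big_nil mulr0.
have [->|x1] := eqVneq x 1%N.
  by rewrite /chebyshev big_nat1 mangoldt1 mulr1.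
(* Induction and doubling give 4 m + 2 m = 6 m, which is at most 4 x for x >= 2, with equality at x
   = 3: hence the constant 4. *)
pose m := uphalf x.
have mx : (m < x)%N by rewrite /m; lia.
have x2 : (x <= m.*2)%N by rewrite /m; lia.
have h : (6 * m <= 4 * x)%N by rewrite /m; lia.
have := ler_chebyshev x2; have := IH m mx; have := chebyshev_le_double m.
have : 6 * m%:R <= 4 * x%:R :> R by rewrite -!natrM ler_nat.
rewrite -muln2 natrM; lra.
Qed.

Lemma floor_div_bounds (x d : nat) : (0 < d)%N ->
  (x %/ d)%:R <= x%:R / d%:R :> R /\ x%:R / d%:R <= (x %/ d)%:R + 1 :> R.
Proof.
move=> d0; have dR : 0 < d%:R :> R by rewrite ltr0n.
rewrite ler_pdivlMr // ler_pdivrMr // natr1 -!natrM !ler_nat leq_trunc_div.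
by split=> //; rewrite ltnW // ltn_ceil.
Qed.

Definition mertens (x : nat) : R := \sum_(1 <= d < x.+1) mangoldt d / d%:R.

(** Replacing each x / d by its floor turns [x * mertens x] into [lnfact x], with an error of at
    most [chebyshev x], itself at most 4 x. *)
Lemma mertens_le (x : nat) : (0 < x)%N -> mertens x <= ln x%:R + 4.
Proof.
move=> x0; have xR : 0 < x%:R :> R by rewrite ltr0n.
rewrite -(ler_pM2l xR).
have : x%:R * mertens x <= lnfact x + chebyshev x.
  rewrite lnfact_mangoldt -big_split /= /mertens mulr_sumr.
  apply: ler_sum_nat => d /andP[d0 _].
  have [_ h] := floor_div_bounds x d0; have m0 := @mangoldt_ge0 R d.
  have -> : x%:R * (mangoldt d / d%:R) = mangoldt d * (x%:R / d%:R) :> R.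
    by ring.
  apply: le_trans (ler_wpM2l m0 h) _; lra.
have := lnfact_le x; have := chebyshev_le x; lra.
Qed.

Lemma mertens_ge (x : nat) : (0 < x)%N -> ln x%:R - 1 <= mertens x.
Proof.
move=> x0; have xR : 0 < x%:R :> R by rewrite ltr0n.
rewrite -(ler_pM2l xR).
have : lnfact x <= x%:R * mertens x.
  rewrite lnfact_mangoldt /mertens mulr_sumr.
  apply: ler_sum_nat => d /andP[d0 _].
  have [h _] := floor_div_bounds x d0; have m0 := @mangoldt_ge0 R d.
  have -> : x%:R * (mangoldt d / d%:R) = mangoldt d * (x%:R / d%:R) :> R.
    by ring.
  exact: ler_wpM2l.
have := lnfact_ge x; lra.
Qed.

Lemma sum_ln_quotient (x : nat) :
  \sum_(1 <= n < x.+1) (ln x%:R - ln n%:R) <= x%:R :> R.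
Proof.
rewrite sumrB sumr_const_nat subSS subn0 -[ln _ *+ _]mulr_natl.
have := lnfact_ge x; rewrite /lnfact; lra.
Qed.

Lemma ln_unbounded (B : R) : exists x : nat, (0 < x)%N /\ B < ln x%:R.
Proof.
pose x := (Num.truncn (sequences.expR B)).+1.
exists x; split=> //; rewrite -ltr_expR lnK ?posrE ?ltr0n //.
exact: truncnS_gt.
Qed.

Lemma sum_inv_powers (n K : nat) : (1 < n)%N ->
  \sum_(2 <= k < K.+1) (n%:R ^+ k)^-1 <= (n%:R * (n%:R - 1))^-1 :> R.
Proof.
move=> n1; have nR : 0 < n%:R :> R by rewrite ltr0n ltnW.
have n1R : 0 < n%:R - 1 :> R by rewrite subr_gt0 ltr1n.
case: K => [|K]; first by rewrite big_geq // invr_ge0 mulr_ge0 // ltW.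
have : \sum_(2 <= k < K.+2) (n%:R ^+ k)^-1 + (n%:R ^+ K.+1 * (n%:R - 1))^-1
    = (n%:R * (n%:R - 1))^-1 :> R.
  elim: K => [|K IH]; first by rewrite big_geq // add0r expr1.
  rewrite big_nat_recr //= -addrA -IH; congr (_ + _).
  have h : n%:R ^+ K.+1 != 0 :> R by rewrite expf_neq0 // gt_eqF.
  rewrite !(exprS _ K.+1) !invfM; move: (n%:R ^+ K.+1) h => y h.
  field; rewrite h !gt_eqF //.
have : 0 <= (n%:R ^+ K.+1 * (n%:R - 1))^-1 :> R.
  by rewrite invr_ge0 mulr_ge0 ?exprn_ge0 ?ltW.
lra.
Qed.

Lemma sum_ln_sq (x : nat) :
  \sum_(2 <= n < x.+1) ln n%:R / (n%:R * (n%:R - 1)) <= 2 :> R.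
Proof.
case: x => [|x]; first by rewrite big_geq.
(* The subtracted remainder telescopes: by [ln_succ] its drop at each step dominates the new
   term. *)
have : \sum_(2 <= n < x.+2) ln n%:R / (n%:R * (n%:R - 1))
   <= 2 - (2 + ln x.+1%:R) / x.+1%:R :> R.
  elim: x => [|x IH]; first by rewrite big_geq // ln1; lra.
  rewrite big_nat_recr //=.
  apply: (le_trans (lerD IH (lexx _))) => {IH}.
  have h := @ln_succ x.+1 isT; have l0 := ln_nat_ge0 x.+2.
  have xR : 0 < x.+1%:R :> R by rewrite ltr0n.
  have x2R : x.+2%:R = x.+1%:R + 1 :> R by rewrite natr1.
  have x1 : 1 <= x.+1%:R :> R by rewrite ler1n.
  move: (ln x.+2%:R) (ln x.+1%:R) h l0 => l k h l0; rewrite x2R.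
  move: (x.+1%:R) xR x1 h => y y0 y1 h.
  have hy : (l - k) * y <= 1.
    by rewrite -ler_pdivlMr // div1r.
  rewrite -subr_ge0.
  have -> : 2 - (2 + l) / (y + 1) - (2 - (2 + k) / y + l / ((y + 1) * (y + 1 - 1)))
    = (2 + k * (y + 1) - l * (y + 1)) / (y * (y + 1)).
    by field; rewrite !gt_eqF //; lra.
  apply: divr_ge0; nra.
have : 0 <= (2 + ln x.+1%:R) / x.+1%:R :> R.
  by rewrite divr_ge0 // addr_ge0 ?ln_nat_ge0.
by move=> h0 h; apply: (le_trans h); rewrite gerBl.
Qed.

End Analysis.

Section PrimePowers.
Context {R : realType}.

Lemma mangoldt_neq0 (d : nat) : @mangoldt R d != 0 ->
  exists p k, [/\ prime p, (0 < k)%N, d = (p ^ k)%N & @mangoldt R d = ln p%:R].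
Proof.
rewrite /mangoldt; case: ifP => [/andP[d1 /eqP dE] _|]; last by rewrite eqxx.
have d0 := ltnW d1; have pp : prime (pdiv d) by rewrite pdiv_prime.
exists (pdiv d), (logn (pdiv d) d); split=> //.
  by rewrite logn_gt0 mem_primes pp d0 pdiv_dvd.
by rewrite -p_part -[LHS](partnC (pdiv d) d0) dE muln1.
Qed.

(** Only proper prime powers count. Admitting all bases n >= 2 and exponents k >= 2 enlarges the sum
    to a geometric series in k, followed by [sum_ln_sq]. *)
Lemma sum_mangoldt_nonprime (x : nat) :
  \sum_(1 <= d < x.+1 | ~~ prime d) mangoldt d / d%:R <= 2 :> R.
Proof.
pose F d n k : R := if d == (n ^ k)%N then ln n%:R * (n%:R ^+ k)^-1 else 0.
have F0 d n k : 0 <= F d n k.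
  rewrite /F; case: ifP => // _.
  by rewrite mulr_ge0 ?ln_nat_ge0 // invr_ge0 exprn_ge0.
apply: (@le_trans _ _ (\sum_(1 <= d < x.+1) \sum_(2 <= n < x.+1)
    \sum_(2 <= k < x.+1) F d n k)).
  rewrite big_mkcond; apply: ler_sum_nat => d /andP[d0]; rewrite ltnS => dx.
  have S0 : 0 <= \sum_(2 <= n < x.+1) \sum_(2 <= k < x.+1) F d n k.
    by apply: sumr_ge0 => n _; apply: sumr_ge0.
  case: ifP => // npd; have [->|/mangoldt_neq0] := eqVneq (@mangoldt R d) 0.
    by rewrite mul0r.
  move=> [p [k [pp k0 dE ->]]]; have p1 := prime_gt1 pp.
  have k1 : (1 < k)%N.
    by case: k k0 dE => // -[|//] _ dE; rewrite dE expn1 pp in npd.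
  have pd : (p <= d)%N by rewrite dE -{1}(expn1 p) leq_exp2l.
  have kd : (k <= d)%N by rewrite dE ltnW // ltn_expl.
  rewrite (bigD1_seq p) ?iota_uniq ?mem_index_iota ?p1 ?ltnS ?(leq_trans pd) //=.
  rewrite (bigD1_seq k) ?iota_uniq ?mem_index_iota ?k1 ?ltnS ?(leq_trans kd) //=.
  have -> : ln p%:R / d%:R = F d p k by rewrite /F (introT eqP dE) dE natrX.
  rewrite -addrA lerDl; apply: addr_ge0; first by apply: sumr_ge0.
  by apply: sumr_ge0 => n _; apply: sumr_ge0.
rewrite exchange_big /=; apply: le_trans (sum_ln_sq x).
apply: ler_sum_nat => n /andP[n1 _].
apply: le_trans (ler_wpM2l (ln_nat_ge0 n) (sum_inv_powers x n1)).
rewrite exchange_big /= mulr_sumr; apply: ler_sum => k _.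
have z0 : 0 <= ln n%:R * (n%:R ^+ k)^-1 :> R.
  by rewrite mulr_ge0 ?ln_nat_ge0 // invr_ge0 exprn_ge0.
have [nkx|nkx] := boolP ((n ^ k)%N \in index_iota 1 x.+1).
  rewrite (bigD1_seq (n ^ k)%N) ?iota_uniq //= /F eqxx big1 ?addr0 // => d.
  by move=> /negbTE ->.
rewrite big_seq big1 // => d dx; rewrite /F; case: eqP => // dE.
by rewrite -dE dx in nkx.
Qed.

End PrimePowers.

(** * Real characters and the Lambert series *)

Lemma perm_divisors_coprime (p k m : nat) : prime p -> (0 < m)%N ->
  ~~ (p %| m)%N ->
  perm_eq [seq d <- divisors (p ^ k * m) | ~~ (p %| d)%N] (divisors m).
Proof.
move=> pp m0 pm; apply: uniq_perm; rewrite ?filter_uniq ?divisors_uniq // => d.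
have pk0 : (0 < p ^ k * m)%N by rewrite muln_gt0 expn_gt0 prime_gt0.
rewrite mem_filter -!dvdn_divisors //; apply/andP/idP => [[pd]|dm].
  by rewrite Gauss_dvdr // coprime_sym coprimeXl // prime_coprime.
split; last exact: dvdn_mull.
by apply: contraNN pm => /dvdn_trans; apply.
Qed.

Section RealNonvanishing.
Context {R : realType}.
Variable a : nat -> R.
Hypothesis a1 : a 1 = 1.
Hypothesis aM : forall m n, a (m * n)%N = a m * a n.
Hypothesis aV : forall n, a n = 0 \/ a n = 1 \/ a n = -1.

Definition divisor_sum (n : nat) : R := \sum_(d <- divisors n) a d.

Lemma divisor_sum_primepow (p k m : nat) :
  prime p -> (0 < m)%N -> ~~ (p %| m)%N ->
  divisor_sum (p ^ k * m) = (\sum_(i < k.+1) a p ^+ i) * divisor_sum m.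
Proof.
move=> pp m0 pm; elim: k => [|k IH].
  by rewrite expn0 mul1n big_ord1 expr0 mul1r.
rewrite /divisor_sum expnS -mulnA sum_divisors_prime_mul //; last first.
  by rewrite muln_gt0 expn_gt0 prime_gt0.
rewrite -big_filter (perm_big _ (perm_divisors_coprime k pp m0 pm)).
have -> : \sum_(e <- divisors (p ^ k * m)) a (p * e)
    = a p * divisor_sum (p ^ k * m).
  by rewrite mulr_sumr; apply: eq_bigr => e _; rewrite aM.
rewrite IH [in RHS]big_ord_recl expr0 mulrDl mul1r mulrA.
congr (_ + _ * _); rewrite mulr_sumr.
by apply: eq_bigr => i _; rewrite -exprS.
Qed.

Lemma sign_geom_ge0 (x : R) (k : nat) : x = 0 \/ x = 1 \/ x = -1 ->
  0 <= \sum_(i < k.+1) x ^+ i.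
Proof.
case=> [->|[->|->]].
- by apply: sumr_ge0 => i _; rewrite exprn_ge0.
- by apply: sumr_ge0 => i _; rewrite exprn_ge0.
have -> : \sum_(i < k.+1) (-1) ^+ i = (~~ odd k)%:R :> R; last exact: ler0n.
elim: k => [|k IH]; first by rewrite big_ord1 expr0.
rewrite big_ord_recr /= IH -signr_odd /=.
by case: (odd k); rewrite /= ?expr0 ?expr1 ?add0r ?subrr.
Qed.

Lemma sign_geom_ge1 (x : R) (k : nat) : x = 0 \/ x = 1 \/ x = -1 ->
  1 <= \sum_(i < k.*2.+1) x ^+ i.
Proof.
move=> h; elim: k => [|k IH]; first by rewrite big_ord1 expr0.
rewrite doubleS 2!big_ord_recr /=; apply: (le_trans IH).
rewrite -addrA lerDl !exprS -muln2 exprM.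
move: (sqr_ge0 (x ^+ k)); move: (_ ^+ 2) => y y0.
by case: h => [->|[->|->]]; lra.
Qed.

Lemma divisor_sum_ge0 (n : nat) : (0 < n)%N -> 0 <= divisor_sum n.
Proof.
elim/ltn_ind: n => n IH n0.
have [->|n1] := eqVneq n 1%N; first by rewrite /divisor_sum big_seq1 a1.
have [p pp pn] : exists2 p, prime p & (p %| n)%N.
  by exists (pdiv n); rewrite ?pdiv_dvd ?pdiv_prime // ltn_neqAle eq_sym n1.
have kn : (0 < logn p n)%N by rewrite logn_gt0 mem_primes pp n0 pn.
case: (pfactor_coprime pp n0) kn => m pm nE; move: (logn _ _) nE => k nE k0.
rewrite prime_coprime // in pm.
have m0 : (0 < m)%N by case: m nE {pm} => // nE; rewrite nE mul0n in n0.
rewrite nE mulnC divisor_sum_primepow // mulr_ge0 ?sign_geom_ge0 //.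
apply: IH => //; rewrite nE ltn_Pmulr // -{1}(exp1n k) ltn_exp2r //.
exact: prime_gt1.
Qed.

Lemma divisor_sum_square (n : nat) : (0 < n)%N -> 1 <= divisor_sum (n ^ 2).
Proof.
elim/ltn_ind: n => n IH n0.
have [->|n1] := eqVneq n 1%N; first by rewrite /divisor_sum exp1n big_seq1 a1.
have [p pp pn] : exists2 p, prime p & (p %| n)%N.
  by exists (pdiv n); rewrite ?pdiv_dvd ?pdiv_prime // ltn_neqAle eq_sym n1.
have kn : (0 < logn p n)%N by rewrite logn_gt0 mem_primes pp n0 pn.
case: (pfactor_coprime pp n0) kn => m pm nE; move: (logn _ _) nE => k nE k0.
rewrite prime_coprime // in pm.
have m0 : (0 < m)%N by case: m nE {pm} => // nE; rewrite nE mul0n in n0.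
have h : 1 <= divisor_sum (m ^ 2).
  apply: IH => //; rewrite nE ltn_Pmulr // -{1}(exp1n k) ltn_exp2r //.
  exact: prime_gt1.
rewrite nE mulnC expnMn -expnM muln2 divisor_sum_primepow ?expn_gt0 ?m0 //.
  by rewrite -(mulr1 1) ler_pM // sign_geom_ge1.
by rewrite Euclid_dvdX // negb_and pm.
Qed.

Definition geom (t : R) (n : nat) : R := \sum_(i < n) t ^+ i.

Lemma geomE t n : (1 - t) * geom t n = 1 - t ^+ n.
Proof. by rewrite -[RHS]opprB subrX1 -mulNr opprB. Qed.

(** The exponents i and n - i are paired by the arithmetic-geometric inequality. The square root s
    of t avoids half-integral exponents. *)
Lemma geom_ge (s : R) n : 0 <= s -> n.+1%:R * s ^+ n <= geom (s ^+ 2) n.+1.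
Proof.
move=> s0.
have h : geom (s ^+ 2) n.+1 *+ 2
    = \sum_(i < n.+1) ((s ^+ i) ^+ 2 + (s ^+ (n - i)) ^+ 2).
  rewrite big_split /= mulr2n /geom; congr (_ + _).
    by apply: eq_bigr => i _; rewrite exprAC.
  rewrite [LHS](reindex_inj rev_ord_inj) /=.
  by apply: eq_bigr => i _; rewrite exprAC subSS.
have : n.+1%:R * s ^+ n *+ 2 <= geom (s ^+ 2) n.+1 *+ 2.
  have -> : n.+1%:R * s ^+ n *+ 2 = \sum_(i < n.+1) (s ^+ n *+ 2).
    by rewrite sumr_const card_ord mulr_natl mulrnAC.
  rewrite h; apply: ler_sum => i _.
  have -> : s ^+ n = s ^+ i * s ^+ (n - i).
    by rewrite -exprD subnKC // -ltnS.
  have := sqr_ge0 (s ^+ i - s ^+ (n - i)); rewrite sqrrB; lra.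
by rewrite !mulr2n; lra.
Qed.

Section Lambert.
Variables (s C : R).
Hypothesis s01 : 0 < s < 1.
Hypothesis aC : forall x, `|\sum_(1 <= n < x.+1) a n| <= C.
Hypothesis aL : forall x, `|\sum_(1 <= n < x.+1) a n / n%:R| <= C / x.+1%:R.
Let t := s ^+ 2.

Let t01 : 0 < t < 1.
Proof. by move: s01 => /andP[h1 h2]; rewrite exprn_gt0 //= expr_lte1 // ltW. Qed.

Let geom_gt0 n : 0 < geom t n.+1.
Proof.
have /andP[t0 _] := t01.
rewrite /geom big_ord_recl expr0 ltr_pwDl //; apply: sumr_ge0 => i _.
by rewrite exprn_ge0 // ltW.
Qed.

(** As [geom t n] is (1 - t^n) / (1 - t), this is 1/(n (1 - t)) - t^n/(1 - t^n): the leading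
    behaviour, as t tends to 1, of the Lambert term of n, minus that term. *)
Definition lambert_weight (n : nat) : R := (n%:R^-1 - t ^+ n / geom t n) / (1 - t).

Lemma geom_mean_ge (n : nat) : n.+1%:R * t ^+ n <= geom t n.+1.
Proof.
have /andP[s0 s1] := s01; apply: le_trans (geom_ge n (ltW s0)).
rewrite ler_wpM2l // /t -exprM mulnC mulnS muln1.
by apply: ler_wiXn2l; rewrite ?ltW // leq_addr.
Qed.

Lemma lambert_weight_ge0 n : (0 < n)%N -> 0 <= lambert_weight n.
Proof.
case: n => // n _; have /andP[t0 t1] := t01; have g0 := geom_gt0 n.
rewrite /lambert_weight divr_ge0 ?subr_ge0 ?(ltW t1) //.
rewrite ler_pdivrMr // ler_pdivlMl ?ltr0n //.
apply: le_trans (geom_mean_ge n); rewrite ler_wpM2l // exprS.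
by rewrite ger_pMl; [exact: ltW|exact: exprn_gt0].
Qed.

Lemma lambert_weight_decr n : (0 < n)%N ->
  lambert_weight n.+1 <= lambert_weight n.
Proof.
case: n => // n _; have /andP[t0 t1] := t01; have /andP[s0 s1] := s01.
have g0 := geom_gt0 n; have g1 := geom_gt0 n.+1.
rewrite /lambert_weight ler_pM2r ?invr_gt0 ?subr_gt0 //.
have n1 : 0 < n.+1%:R :> R by rewrite ltr0n.
have n2 : 0 < n.+2%:R :> R by rewrite ltr0n.
(* After clearing denominators this is the claim. It is the product of two cases of [geom_ge], whose
   powers of s add up to 2n + 1, one less than the 2n + 2 in [t ^+ n.+1]. *)
have key : n.+1%:R * n.+2%:R * t ^+ n.+1 <= geom t n.+1 * geom t n.+2.
  have h1 := geom_ge n (ltW s0); have h2 := geom_ge n.+1 (ltW s0).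
  have : (n.+1%:R * s ^+ n) * (n.+2%:R * s ^+ n.+1)
      <= geom t n.+1 * geom t n.+2.
    by apply: ler_pM => //; rewrite mulr_ge0 // exprn_ge0 // ltW.
  apply: le_trans.
  rewrite mulrACA -exprD ler_wpM2l ?mulr_ge0 //.
  by rewrite /t -exprM; apply: ler_wiXn2l; rewrite ?ltW //; lia.
rewrite -subr_ge0.
have gS : geom t n.+2 = 1 + t * geom t n.+1.
  rewrite /geom big_ord_recl expr0 mulr_sumr; congr (_ + _).
  by apply: eq_bigr => i _; rewrite -exprS.
have -> : n.+1%:R^-1 - t ^+ n.+1 / geom t n.+1
      - (n.+2%:R^-1 - t ^+ n.+2 / geom t n.+2)
    = (geom t n.+1 * geom t n.+2 - n.+1%:R * n.+2%:R * t ^+ n.+1)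
      / (n.+1%:R * n.+2%:R * (geom t n.+1 * geom t n.+2)).
  have n2E : n.+2%:R = n.+1%:R + 1 :> R by rewrite natr1.
  have g1' : 1 + t * geom t n.+1 != 0 by rewrite -gS gt_eqF.
  rewrite n2E in n2 *.
  rewrite gS (exprS _ n.+1).
  move: (geom t n.+1) (n.+1%:R) (t ^+ n.+1) g0 n1 n2 g1' => g m u g0 m0 m1 g1'.
  by field; rewrite g1' !gt_eqF.
by rewrite divr_ge0 ?subr_ge0 // ?mulr_ge0 // ltW.
Qed.

Lemma lambert_weight1 : lambert_weight 1 = 1.
Proof.
have /andP[t0 t1] := t01.
rewrite /lambert_weight /geom big_ord1 expr0 expr1 !divr1 invr1 divff //.
by rewrite subr_eq0 gt_eqF.
Qed.

(** The truncated Lambert series has three parts: a partial sum of a n / n, small by [aL]; the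
    weights, at most 2C by Abel summation because [lambert_weight 1 = 1]; and the truncation error.
    For fixed s only the 2C, uniform in s, survives as Y grows. *)
Lemma lambert_bound (Y : nat) : (0 < Y)%N ->
  \sum_(1 <= j < Y.*2.+1) divisor_sum j * t ^+ j
    <= C *+ 2 + C / (1 - t) / Y%:R + 2 / (1 - t) ^+ 3 / Y%:R.
Proof.
move=> Y0; have /andP[t0 t1] := t01; have t1' : 0 < 1 - t by rewrite subr_gt0.
have C0 : 0 <= C by apply: le_trans (aC 0).
have YR : 0 < Y%:R :> R by rewrite ltr0n.
set X := Y.*2.
pose q n := (X %/ n)%N.
have e1 : \sum_(1 <= j < X.+1) divisor_sum j * t ^+ j
   = \sum_(1 <= n < X.+1) a n * \sum_(1 <= k < (q n).+1) t ^+ (n * k).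
  transitivity (\sum_(1 <= j < X.+1) \sum_(d <- divisors j)
      a d * t ^+ (d * (j %/ d))).
    apply: eq_big_nat => j /andP[j0 _]; rewrite mulr_suml.
    rewrite big_seq [RHS]big_seq; apply: eq_bigr => d.
    by rewrite -dvdn_divisors // => dj; rewrite mulnC divnK.
  rewrite (sum_convolution X (fun d m => a d * t ^+ (d * m))).
  by apply: eq_bigr => d _; rewrite mulr_sumr.
have e2 n : (0 < n)%N -> \sum_(1 <= k < (q n).+1) t ^+ (n * k)
   = (n%:R^-1 / (1 - t) - lambert_weight n) - t ^+ (n * (q n).+1) / (1 - t ^+ n).
  move=> n0; have tn : 0 < 1 - t ^+ n.
    by rewrite subr_gt0 expr_lt1 ?ltW.
  have gn : geom t n = (1 - t ^+ n) / (1 - t).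
    by rewrite -geomE mulrAC divff ?mul1r // gt_eqF.
  have -> : n%:R^-1 / (1 - t) - lambert_weight n = t ^+ n / (1 - t ^+ n).
    rewrite /lambert_weight gn mulrBl opprB addrC subrK.
    by field; rewrite !gt_eqF.
  apply: (mulIf (x := 1 - t ^+ n)); first by rewrite gt_eqF.
  rewrite mulrBl !divfK ?gt_eqF //.
  elim: (q n) => [|k IH]; first by rewrite big_geq // muln1 subrr mul0r.
  rewrite big_nat_recr //= mulrDl IH (mulnS n k.+1) exprD; ring.
rewrite e1 (eq_big_nat _ _ (F2 := fun n => (1 - t)^-1 * (a n / n%:R)
   - a n * lambert_weight n - a n * (t ^+ (n * (q n).+1) / (1 - t ^+ n)))); last first.
  by move=> n /andP[n0 _]; rewrite e2 //; ring.
rewrite !sumrB -mulr_sumr.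
have b1 : (1 - t)^-1 * (\sum_(1 <= n < X.+1) a n / n%:R) <= C / (1 - t) / Y%:R.
  rewrite mulrC ler_pdivrMr //.
  apply: le_trans (ler_norm _) _; apply: le_trans (aL X) _.
  rewrite mulrAC divfK ?gt_eqF //; apply: ler_wpM2l => //.
  by rewrite lef_pV2 ?posrE ?ltr0n // ler_nat /X; lia.
have b2 : - (\sum_(1 <= n < X.+1) a n * lambert_weight n) <= C *+ 2.
  apply: le_trans (ler_norm _) _; rewrite normrN.
  rewrite -[X in _ <= X]mulr1 -lambert_weight1.
  exact: (@abel_bound R a _ C 0 X aC lambert_weight_ge0 lambert_weight_decr).
have b3 : - (\sum_(1 <= n < X.+1) a n * (t ^+ (n * (q n).+1) / (1 - t ^+ n)))
    <= 2 / (1 - t) ^+ 3 / Y%:R.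
  apply: le_trans (ler_norm _) _; rewrite normrN.
  apply: le_trans (ler_norm_sum _ _ _) _.
  apply: (@le_trans _ _ (\sum_(1 <= n < X.+1) t ^+ X / (1 - t))).
    apply: ler_sum_nat => n /andP[n0 _].
    have tn : 0 < 1 - t ^+ n by rewrite subr_gt0 expr_lt1 ?ltW.
    rewrite normrM -[X in _ <= X]mul1r; apply: ler_pM => //.
      by case: (aV n) => [->|[->|->]]; rewrite ?normrN ?normr0 ?normr1.
    have tX k : 0 <= t ^+ k by apply: exprn_ge0; apply: ltW.
    rewrite ger0_norm; last by rewrite divr_ge0 ?tX ?(ltW tn).
    apply: ler_pM; rewrite ?tX ?invr_ge0 ?(ltW tn) //.
      by apply: ler_wiXn2l; rewrite ?ltW // mulnC ltnW // -ltn_divLR.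
    rewrite lef_pV2 ?posrE // lerD2l lerN2.
    by rewrite -{2}(expr1 t); apply: ler_wiXn2l; rewrite ?ltW.
  rewrite sumr_const_nat subSS subn0.
  (* With X = 2Y, [t ^+ X] is a square: one factor [t ^+ Y] pays for the number X of terms, the
     other for the decay 1/Y. *)
  have h : Y%:R * t ^+ Y <= (1 - t)^-1.
    apply: (@le_trans _ _ (geom t Y)).
      case: (Y) Y0 => // y _; apply: le_trans (geom_mean_ge y).
      by rewrite ler_wpM2l // exprS ger_pMl; [exact: ltW|exact: exprn_gt0].
    rewrite -[X in _ <= X]mul1r ler_pdivlMr // mulrC geomE gerBl.
    by rewrite exprn_ge0 // ltW.
  have h0 : 0 <= Y%:R * t ^+ Y by rewrite mulr_ge0 // exprn_ge0 // ltW.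
  rewrite ler_pdivlMr //.
  have -> : t ^+ X / (1 - t) *+ X * Y%:R = 2 * (Y%:R * t ^+ Y) ^+ 2 / (1 - t).
    have -> : t ^+ X = (t ^+ Y) ^+ 2 by rewrite -exprM muln2.
    by rewrite -[_ *+ X]mulr_natr -[X in X%:R]/(Y.*2) -muln2 natrM; ring.
  have -> : 2 / (1 - t) ^+ 3 = 2 * ((1 - t)^-1) ^+ 2 / (1 - t) :> R.
    by field; rewrite gt_eqF.
  rewrite ler_pM2r ?invr_gt0 // ler_pM2l // ler_pXn2r ?nnegrE //.
  by rewrite invr_ge0 ltW.
lra.
Qed.

End Lambert.

(* Monsky's proof that [L(1, a) <> 0]: with [t = s ^ 2 < 1], Lambert's series turns the vanishing of [\sum a n / n] into a bound, uniform in [t], for [\sum A(j) t ^ j], where [A] is nonnegative and at least [1] at squares. *)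
Lemma real_nonvanishing (C : R) :
  (forall x, `|\sum_(1 <= n < x.+1) a n| <= C) ->
  (forall x, `|\sum_(1 <= n < x.+1) a n / n%:R| <= C / x.+1%:R) -> False.
Proof.
move=> aC aL; have C0 : 0 <= C by apply: le_trans (aC 0).
pose m := (Num.truncn (C *+ 4 + 4)).+1.
have mC : C *+ 4 + 4 < m%:R by exact: truncnS_gt.
have m0 : 0 < m%:R :> R by rewrite ltr0n.
pose J := (m ^ 2)%N.
have JR : 0 < J%:R :> R by rewrite ltr0n expn_gt0.
(* By Bernoulli's inequality [t ^+ k] is at least 1/2 for k <= J. The m squares up to J then
   contribute at least m/2 > 2C + 2, whereas [lambert_bound] allows at most 2C + 1 once Y exceeds
   D. *)
pose s : R := 1 - (4 * J%:R)^-1.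
have JV : 0 < (4 * J%:R)^-1 :> R by rewrite invr_gt0 mulr_gt0.
have JV4 : (4 * J%:R)^-1 <= 4^-1 :> R.
  by rewrite lef_pV2 ?posrE ?mulr_gt0 // ler_peMr // ler1n expn_gt0.
have s01 : 0 < s < 1 by rewrite /s; lra.
have tJ k : (k <= J)%N -> 2^-1 <= (s ^+ 2) ^+ k.
  move=> kJ.
  have bern n : 1 - n%:R * (4 * J%:R)^-1 <= s ^+ n.
    elim: n => [|n IH]; first by rewrite mul0r subr0 expr0.
    rewrite exprS -natr1.
    have : s * (1 - n%:R * (4 * J%:R)^-1) <= s * s ^+ n.
      by apply: ler_wpM2l => //; lra.
    have : 0 <= n%:R * ((4 * J%:R)^-1 * (4 * J%:R)^-1) :> R.
      by rewrite !mulr_ge0 // ltW.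
    rewrite /s; move: (_^-1) (n%:R) (_ ^+ n) => u v w; lra.
  rewrite -exprM; apply: le_trans (bern _).
  have : (2 * k)%:R * (4 * J%:R)^-1 <= 2^-1 :> R.
    rewrite ler_pdivrMr ?mulr_gt0 // natrM.
    have : k%:R <= J%:R :> R by rewrite ler_nat.
    lra.
  lra.
have t1 : 0 < 1 - s ^+ 2 by rewrite subr_gt0 expr_lt1 ?(andP s01).2 // ltW // (andP s01).1.
pose D := C / (1 - s ^+ 2) + 2 / (1 - s ^+ 2) ^+ 3.
pose Y := (maxn J (Num.truncn D)).+1.
have YD : D < Y%:R.
  apply: lt_le_trans (truncnS_gt _) _; rewrite ler_nat ltnS.
  exact: leq_maxr.
have JY : (J <= Y)%N by rewrite leqW // leq_maxl.
have Y0 : 0 < Y%:R :> R by rewrite ltr0n.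
have := lambert_bound s01 aC aL (ltn0Sn (maxn J (Num.truncn D))).
rewrite -/Y -addrA -mulrDl -/D.
have : D / Y%:R <= 1 by rewrite ler_pdivrMr // mul1r ltW.
have : m%:R / 2 <= \sum_(1 <= j < Y.*2.+1) divisor_sum j * (s ^+ 2) ^+ j.
  have pos j : (0 < j)%N -> 0 <= divisor_sum j * (s ^+ 2) ^+ j.
    by move=> j0; rewrite mulr_ge0 ?divisor_sum_ge0 // exprn_ge0 // sqr_ge0.
  rewrite (@big_cat_nat _ _ _ J.+1) //=; last first.
    by rewrite ltnS (leq_trans JY) // -addnn leq_addr.
  apply: ler_wpDr.
    by rewrite big_nat; apply: sumr_ge0 => j /andP[jJ _]; rewrite pos // (leq_trans _ jJ).
  have -> : m%:R / 2 = \sum_(1 <= r < m.+1) 2^-1 :> R.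
    by rewrite sumr_const_nat subSS subn0 mulr_natl.
  apply: (@le_trans _ _ (\sum_(1 <= j < J.+1) \sum_(1 <= r < m.+1)
     if j == (r ^ 2)%N then divisor_sum j * (s ^+ 2) ^+ j else 0)).
    rewrite exchange_big /=; apply: ler_sum_nat => r /andP[r0 rm].
    have rJ : (r ^ 2 <= J)%N by rewrite leq_sqr.
    rewrite (bigD1_seq (r ^ 2)%N) ?iota_uniq //=; last first.
      by rewrite mem_index_iota expn_gt0 r0.
    rewrite eqxx big1 ?addr0; last by move=> j /negbTE ->.
    rewrite -[X in X <= _]mul1r; apply: ler_pM; rewrite ?invr_ge0 //.
      exact: divisor_sum_square.
    exact: tJ.
  apply: ler_sum_nat => j /andP[j0 jJ].
  have [[r jE]|nsq] := pselect (exists r, j = (r ^ 2)%N).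
    have [rm|rm] := boolP (r \in index_iota 1 m.+1).
      rewrite (bigD1_seq r) ?iota_uniq //= {1}jE eqxx big1 ?addr0 // => i ir.
      by case: eqP => // /eqP; rewrite jE eqn_sqr eq_sym (negbTE ir).
    rewrite big_seq big1 ?pos // => i im; case: eqP => // /eqP.
    by rewrite jE eqn_sqr => /eqP rE; rewrite rE im in rm.
  rewrite big1 ?pos // => i _; case: eqP => // jE; case: nsq; by exists i.
lra.
Qed.

End RealNonvanishing.

(** * Sums over integers and primes twisted by functions on a finite abelian group *)

Section Twisted.
Context {R : realType} {G : finGroupType}.
Variables (nu : nat -> G) (P : pred nat).
Hypothesis GC : forall a b : G, (a * b = b * a)%g.
Hypothesis P1 : P 1.
Hypothesis nu1 : nu 1%N = 1%g.
Hypothesis PM : forall m n, P (m * n)%N = P m && P n.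
Hypothesis nuM : forall m n, P m -> P n -> nu (m * n)%N = (nu m * nu n)%g.
Implicit Types (f v l : G -> R) (g h : G).

(** In the application [P] is coprimality to the modulus and [nu] the residue class. Indices outside
    [P] act by 0, just as a Dirichlet character vanishes there. *)
Definition shift f (n : nat) g : R := if P n then f (nu n * g)%g else 0.

Definition mean0 f := \sum_g f g = 0.

Hypothesis equidistribution : forall f, mean0 f ->
  exists C : R, forall x g, `|\sum_(1 <= n < x.+1) shift f n g| <= C.

Lemma shift1 f g : shift f 1 g = f g.
Proof. by rewrite /shift P1 nu1 mul1g. Qed.

Lemma shift_sum f m (r : seq nat) (c : nat -> R) g :
  \sum_(n <- r) c n * shift f (m * n) g
    = shift (fun g' => \sum_(n <- r) c n * shift f n g') m g.
Proof.
rewrite [RHS]/shift; case: (boolP (P m)) => Pm; last first.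
  by rewrite big1 // => n _; rewrite /shift PM (negbTE Pm) mulr0.
apply: eq_bigr => n _; rewrite /shift PM Pm /=; case: ifP => // Pn.
by rewrite nuM // [(nu m * _)%g]GC mulgA.
Qed.

Lemma shift_norm f C n g : (forall g', `|f g'| <= C) -> `|shift f n g| <= C.
Proof.
move=> fC; rewrite /shift; case: ifP => // _.
by rewrite normr0; apply: le_trans (fC g).
Qed.

Lemma mean0_shift f n : mean0 f -> mean0 (shift f n).
Proof.
move=> f0; rewrite /mean0 /shift; case: (P n); last by rewrite big1.
by rewrite -[RHS]f0 [RHS](reindex_inj (mulgI (nu n))).
Qed.

Lemma le0_of_le_div (c C : R) : (forall x : nat, c <= C / x.+1%:R) -> c <= 0.
Proof.
move=> h; rewrite leNgt; apply/negP => c0.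
have := h (Num.truncn (C / c)); rewrite leNgt => /negP; apply.
rewrite ltr_pdivrMr ?ltr0n // mulrC -ltr_pdivrMr //; exact: truncnS_gt.
Qed.

Definition partial_L f (x : nat) g : R :=
  \sum_(1 <= n < x.+1) n%:R^-1 * shift f n g.

(** The limit comes with its rate: at x %/ d the error is of order d / x, which cancels the
    denominator of [mangoldt d / d]. The same rate is a hypothesis of [real_nonvanishing]. *)
Definition is_L f l :=
  exists C, forall x g, `|partial_L f x g - l g| <= C / x.+1%:R.

Lemma is_L_exists f : mean0 f -> exists l, is_L f l.
Proof.
move=> f0; have [C fC] := equidistribution f0.
have H g : exists L, forall x, `|partial_L f x g - L| <= C *+ 2 / x.+1%:R.
  apply: cauchy_limit => m x mx.
  rewrite /partial_L -sum_tail // (eq_bigr (fun n => shift f n g * n%:R^-1)).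
    apply: (@abel_bound R (fun n => shift f n g) (fun n => n%:R^-1)) => //.
      by move=> n _; rewrite invr_ge0.
    by move=> n n0; rewrite lef_pV2 ?posrE ?ltr0n // ler_nat.
  by move=> n _; rewrite mulrC.
have [l lP] := choice H.
by exists l, (C *+ 2) => x g.
Qed.

Lemma is_L_bound f l : is_L f l ->
  exists2 C, 0 <= C & forall x g, `|partial_L f x g - l g| <= C / x.+1%:R.
Proof.
case=> C h; exists C => //; have := h 0%N 1%g; rewrite divr1.
exact: le_trans.
Qed.

Lemma is_L_unique f l l' : is_L f l -> is_L f l' -> l =1 l'.
Proof.
move=> [C h] [C' h'] g; apply/eqP; rewrite -subr_eq0 -normr_le0.
apply: (@le0_of_le_div _ (C + C')) => x.
have -> : l g - l' g = (partial_L f x g - l' g) - (partial_L f x g - l g) by ring.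
apply: le_trans (ler_normB _ _) _; rewrite mulrDl addrC.
by apply: lerD.
Qed.

Lemma partial_L_sum (I : finType) (c : I -> R) (F : I -> G -> R) x g :
  partial_L (fun g' => \sum_i c i * F i g') x g = \sum_i c i * partial_L (F i) x g.
Proof.
rewrite /partial_L (eq_bigr (fun n => \sum_i c i * (n%:R^-1 * shift (F i) n g))).
  by rewrite exchange_big; apply: eq_bigr => i _; rewrite mulr_sumr.
move=> n _; rewrite /shift; case: ifP => _.
  by rewrite mulr_sumr; apply: eq_bigr => i _; rewrite mulrCA.
by rewrite mulr0 big1 // => i _; rewrite !mulr0.
Qed.

Lemma is_L_sum (I : finType) (c : I -> R) (F K : I -> G -> R) :
  (forall i, is_L (F i) (K i)) ->
  is_L (fun g => \sum_i c i * F i g) (fun g => \sum_i c i * K i g).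
Proof.
move=> h; have [C hC] := choice h.
exists (\sum_i `|c i| * C i) => x g.
rewrite partial_L_sum -sumrB; apply: le_trans (ler_norm_sum _ _ _) _.
rewrite mulr_suml; apply: ler_sum => i _.
by rewrite -mulrBr normrM -mulrA ler_wpM2l.
Qed.

Lemma is_L_translate f l h : is_L f l ->
  is_L (fun g => f (h * g)%g) (fun g => l (h * g)%g).
Proof.
case=> C H; exists C => x g.
have -> : partial_L (fun g => f (h * g)%g) x g = partial_L f x (h * g)%g.
  apply: eq_bigr => n _; congr (_ * _); rewrite /shift; case: ifP => // _.
  by rewrite !mulgA (GC h).
exact: H.
Qed.

Lemma mean0_is_L f l : mean0 f -> is_L f l -> mean0 l.
Proof.
move=> f0 [C h]; apply/eqP; rewrite -normr_le0.
apply: (@le0_of_le_div _ (\sum_(g : G) C)) => x.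
have e : \sum_g partial_L f x g = 0.
  rewrite /partial_L exchange_big big1 //= => n _.
  by rewrite -mulr_sumr (mean0_shift n f0) mulr0.
have -> : \sum_g l g = - \sum_g (partial_L f x g - l g).
  by rewrite sumrB e sub0r opprK.
rewrite normrN; apply: le_trans (ler_norm_sum _ _ _) _.
by rewrite mulr_suml; apply: ler_sum.
Qed.

Definition prime_sum f (x : nat) g : R :=
  \sum_(1 <= d < x.+1) mangoldt d / d%:R * shift f d g.

Lemma partial_D_bounded f : mean0 f ->
  exists C, forall x g,
    `|\sum_(1 <= n < x.+1) ln n%:R / n%:R * shift f n g| <= C.
Proof.
move=> f0; have [C fC] := equidistribution f0.
exists (C *+ 4) => x g.
have -> : \sum_(1 <= n < x.+1) ln n%:R / n%:R * shift f n g
  = \sum_(1 <= n < x.+1) shift f n g * ((1 + ln n%:R) / n%:R)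
    - \sum_(1 <= n < x.+1) shift f n g * n%:R^-1.
  by rewrite -sumrB; apply: eq_bigr => n _; ring.
apply: le_trans (ler_normB _ _) _.
have := @abel_bound R (fun n => shift f n g) (fun n => (1 + ln n%:R) / n%:R)
  C 0 x (fun k => fC k g).
have := @abel_bound R (fun n => shift f n g) (fun n => n%:R^-1)
  C 0 x (fun k => fC k g).
rewrite ln1 addr0 divr1 invr1 !mulr1 => h1 h2.
have -> : C *+ 4 = C *+ 2 + C *+ 2 by ring.
apply: lerD.
  apply: h2 => n n0; last exact: ln_over_decr.
  by rewrite divr_ge0 // addr_ge0 ?ln_nat_ge0.
apply: h1 => n n0; first by rewrite invr_ge0.
by rewrite lef_pV2 ?posrE ?ltr0n // ler_nat.
Qed.

Lemma inv_floorS (x d : nat) : (0 < d)%N -> (0 < x)%N ->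
  (x %/ d).+1%:R^-1 <= d%:R / x%:R :> R.
Proof.
move=> d0 x0; rewrite -[X in _ <= X]invrK invf_div.
rewrite lef_pV2 ?posrE ?divr_gt0 ?ltr0n // -natr1.
by have [] := @floor_div_bounds R x d d0.
Qed.

(* Expand [ln = Lambda * 1]: the sum of [ln n / n] twisted by [f], which is bounded, is the prime sum of [l] up to errors controlled by Chebyshev's bound. *)
Lemma prime_sum_L_bounded f l : mean0 f -> is_L f l ->
  exists C, forall x g, `|prime_sum l x g| <= C.
Proof.
move=> f0 fl; have [C C0 h] := is_L_bound fl.
have [C' h'] := partial_D_bounded f0.
exists (C' + 4 * C) => x g; case: (posnP x) => [->|x0].
  rewrite /prime_sum big_geq // normr0 addr_ge0 ?mulr_ge0 //.
  exact: le_trans (h' 0%N 1%g).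
have xR : 0 < x%:R :> R by rewrite ltr0n.
have e : \sum_(1 <= n < x.+1) ln n%:R / n%:R * shift f n g
    = \sum_(1 <= d < x.+1) mangoldt d / d%:R * shift (partial_L f (x %/ d)) d g.
  transitivity (\sum_(1 <= k < x.+1) \sum_(d <- divisors k)
     mangoldt d / d%:R * ((k %/ d)%:R^-1 * shift f (d * (k %/ d)) g)).
    apply: eq_big_nat => k /andP[k0 _].
    rewrite -sum_mangoldt // !mulr_suml big_seq [RHS]big_seq.
    apply: eq_bigr => d; rewrite -dvdn_divisors // => dk.
    rewrite [in X in _ = _ * (_ * X)]mulnC divnK // -{1}(divnK dk) natrM invfM.
    by ring.
  rewrite (sum_convolution x (fun d m =>
     mangoldt d / d%:R * (m%:R^-1 * shift f (d * m) g))).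
  by apply: eq_bigr => d _; rewrite -mulr_sumr shift_sum.
have -> : prime_sum l x g
  = \sum_(1 <= n < x.+1) ln n%:R / n%:R * shift f n g
   - \sum_(1 <= d < x.+1) mangoldt d / d%:R
       * shift (fun g' => partial_L f (x %/ d) g' - l g') d g.
  rewrite e -sumrB; apply: eq_bigr => d _; rewrite /shift.
  by case: ifP => _; ring.
apply: le_trans (ler_normB _ _) _; apply: lerD => //.
apply: le_trans (ler_norm_sum _ _ _) _.
apply: (@le_trans _ _ (\sum_(1 <= d < x.+1) mangoldt d * (C / x%:R))).
  apply: ler_sum_nat => d /andP[d0 _].
  have dR : 0 < d%:R :> R by rewrite ltr0n.
  have m0 := @mangoldt_ge0 R d.
  rewrite normrM ger0_norm ?divr_ge0 // -mulrA; apply: ler_wpM2l => //.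
  rewrite mulrC ler_pdivrMr //.
  have -> : C / x%:R * d%:R = C * (d%:R / x%:R) by ring.
  apply: le_trans (shift_norm _ _ (h (x %/ d)%N)) _.
  by apply: ler_wpM2l => //; exact: inv_floorS.
rewrite -mulr_suml -/(chebyshev x) mulrA ler_pdivrMr //.
have := ler_wpM2r C0 (@chebyshev_le R x); lra.
Qed.

(* When [L] kills [v], Moebius inversion of the weights [ln (x / n)] shows that the primes act on [v] by [- ln x]. *)
Lemma prime_sum_ker v : is_L v (fun=> 0) ->
  exists C, forall x g, (0 < x)%N -> `|prime_sum v x g + ln x%:R * v g| <= C.
Proof.
move=> fl; have [C C0 h] := is_L_bound fl.
exists C => x g x0.
have xR : 0 < x%:R :> R by rewrite ltr0n.
have -> : prime_sum v x g + ln x%:R * v g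
  = \sum_(1 <= n < x.+1) (moebius n)%:~R / n%:R * (ln x%:R - ln n%:R)
      * shift (partial_L v (x %/ n)) n g.
  transitivity (\sum_(1 <= k < x.+1) \sum_(n <- divisors k)
     (moebius n)%:~R / n%:R * (ln x%:R - ln n%:R)
       * ((k %/ n)%:R^-1 * shift v (n * (k %/ n)) g)); last first.
    rewrite (sum_convolution x (fun n m => (moebius n)%:~R / n%:R
       * (ln x%:R - ln n%:R) * (m%:R^-1 * shift v (n * m) g))).
    by apply: eq_bigr => d _; rewrite -mulr_sumr shift_sum.
  transitivity (\sum_(1 <= k < x.+1)
     (ln x%:R * (k == 1%N)%:R + mangoldt k) * (k%:R^-1 * shift v k g)).
    rewrite /prime_sum; symmetry.
    rewrite (eq_bigr (fun k => ln x%:R * (k == 1%N)%:R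
       * (k%:R^-1 * shift v k g) + mangoldt k / k%:R * shift v k g)); last first.
      by move=> k _; ring.
    rewrite big_split /= addrC; congr (_ + _).
    rewrite big_ltn ?ltnS // eqxx invr1 shift1 big_nat big1 ?addr0.
      by rewrite mulr1 mul1r.
    by move=> k /andP[k1 _]; rewrite gtn_eqF // mulr0 mul0r.
  apply: eq_big_nat => k /andP[k0 _].
  have -> : (k == 1%N)%:R = \sum_(d <- divisors k) (moebius d)%:~R :> R.
    by rewrite -rmorph_sum /= sum_moebius // rmorph_nat.
  rewrite mangoldt_moebius // mulr_sumr -sumrB mulr_suml big_seq [RHS]big_seq.
  apply: eq_bigr => n; rewrite -dvdn_divisors // => nk.
  rewrite [in X in _ = _ * (_ * X)]mulnC divnK // -{1}(divnK nk) natrM invfM.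
  by ring.
apply: le_trans (ler_norm_sum _ _ _) _.
apply: (@le_trans _ _ (\sum_(1 <= n < x.+1) C / x%:R * (ln x%:R - ln n%:R))).
  apply: ler_sum_nat => n /andP[n0 nx].
  have nR : 0 < n%:R :> R by rewrite ltr0n.
  have l0 : 0 <= ln x%:R - ln n%:R :> R by rewrite subr_ge0 ler_ln_nat // n0.
  rewrite !normrM (ger0_norm l0) mulrAC; apply: ler_wpM2r => //.
  rewrite (ger0_norm (_ : 0 <= n%:R^-1)) ?invr_ge0 //.
  have hs : `|shift (partial_L v (x %/ n)) n g| <= C * (n%:R / x%:R).
    apply: (@le_trans _ _ (C / (x %/ n).+1%:R)); last first.
      by apply: ler_wpM2l => //; exact: inv_floorS.
    by apply: shift_norm => g'; have := h (x %/ n)%N g'; rewrite subr0.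
  have hm : `|(moebius n)%:~R| <= 1 :> R.
    by rewrite -intr_norm -[1](_ : 1%:~R = 1) // ler_int normr_moebius.
  rewrite -mulrA -[X in _ <= X]mul1r; apply: ler_pM => //.
    by rewrite mulr_ge0 // invr_ge0 ltW.
  rewrite mulrC ler_pdivrMr //.
  by have -> : C / x%:R * n%:R = C * (n%:R / x%:R) by ring.
rewrite -mulr_sumr -mulrA -[X in _ <= X]mulr1; apply: ler_wpM2l => //.
rewrite mulrC ler_pdivrMr // mul1r; exact: sum_ln_quotient.
Qed.

Definition class_sum (x : nat) h : R :=
  \sum_(1 <= d < x.+1 | P d && (nu d == h)) mangoldt d / d%:R.

Lemma class_sum_ge0 x h : 0 <= class_sum x h.
Proof. by apply: sumr_ge0 => d _; rewrite divr_ge0 ?mangoldt_ge0. Qed.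

Lemma prime_sumE f x g : prime_sum f x g = \sum_h class_sum x h * f (h * g)%g.
Proof.
rewrite (eq_bigr (fun h => \sum_(1 <= d < x.+1)
   if P d && (nu d == h) then mangoldt d / d%:R * f (h * g)%g else 0)).
  rewrite exchange_big; apply: eq_bigr => d _; rewrite /shift.
  case: (P d) => /=; last by rewrite mulr0 big1.
  rewrite (bigD1 (nu d)) //= eqxx big1 ?addr0 // => h hd.
  by rewrite eq_sym (negbTE hd).
move=> h _; rewrite /class_sum big_mkcond mulr_suml; apply: eq_bigr => d _.
by case: ifP => // _; rewrite mul0r.
Qed.

Definition total_sum x := \sum_h class_sum x h.

Lemma total_sumE x : total_sum x = \sum_(1 <= d < x.+1 | P d) mangoldt d / d%:R.
Proof.
have := prime_sumE (fun=> 1) x 1%g.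
rewrite (eq_bigr (fun h => class_sum x h)); last by move=> h _; rewrite mulr1.
rewrite -/(total_sum x) => <-; rewrite /prime_sum [RHS]big_mkcond; apply: eq_bigr => d _.
by rewrite /shift; case: ifP => _; rewrite ?mulr1 ?mulr0.
Qed.

Lemma total_sum_le x : (0 < x)%N -> total_sum x <= ln x%:R + 4.
Proof.
move=> x0; apply: le_trans (mertens_le x0); rewrite total_sumE big_mkcond.
apply: ler_sum => d _; case: ifP => // _.
by rewrite divr_ge0 ?mangoldt_ge0.
Qed.

Hypothesis finitely_many_bad :
  exists2 N, (0 < N)%N & forall p, prime p -> ~~ P p -> (p %| N)%N.

(** From [mertens x], at least ln x - 1, the indices outside [P] remove a bounded amount: at most 2
    for those that are not prime, and the primes among them divide N, hence do not exceed it. *)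
Lemma total_sum_unbounded (B : R) : exists2 x, (0 < x)%N & B < total_sum x.
Proof.
have [N N0 hN] := finitely_many_bad.
have F0 d : 0 <= @mangoldt R d / d%:R by rewrite divr_ge0 ?mangoldt_ge0.
have [x [x0 xB]] := ln_unbounded (B + 3 + \sum_(1 <= p < N.+1) mangoldt p / p%:R).
exists x => //; rewrite total_sumE.
have := @mertens_ge R x x0; rewrite {1}/mertens (bigID P xpredT) /= => h1.
have : \sum_(1 <= d < x.+1 | ~~ P d) mangoldt d / d%:R
    <= 2 + \sum_(1 <= p < N.+1) mangoldt p / p%:R :> R; last by move: h1; lra.
rewrite (bigID prime) /= addrC; apply: lerD.
  apply: le_trans (sum_mangoldt_nonprime x).
  rewrite big_mkcond [X in _ <= X]big_mkcond; apply: ler_sum => d _.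
  by case: (P d); case: (prime d) => //=; rewrite F0.
apply: (@le_trans _ _ (\sum_(1 <= d < x.+1) \sum_(1 <= p < N.+1)
    if d == p then mangoldt p / p%:R else 0)).
  rewrite big_mkcond; apply: ler_sum_nat => d /andP[d0 _]; case: ifP.
    move=> /andP[Pd pd]; have dN := hN d pd Pd.
    have dm : d \in index_iota 1 N.+1 by rewrite mem_index_iota d0 /= ltnS dvdn_leq.
    rewrite (bigD1_seq d dm) ?iota_uniq //=.
    by rewrite eqxx lerDl; apply: sumr_ge0 => p _; case: ifP.
  by move=> _; apply: sumr_ge0 => p _; case: ifP.
rewrite exchange_big /=; apply: ler_sum => p _.
have [px|px] := boolP (p \in index_iota 1 x.+1).
  rewrite (bigD1_seq p) ?iota_uniq //= eqxx big1 ?addr0 // => d.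
  by move=> /negbTE ->.
rewrite big_seq big1 // => d dx; case: eqP => // dp.
by rewrite -dp dx in px.
Qed.

Definition thick h := forall B : R, exists x, B < class_sum x h.

(** [Q h] vanishes exactly when translation by h acts on v as -1. Summed with the weights
    [class_sum x h] it stays bounded: the term [2 * E] brings in the total weight, at most ln x + 4,
    and the inner products bring in -ln x by [prime_sum_ker]. An unbounded weight thus forces
    [Q h = 0]. *)
Lemma thick_neg v h : is_L v (fun=> 0) -> thick h -> forall k, v (h * k)%g = - v k.
Proof.
move=> vL th; have [C hC] := prime_sum_ker vL.
pose E := \sum_k v k ^+ 2.
pose Q h := \sum_k (v k + v (h * k)%g) ^+ 2.
have E0 : 0 <= E by apply: sumr_ge0 => k _; exact: sqr_ge0.
have Q0 h' : 0 <= Q h' by apply: sumr_ge0 => k _; exact: sqr_ge0.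
have QE h' : Q h' = 2 * E + 2 * \sum_k v k * v (h' * k)%g.
  have e : \sum_k v (h' * k)%g ^+ 2 = E by rewrite /E [RHS](reindex_inj (mulgI h')).
  have -> : 2 * E = E + \sum_k v (h' * k)%g ^+ 2 by rewrite e; ring.
  rewrite mulr_sumr -!big_split /=; apply: eq_bigr => k _; ring.
pose B := 8 * E + 2 * \sum_k `|v k| * C.
have QB x h' : (0 < x)%N -> class_sum x h' * Q h' <= B.
  move=> x0; apply: (@le_trans _ _ (\sum_h'' class_sum x h'' * Q h'')).
    rewrite (bigD1 h') //= lerDl; apply: sumr_ge0 => h'' _.
    by rewrite mulr_ge0 ?class_sum_ge0.
  have -> : \sum_h'' class_sum x h'' * Q h''
      = 2 * E * (total_sum x - ln x%:R)
        + 2 * \sum_k v k * (prime_sum v x k + ln x%:R * v k).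
    have -> : \sum_k v k * (prime_sum v x k + ln x%:R * v k)
       = \sum_k v k * prime_sum v x k + ln x%:R * E.
      rewrite /E mulr_sumr -big_split /=; apply: eq_bigr => k _; ring.
    have -> : \sum_k v k * prime_sum v x k
       = \sum_h'' class_sum x h'' * \sum_k v k * v (h'' * k)%g.
      rewrite (eq_bigr (fun k => \sum_h'' class_sum x h'' * (v k * v (h'' * k)%g))).
        by rewrite exchange_big; apply: eq_bigr => h'' _; rewrite mulr_sumr.
      move=> k _; rewrite prime_sumE mulr_sumr; apply: eq_bigr => h'' _; ring.
    rewrite (eq_bigr (fun h'' => 2 * E * class_sum x h''
       + 2 * (class_sum x h'' * \sum_k v k * v (h'' * k)%g))).
      by rewrite big_split /= -!mulr_sumr -/(total_sum x); ring.
    by move=> h'' _; rewrite QE; ring.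
  apply: lerD.
    have := total_sum_le x0 => ht.
    have -> : 8 * E = 2 * E * 4 by ring.
    by apply: ler_wpM2l; [rewrite mulr_ge0|lra].
  rewrite ler_pM2l //; apply: ler_sum => k _.
  apply: le_trans (ler_norm _) _; rewrite normrM; apply: ler_wpM2l => //.
  exact: hC.
have Qh : Q h = 0.
  apply/eqP; rewrite eq_le Q0 andbT leNgt; apply/negP => Qpos.
  have B0 : 0 <= B by apply: le_trans (QB 1%N h isT); rewrite mulr_ge0 ?class_sum_ge0.
  have [x] := th (B / Q h); rewrite ltr_pdivrMr //.
  case: x => [|x]; last by rewrite ltNge QB.
  by rewrite /class_sum big_geq // mul0r ltNge B0.
move=> k; apply/eqP; rewrite -addr_eq0 addrC -sqrf_eq0.
by move/eqP: Qh; rewrite psumr_eq0 => [/allP/(_ k (mem_index_enum k))//|i _]; exact: sqr_ge0.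
Qed.

Lemma not_thick h : ~ thick h -> exists2 B : R, 0 <= B & forall x, class_sum x h <= B.
Proof.
move=> nth; apply: contrapT => H; apply: nth => B.
apply: contrapT => nx; apply: H; exists (`|B|) => // x.
rewrite leNgt; apply/negP => hx; apply: nx; exists x.
exact: le_lt_trans (ler_norm _) hx.
Qed.

Lemma thick_exists : exists h, thick h.
Proof.
apply: contrapT => H.
have H1 h : exists B : R, forall x, class_sum x h <= B.
  by have [|B _ hB] := @not_thick h; [move=> th; apply: H; exists h|exists B].
have [B hB] := choice H1.
have [x _] := total_sum_unbounded (\sum_h B h).
by rewrite ltNge ler_sum.
Qed.

(** The image l of f under L is invariant too, so its bounded prime sum is [total_sum x * l g] up to
    the classes that are not thick: l = 0. Then [thick_neg] makes f change sign under a thick class,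
    against invariance. *)
Lemma thick_invariant0 f : mean0 f ->
  (forall h g, thick h -> f (h * g)%g = f g) -> forall g, f g = 0.
Proof.
move=> f0 inv; have [l fl] := is_L_exists f0.
have linv h g : thick h -> l (h * g)%g = l g.
  move=> th; have H : is_L f (fun g' => l (h * g')%g).
    have -> : f = (fun g' => f (h * g')%g) by apply/funext => g'; rewrite inv.
    exact: is_L_translate.
  exact: is_L_unique H fl g.
have l0 : l = fun=> 0.
  apply/funext => g; have [C hC] := prime_sum_L_bounded f0 fl.
  have H1 h : exists B : R, forall x,
      class_sum x h * `|l g - l (h * g)%g| <= B.
    have [th|/not_thick[B B0 hB]] := pselect (thick h).
      by exists 0 => x; rewrite linv // subrr normr0 mulr0.
    by exists (B * `|l g - l (h * g)%g|) => x; apply: ler_wpM2r.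
  have [B hB] := choice H1.
  apply/eqP; rewrite -normr_le0 leNgt; apply/negP => lg0.
  have [x _] := total_sum_unbounded ((C + \sum_h B h) / `|l g|).
  rewrite ltr_pdivrMr // ltNge => /negP; apply.
  rewrite -[X in X * _]ger0_norm; last by apply: sumr_ge0 => h _; exact: class_sum_ge0.
  rewrite -normrM.
  have -> : total_sum x * l g = prime_sum l x g
     + \sum_h class_sum x h * (l g - l (h * g)%g).
    rewrite prime_sumE -big_split mulr_suml /=; apply: eq_bigr => h _; ring.
  apply: le_trans (ler_normD _ _) _; apply: lerD => //.
  apply: le_trans (ler_norm_sum _ _ _) _; apply: ler_sum => h _.
  by rewrite normrM ger0_norm ?class_sum_ge0.
rewrite l0 in fl; have [h th] := thick_exists => g.
have := thick_neg fl th g; rewrite inv // => e.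
by apply/eqP; rewrite -[_ == _](mulrn_eq0 _ 2) mulr2n {1}e addNr.
Qed.

(** In terms of functions, the thick classes generate the group. *)
Lemma thick_invariant_const f :
  (forall h g, thick h -> f (h * g)%g = f g) -> forall g, f g = f 1%g.
Proof.
move=> inv g; pose m := (\sum_g f g) / #|G|%:R.
have G0 : #|G|%:R != 0 :> R.
  by rewrite pnatr_eq0 -lt0n; apply/card_gt0P; exists 1%g.
have f0 : mean0 (fun g => f g - m).
  rewrite /mean0 sumrB sumr_const -mulr_natr divfK ?subrr //.
have h := @thick_invariant0 _ f0 _.
by apply/eqP; rewrite -(inj_eq (addIr (- m))) !h // => h' g' th; rewrite inv.
Qed.

(* A function killed by [L] is a multiple of a real character, so [real_nonvanishing] applies. *)
Lemma L_injective v : mean0 v -> is_L v (fun=> 0) -> forall g, v g = 0.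
Proof.
move=> v0 vL; have neg h g : thick h -> v (h * g)%g = - v g.
  by move=> th; exact: thick_neg.
have vsq g : v g ^+ 2 = v 1%g ^+ 2.
  apply: (thick_invariant_const (f := fun g => v g ^+ 2)) => h g' th.
  by rewrite (neg _ _ th) sqrrN.
have [v10|v1] := eqVneq (v 1%g) 0.
  by move=> g; apply/eqP; rewrite -sqrf_eq0 vsq v10 expr0n.
have vn0 g : v g != 0 by rewrite -sqrf_eq0 vsq sqrf_eq0.
(* Both terms of the difference change sign under a thick class. Its product with v is therefore
   invariant, hence constant, and it vanishes at g = 1. *)
have mul b g : v 1%g * v (b * g)%g = v b * v g.
  have h : forall g, (v 1%g * v (b * g)%g - v b * v g) * v g
     = (v 1%g * v (b * 1)%g - v b * v 1%g) * v 1%g.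
    apply: (thick_invariant_const
      (f := fun g => (v 1%g * v (b * g)%g - v b * v g) * v g)) => h g' th.
    have -> : v (b * (h * g'))%g = - v (b * g')%g.
      by rewrite mulgA (GC b h) -mulgA (neg _ _ th).
    by rewrite !(neg _ _ th); ring.
  have := h g; rewrite mulg1 [v b * v 1%g]mulrC subrr mul0r => /eqP.
  by rewrite mulf_eq0 (negbTE (vn0 _)) orbF subr_eq0 => /eqP.
exfalso.
pose a n := if P n then v (nu n) / v 1%g else 0.
have aS n : a n = shift v n 1%g / v 1%g.
  by rewrite /a /shift; case: ifP => _; rewrite ?mulg1 ?mul0r.
have [C hC] := equidistribution v0; have [C' hC'] := vL.
apply: (@real_nonvanishing R a _ _ _ (Num.max (C / `|v 1%g|) (C' / `|v 1%g|))).
- by rewrite /a P1 nu1 divff.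
- move=> m n; rewrite /a PM; case: (boolP (P m)) => Pm; rewrite ?mul0r //=.
  case: (boolP (P n)) => Pn; rewrite ?mulr0 // nuM //.
  have -> : v (nu m * nu n)%g = v (nu m) * v (nu n) / v 1%g.
    by rewrite -mul mulrAC divff ?mul1r.
  by ring.
- move=> n; rewrite /a; case: ifP => _; [right|by left].
  have : (v (nu n) / v 1%g) ^+ 2 = 1 by rewrite expr_div_n vsq divff // sqrf_eq0.
  by move/eqP; rewrite sqrf_eq1 => /orP[/eqP->|/eqP->]; [left|right].
- move=> x; rewrite (eq_bigr _ (fun n _ => aS n)) -mulr_suml normf_div.
  by rewrite le_max ler_wpM2r ?hC // invr_ge0.
move=> x; rewrite (eq_bigr (fun n => n%:R^-1 * shift v n 1%g / v 1%g)); last first.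
  by move=> n _; rewrite aS; ring.
rewrite -mulr_suml normf_div ler_pdivlMr ?ltr0n //.
rewrite le_max; apply/orP; right.
rewrite mulrAC ler_wpM2r ?invr_ge0 // -ler_pdivlMr ?ltr0n //.
by have := hC' x 1%g; rewrite subr0.
Qed.

(** Injectivity suffices in finite dimension. The matrix [M] extends L from functions of mean zero
    to all functions: the summand 1/|G| makes [w *m M] have the same total as w, so that the kernel
    of [M] consists of functions of mean zero. *)
Lemma L_surjective f : mean0 f -> exists2 phi, mean0 phi & is_L phi f.
Proof.
move=> f0; have G0 : #|G|%:R != 0 :> R.
  by rewrite pnatr_eq0 -lt0n; apply/card_gt0P; exists 1%g.
pose delta h g : R := (g == h)%:R - #|G|%:R^-1.
have delta0 h : mean0 (delta h).
  rewrite /mean0 sumrB sumr_const -[X in _ - X]mulr_natr mulVf //.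
  by rewrite (bigD1 h) //= eqxx big1 ?addr0 ?subrr // => g /negbTE ->.
have [ell ellP] := choice (fun h => is_L_exists (delta0 h)).
have combo (c : G -> R) : mean0 c -> is_L c (fun g => \sum_h c h * ell h g).
  move=> c0; rewrite [X in is_L X](_ : _ = fun g => \sum_h c h * delta h g).
    exact: is_L_sum.
  apply/funext => g; rewrite /delta.
  rewrite (eq_bigr (fun h => c h * (g == h)%:R - c h / #|G|%:R)); last first.
    by move=> h _; rewrite mulrBr.
  rewrite sumrB -mulr_suml c0 mul0r subr0 (bigD1 g) //= eqxx mulr1.
  by rewrite big1 ?addr0 // => h /negbTE hg; rewrite eq_sym hg mulr0.
pose M := \matrix_(i < #|G|, j < #|G|)
  (ell (enum_val i) (enum_val j) + #|G|%:R^-1).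
pose fn (w : 'rV[R]_#|G|) g := w 0 (enum_rank g).
have reE (F : G -> R) : \sum_(i < #|G|) F (enum_val i) = \sum_g F g.
  by rewrite (reindex (@enum_rank G)) /=; [apply: eq_bigr => g _; rewrite enum_rankK
    | apply: onW_bij; exact: enum_rank_bij].
have wM w g : (w *m M) 0 (enum_rank g)
    = \sum_h fn w h * ell h g + (\sum_h fn w h) / #|G|%:R.
  rewrite mxE mulr_suml -big_split /= -reE; apply: eq_bigr => i _.
  by rewrite mxE enum_rankK /fn enum_valK mulrDr.
have sumM w : \sum_g (w *m M) 0 (enum_rank g) = \sum_h fn w h.
  rewrite (eq_bigr _ (fun g _ => wM w g)) big_split /= sumr_const.
  rewrite -[X in _ + X]mulr_natr divfK // exchange_big big1 ?add0r //= => h _.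
  by rewrite -mulr_sumr (mean0_is_L (delta0 h) (ellP h)) mulr0.
have Mu : M \in unitmx.
  rewrite -row_free_unit -kermx_eq0; apply/eqP/row_matrixP => i; rewrite row0.
  set w := row i _; have w0 : w *m M = 0 by rewrite -row_mul mulmx_ker row0.
  have sw : mean0 (fn w) by rewrite /mean0 -sumM w0 big1 // => g _; rewrite mxE.
  have := L_injective sw; move=> /(_ _) h.
  have hz : forall g, fn w g = 0.
    apply: h; rewrite [X in is_L _ X](_ : _ = fun g => \sum_h fn w h * ell h g).
      exact: combo.
    apply/funext => g; have := wM w g.
    by rewrite w0 mxE sw mul0r addr0.
  by apply/rowP => j; have := hz (enum_val j); rewrite /fn enum_valK => ->; rewrite mxE.
pose w := (\row_j f (enum_val j)) *m invmx M.
have wE : w *m M = \row_j f (enum_val j) by rewrite mulmxKV.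
have fE g : (w *m M) 0 (enum_rank g) = f g by rewrite wE mxE enum_rankK.
have sw : mean0 (fn w).
  by rewrite /mean0 -sumM -[RHS]f0; apply: eq_bigr => g _.
exists (fn w) => //.
rewrite [X in is_L _ X](_ : _ = fun g => \sum_h fn w h * ell h g).
  exact: combo.
by apply/funext => g; rewrite -fE wM sw mul0r addr0.
Qed.

(** Let [phi] be a preimage under L of the indicator of h minus its mean. By [prime_sum_L_bounded]
    the sum of the class h differs boundedly from the average over all classes, which is
    unbounded. *)
Lemma all_thick h : thick h.
Proof.
have G0 : 0 < #|G|%:R :> R.
  by rewrite ltr0n; apply/card_gt0P; exists 1%g.
pose delta g : R := (g == h)%:R - #|G|%:R^-1.
have delta0 : mean0 delta.
  rewrite /mean0 sumrB sumr_const -[X in _ - X]mulr_natr mulVf ?gt_eqF //.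
  by rewrite (bigD1 h) //= eqxx big1 ?addr0 ?subrr // => g /negbTE ->.
have [phi phi0 phiL] := L_surjective delta0.
have [C hC] := prime_sum_L_bounded phi0 phiL.
move=> B; have [x x0 hx] := total_sum_unbounded ((B + C) * #|G|%:R).
exists x; have := hC x 1%g; rewrite prime_sumE.
rewrite (eq_bigr (fun h' => class_sum x h' * (h' == h)%:R
   - class_sum x h' / #|G|%:R)); last first.
  by move=> h' _; rewrite mulg1 /delta mulrBr.
rewrite sumrB -mulr_suml -/(total_sum x) (bigD1 h) //= eqxx mulr1.
rewrite big1 ?addr0; last by move=> h' /negbTE ->; rewrite mulr0.
move: hx; rewrite -ltr_pdivlMr //; rewrite ler_norml; lra.
Qed.

Theorem prime_in_class h : exists p, [/\ prime p, P p & nu p = h].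
Proof.
(* A class without primes has sums of at most 2, the bound for all indices that are not prime. *)
apply: contrapT => H; have [x] := all_thick h 2.
rewrite ltNge => /negP; apply; apply: le_trans (sum_mangoldt_nonprime x).
rewrite /class_sum big_mkcond [X in _ <= X]big_mkcond; apply: ler_sum => d _.
case: (boolP (prime d)) => pd /=; last first.
  by case: ifP => // _; rewrite divr_ge0 ?mangoldt_ge0.
by case: ifP => // /andP[Pd /eqP nd]; case: H; exists d.
Qed.

End Twisted.

(** * Residue classes modulo N *)

Lemma periodic_sum (V : zmodType) (N : nat) (F : nat -> V) (x : nat) :
  (forall n, F (n + N)%N = F n) -> \sum_(0 <= n < N) F n = 0 ->
  \sum_(0 <= n < x) F n = \sum_(0 <= n < x %% N) F n.
Proof.
move=> per s0; rewrite {1}(divn_eq x N); move: (x %% N)%N => r.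
elim: (x %/ N)%N => [|k IH]; first by rewrite mul0n add0n.
rewrite mulSn -addnA (@big_cat_nat _ _ _ N) //= ?leq_addr // s0 add0r -IH.
rewrite -{1}[N]add0n big_addn addnC addnK.
by apply: eq_bigr => n _; exact: per.
Qed.

Section Residues.
Variable N : nat.
Hypothesis N1 : (1 < N)%N.

Let nu (n : nat) : {unit 'Z_N} := insubd (1%g : {unit 'Z_N}) (n%:R : 'Z_N).

Let val_nu n : coprime N n -> val (nu n) = n%:R.
Proof. by move=> Nn; rewrite /nu val_insubd unitZpE // Nn. Qed.

(** For fixed g the terms are N-periodic with sum 0 over a period, so only an incomplete period
    remains, whatever x is. *)
Lemma residues_equidistributed (R : realType) (f : {unit 'Z_N} -> R) :
  mean0 f -> exists C : R, forall x g,
    `|\sum_(1 <= n < x.+1) shift nu (coprime N) f n g| <= C.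
Proof.
move=> f0; exists (\sum_(0 <= n < N) \sum_g `|shift nu (coprime N) f n g|) => x g.
pose F n := shift nu (coprime N) f n g.
have F0 : F 0%N = 0.
  by rewrite /F /shift /coprime gcdn0 gtn_eqF.
have per n : F (n + N)%N = F n.
  rewrite /F /shift {1}/coprime gcdnDr -/(coprime N n); case: ifP => // Nn.
  congr (f (_ * _)%g); apply: val_inj; rewrite !val_nu ?natrD //; last first.
    by rewrite /coprime gcdnDr.
  by rewrite [X in _ + X]pchar_Zp // addr0.
have s0 : \sum_(0 <= n < N) F n = 0.
  have G0 : \sum_h f (h * g)%g = 0.
    by rewrite -[RHS]f0 [RHS](reindex_inj (mulIg g)).
  rewrite -[RHS]G0 big_mkord /F /shift -big_mkcond /=.
  have N0 := ltnW N1.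
  (* The order of ['Z_N] is N only up to a proved equation, so the value is reduced modulo N to
     become an ordinal below N. *)
  pose res (u : {unit 'Z_N}) : 'I_N := Ordinal (ltn_pmod (val u : 'Z_N) N0).
  have nu_res u : nu (res u) = u.
    have e : (res u)%:R = val u :> 'Z_N.
      by rewrite /= Zp_nat_mod // natr_Zp.
    by apply: val_inj; rewrite val_nu -?unitZpE ?e //; case: (u).
  rewrite [RHS](reindex_onto (fun i : 'I_N => nu i) res) /=; last by move=> u _; exact: nu_res.
  apply: eq_bigl => i; case: (boolP (coprime N i)) => Ni; apply/esym/eqP.
    have e : (val (nu i) : 'Z_N) = i :> nat.
      by rewrite val_nu // val_Zp_nat // modn_small.
    by apply: ord_inj; rewrite [LHS](congr1 (modn^~ N) e) modn_small.
  move=> e; case/negP: Ni; rewrite -e.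
  by rewrite /= coprime_modr -unitZpE // natr_Zp; case: (nu i).
have -> : \sum_(1 <= n < x.+1) F n = \sum_(0 <= n < x.+1) F n.
  by rewrite [RHS]big_nat_recl // F0 add0r big_add1.
rewrite (periodic_sum _ per s0).
have rN : (x.+1 %% N <= N)%N by rewrite ltnW // ltn_mod ltnW.
apply: le_trans (ler_norm_sum _ _ _) _.
rewrite [X in _ <= X](@big_cat_nat _ _ _ (x.+1 %% N)) //=.
apply: ler_wpDr.
  by apply: sumr_ge0 => n _; apply: sumr_ge0.
apply: ler_sum => n _; rewrite (bigD1 g) //= lerDl; exact: sumr_ge0.
Qed.

End Residues.

Theorem dirichlet_primes (N a : nat) : (0 < N)%N -> coprime a N ->
  exists2 p, prime p & p = a %[mod N].
Proof.
(* ['Z_N] is the ring of residues modulo N only for N > 1, so N = 1 is settled apart. *)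
case: N => [//|[_ _|N _ aN]]; first by exists 2%N; rewrite ?modn1.
have N1 : (1 < N.+2)%N by [].
set M := N.+2 in N1 aN *.
pose nu (n : nat) : {unit 'Z_M} := insubd (1%g : {unit 'Z_M}) (n%:R : 'Z_M).
have val_nu n : coprime M n -> val (nu n) = n%:R.
  by move=> Mn; rewrite /nu val_insubd unitZpE // Mn.
have [|||||||p [pp Mp /(congr1 val)]] :=
  @prime_in_class Rdefinitions.R {unit 'Z_M} nu (coprime M) _ _ _ _ _ _ _ (nu a).
- by move=> u v; apply: val_inj; rewrite !FinRing.val_unitM mulrC.
- exact: coprimen1.
- by apply: val_inj; rewrite val_nu ?coprimen1.
- by move=> m n; rewrite coprimeMr.
- move=> m n Mm Mn; apply: val_inj.
  by rewrite FinRing.val_unitM !val_nu ?coprimeMr ?Mm // natrM.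
- by move=> f; exact: residues_equidistributed.
- exists M => // p pp; rewrite coprime_sym prime_coprime // negbK //.
rewrite !val_nu // 1?coprime_sym // => /(congr1 (fun u : 'Z_M => u : nat)).
by rewrite !val_Zp_nat //; exists p.
Qed.

(** * Reduction to dimension 3 *)

(** Take for t the part of d at the primes not dividing b. A prime of d that divides b divides
    neither t nor, by unimodularity, a; one that does not divide b divides t. So none divides b + t
    a. *)
Lemma coprime_shift (a b d : int) : d != 0 ->
  (exists s u v, s * a + u * b + v * d = 1) ->
  exists t x y, x * (b + t * a) + y * d = 1.
Proof.
move=> d0 [s [u [v e]]].
pose t := (`|d|%N`_[pred p | ~~ (p %| `|b|)])%N.
exists t%:Z.
have cop : coprimez (b + t%:Z * a) d.
  rewrite coprimezE; apply/negPn/negP => ncop.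
  pose p := pdiv (gcdn `|(b + t%:Z * a)%R| `|d|)%N.
  have g0 : (0 < gcdn `|(b + t%:Z * a)%R| `|d|)%N by rewrite gcdn_gt0 [(0 < `|d|)%N]absz_gt0 d0 orbT.
  have pp : prime p by rewrite pdiv_prime // ltn_neqAle eq_sym ncop.
  have := pdiv_dvd (gcdn `|(b + t%:Z * a)%R| `|d|)%N.
  rewrite dvdn_gcd -/p => /andP[p1 pd].
  have {}p1 : (p%:Z %| b + t%:Z * a)%Z by rewrite dvdzE.
  have pd' : (p%:Z %| d)%Z by rewrite dvdzE.
  have d0' : (0 < `|d|)%N by rewrite absz_gt0.
  have pt : (p %| t)%N = ~~ (p %| `|b|)%N.
    have := primes_part [pred p | ~~ (p %| `|b|)%N] `|d|%N.
    move/(congr1 (fun s => p \in s)); rewrite mem_filter !mem_primes pp d0' pd /=.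
    by rewrite part_gt0 andbT.
  case: (boolP (p %| `|b|)%N) => pb.
    have pb' : (p%:Z %| b)%Z by rewrite dvdzE.
    have : (p%:Z %| t%:Z * a)%Z by rewrite -(rpredDl _ pb').
    rewrite dvdzE abszM Euclid_dvdM // pt pb /= => pa.
    have pa' : (p%:Z %| a)%Z by rewrite dvdzE.
    have : (p%:Z %| s * a + u * b + v * d)%Z.
      by rewrite !rpredD //; exact: dvdz_mull.
    rewrite e dvdzE dvdn1 => /eqP p1E; have := prime_gt1 pp.
    by rewrite -[p in (1 < p)%N]/(`|p%:Z|%N) p1E.
  have pt' : (p%:Z %| t%:Z * a)%Z by rewrite dvdz_mulr // dvdzE pt.
  by move: p1; rewrite (rpredDr _ pt') dvdzE (negbTE pb).
have /coprimezP[[x y] /= xy] := cop.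
by exists x, y.
Qed.

Lemma gcd_col (k : nat) (v : 'cV[int]_k) : exists d (w : 'rV[int]_k) (v' : 'cV[int]_k),
  w *m v = d%:M /\ v = d *: v'.
Proof.
elim: k v => [|k IH] v.
  by exists 0, 0, 0; split; [rewrite mul0mx raddf0|apply/matrixP=> -[]].
move: (v : 'cV_(1 + k)) => {}v.
suff : exists d (w : 'rV[int]_(1 + k)) (v' : 'cV[int]_(1 + k)),
  w *m v = d%:M /\ v = d *: v' by [].
rewrite -[v]vsubmxK; set x := usubmx _; set y := dsubmx _.
have [d [w [y' [wy yE]]]] := IH y.
have xE : x = (x 0 0)%:M by exact: mx11_scalar.
have [u [v1 uv]] : exists u v1, u * x 0 0 + v1 * d = gcdz (x 0 0) d.
  by case: (Bezoutz (x 0 0) d) => u [v1 h]; exists u, v1.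
exists (gcdz (x 0 0) d), (row_mx u%:M (v1 *: w)),
  (col_mx (divz (x 0 0) (gcdz (x 0 0) d))%:M (divz d (gcdz (x 0 0) d) *: y')).
split.
  rewrite mul_row_col -scalemxAl wy {1}xE mul_scalar_mx.
  by rewrite !scale_scalar_mx -raddfD /= uv.
rewrite scale_col_mx scale_scalar_mx scalerA; congr col_mx.
  by rewrite {1}xE; congr (_%:M); rewrite mulrC divzK // dvdz_gcdl.
by rewrite {1}yE; congr (_ *: _); rewrite mulrC divzK // dvdz_gcdr.
Qed.

(** The gcd d of all entries but the first serves as third element in [coprime_shift], so changing
    the first entry suffices. If d = 0, another entry is turned from 0 into a. *)
Lemma unimodular_shift (m : nat) (b : 'cV[int]_(1 + m.+1)) (a : int) :
  (exists s (w : 'rV[int]_(1 + m.+1)), (s * a)%:M + w *m b = 1%:M) ->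
  exists (c : 'cV[int]_(1 + m.+1)) (w : 'rV[int]_(1 + m.+1)),
    w *m (b + a *: c) = 1%:M.
Proof.
move=> [s [w]].
rewrite -[b]vsubmxK -[w]hsubmxK.
move: (usubmx b) (dsubmx b) (lsubmx w) (rsubmx w) => x y w1 w2.
have [d [z [y' [zy yE]]]] := gcd_col y.
have xE : x = (x 0 0)%:M by exact: mx11_scalar.
have w1E : w1 = (w1 0 0)%:M by exact: mx11_scalar.
rewrite mul_row_col {1}xE w1E {1}yE -scalemxAr.
have -> : w2 *m y' = ((w2 *m y') 0 0)%:M by exact: mx11_scalar.
move: ((w2 *m y') 0 0) (w1 0 0) => v u.
rewrite mul_scalar_mx !scale_scalar_mx -!raddfD /= => /matrixP/(_ 0 0).
rewrite !mxE !mulr1n => e.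
have [d0|d0] := eqVneq d 0.
  have y0 : y = 0 by rewrite yE d0 scale0r.
  exists (col_mx 0 (delta_mx 0 0)), (row_mx u%:M (s *: delta_mx 0 0)).
  rewrite scale_col_mx scaler0 add_col_mx addr0 mul_row_col y0 add0r.
  rewrite -scalemxAl -scalemxAr mul_delta_mx xE mul_scalar_mx.
  apply/matrixP=> i j; rewrite !ord1 !mxE eqxx !mulr1n mulr1.
  by move: e; rewrite d0 mul0r => <-; ring.
have [|t [p [r pr]]] := @coprime_shift a (x 0 0) d d0.
  by exists s, u, v; rewrite -e; ring.
exists (col_mx t%:M 0), (row_mx p%:M (r *: z)).
rewrite scale_col_mx scaler0 add_col_mx addr0 mul_row_col -scalemxAl zy.
rewrite xE scale_scalar_mx -raddfD /= mul_scalar_mx !scale_scalar_mx -raddfD /=.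
by congr (_%:M); rewrite -pr; ring.
Qed.

(** * Block matrices and clearing of the first row and column *)

Section Reduction.
Variable q : int.

Definition dvdmx (m n : nat) (A : 'M[int]_(m, n)) := forall i j, (q %| A i j)%Z.

Lemma dvdmxD m n (A B : 'M[int]_(m, n)) : dvdmx A -> dvdmx B -> dvdmx (A + B).
Proof. by move=> hA hB i j; rewrite mxE rpredD ?hA ?hB. Qed.

Lemma dvdmxN m n (A : 'M[int]_(m, n)) : dvdmx A -> dvdmx (- A).
Proof. by move=> hA i j; rewrite mxE rpredN hA. Qed.

Lemma dvdmxMl m n p (A : 'M[int]_(m, n)) (B : 'M[int]_(n, p)) :
  dvdmx A -> dvdmx (A *m B).
Proof.
by move=> hA i j; rewrite mxE rpred_sum // => k _; rewrite dvdz_mulr ?hA.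
Qed.

Lemma dvdmxMr m n p (A : 'M[int]_(m, n)) (B : 'M[int]_(n, p)) :
  dvdmx B -> dvdmx (A *m B).
Proof.
by move=> hB i j; rewrite mxE rpred_sum // => k _; rewrite dvdz_mull ?hB.
Qed.

Lemma dvdmx_scale m n (A : 'M[int]_(m, n)) : dvdmx (q *: A).
Proof. by move=> i j; rewrite mxE dvdz_mulr. Qed.

Lemma dvdmx0 m n : dvdmx (0 : 'M[int]_(m, n)).
Proof. by move=> i j; rewrite mxE dvdz0. Qed.

Lemma dvdmxE m n (A : 'M[int]_(m, n)) : dvdmx A -> exists B, A = q *: B.
Proof.
move=> hA; exists (map_mx (divz^~ q) A); apply/matrixP=> i j; rewrite !mxE.
by rewrite mulrC divzK.
Qed.

Definition unip_up n (A : 'M[int]_n) :=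
  (forall i j : 'I_n, (j < i)%N -> A i j = 0) /\ (forall i, A i i = 1)
  /\ (forall i j, i != j -> (q %| A i j)%Z).

Definition unip_low n (A : 'M[int]_n) :=
  (forall i j : 'I_n, (i < j)%N -> A i j = 0) /\ (forall i, A i i = 1)
  /\ (forall i j, i != j -> (q %| A i j)%Z).

(* The subgroup that the powers of [U L] exhaust; the diagonal is constrained modulo [q ^ 2], not [q]. *)
Definition tame n (A : 'M[int]_n) :=
  (forall i, (q ^+ 2 %| A i i - 1)%Z) /\ (forall i j, i != j -> (q %| A i j)%Z).

Lemma unip_up_tr n (A : 'M[int]_n) : unip_up A <-> unip_low A^T.
Proof.
split=> -[h1 [h2 h3]]; split; first by move=> i j ij; rewrite ?mxE h1.
- by split=> [i|i j ij]; rewrite mxE ?h2 // h3 // eq_sym.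
- by move=> i j ij; have := h1 j i ij; rewrite mxE.
split=> [i|i j ij]; first by have := h2 i; rewrite mxE.
by have := h3 j i; rewrite mxE eq_sym; apply.
Qed.

Lemma unip_up1 n : unip_up (1%:M : 'M_n).
Proof.
split=> [i j ij|]; first by rewrite mxE -val_eqE /= gtn_eqF.
by split=> [i|i j /negbTE ij]; rewrite mxE ?eqxx // ij dvdz0.
Qed.

Lemma unip_low1 n : unip_low (1%:M : 'M_n).
Proof. by rewrite -trmx1 -unip_up_tr; exact: unip_up1. Qed.

Lemma unip_up_block m (r : 'rV[int]_m) (u : 'M[int]_m) :
  dvdmx r -> unip_up u -> unip_up (block_mx (1%:M : 'M_1) r 0 u : 'M_(1 + m)).
Proof.
move=> hr [h1 [h2 h3]]; split=> [i j|].
  case: (split_ordP i) => i' ->; case: (split_ordP j) => j' ->.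
  - by rewrite !ord1.
  - by rewrite (ord1 i') /= add1n.
  - by rewrite block_mxEdl mxE.
  - by rewrite /= ltn_add2l block_mxEdr; exact: h1.
split=> [i|i j].
  case: (split_ordP i) => i' ->; last by rewrite block_mxEdr h2.
  by rewrite block_mxEul mxE eqxx.
case: (split_ordP i) => i' ->; case: (split_ordP j) => j' ->.
- by rewrite !ord1 eqxx.
- by rewrite block_mxEur hr.
- by rewrite block_mxEdl mxE dvdz0.
- by rewrite block_mxEdr => ij; apply: h3; apply: contraNneq ij => ->.
Qed.

Lemma unip_low_block m (c : 'cV[int]_m) (l : 'M[int]_m) :
  dvdmx c -> unip_low l -> unip_low (block_mx (1%:M : 'M_1) 0 c l : 'M_(1 + m)).
Proof.
move=> hc hl; rewrite -[block_mx _ _ _ _]trmxK -unip_up_tr tr_block_mx.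
rewrite trmx1 trmx0; apply: unip_up_block; first by move=> i j; rewrite mxE.
by rewrite unip_up_tr trmxK.
Qed.

Lemma tame_block m (A : 'M[int]_1) (B : 'rV[int]_m) (C : 'cV[int]_m) (D : 'M[int]_m) :
  tame (block_mx A B C D : 'M_(1 + m)) <->
  [/\ (q ^+ 2 %| A 0%R 0%R - 1)%Z, dvdmx B, dvdmx C & tame D].
Proof.
split=> [[h1 h2]|[hA hB hC [h1 h2]]].
  split.
  - by have := h1 (lshift m 0); rewrite block_mxEul.
  - by move=> i j; have := h2 (lshift m i) (rshift 1 j); rewrite block_mxEur; apply; rewrite eq_lrshift.
  - by move=> i j; have := h2 (rshift 1 i) (lshift m j); rewrite block_mxEdl; apply; rewrite eq_rlshift.
  - split=> [i|i j ij]; first by have := h1 (rshift 1 i); rewrite block_mxEdr.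
    by have := h2 (rshift 1 i) (rshift 1 j); rewrite block_mxEdr; apply; rewrite (inj_eq (@rshift_inj _ _)).
split=> [i|i j].
  by case: (split_ordP i) => i' ->; rewrite ?block_mxEul ?block_mxEdr ?ord1.
case: (split_ordP i) => i' ->; case: (split_ordP j) => j' ->.
- by rewrite !ord1 eqxx.
- by rewrite block_mxEur.
- by rewrite block_mxEdl.
- by rewrite block_mxEdr => ij; apply: h2; apply: contraNneq ij => ->.
Qed.

Lemma tame1 n : tame (1%:M : 'M_n).
Proof.
split=> [i|i j /negbTE ij]; by rewrite mxE ?eqxx ?ij ?dvdz0.
Qed.

Lemma tameM n (A B : 'M[int]_n) : tame A -> tame B -> tame (A *m B).
Proof.
move=> [a1 a2] [b1 b2]; have q2 x : (q ^+ 2 %| x)%Z -> (q %| x)%Z.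
  by apply: dvdz_trans; rewrite dvdz_exp.
split=> [i|i j ij].
  rewrite mxE (bigD1 i) //= addrAC rpredD //.
    have -> : A i i * B i i - 1 = (A i i - 1) * B i i + (B i i - 1) by ring.
    by rewrite rpredD // dvdz_mulr.
  by rewrite rpred_sum // => k ki; rewrite expr2 dvdz_mul // ?a2 ?b2 // eq_sym.
rewrite mxE rpred_sum // => k _; have [<-|ik] := eqVneq i k.
  by rewrite dvdz_mull // b2.
by rewrite dvdz_mulr // a2.
Qed.

Lemma unip_up_tame n (A : 'M[int]_n) : unip_up A -> tame A.
Proof. by move=> [_ [h2 h3]]; split=> // i; rewrite h2 subrr dvdz0. Qed.

Lemma unip_low_tame n (A : 'M[int]_n) : unip_low A -> tame A.
Proof. by move=> [_ [h2 h3]]; split=> // i; rewrite h2 subrr dvdz0. Qed.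

Definition row_unip m (r : 'rV[int]_m) : 'M[int]_(1 + m) := block_mx 1%:M r 0 1%:M.
Definition col_unip m (c : 'cV[int]_m) : 'M[int]_(1 + m) := block_mx 1%:M 0 c 1%:M.
Definition corner m (A : 'M[int]_m) : 'M[int]_(1 + m) := block_mx 1%:M 0 0 A.

Lemma row_unipN m (r : 'rV[int]_m) : row_unip (- r) *m row_unip r = 1%:M.
Proof.
by rewrite /row_unip mulmx_block !mulmx1 !mul1mx !mulmx0 !mul0mx !addr0 subrr
  add0r -scalar_mx_block.
Qed.

Lemma col_unipN m (c : 'cV[int]_m) : col_unip (- c) *m col_unip c = 1%:M.
Proof.
by rewrite /col_unip mulmx_block !mulmx1 !mul1mx !mulmx0 !mul0mx !addr0 addNr
  add0r -scalar_mx_block.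
Qed.

Lemma det_row_unip m (r : 'rV[int]_m) : \det (row_unip r) = 1.
Proof. by rewrite det_ublock !det1 mulr1. Qed.

Lemma det_col_unip m (c : 'cV[int]_m) : \det (col_unip c) = 1.
Proof. by rewrite det_lblock !det1 mulr1. Qed.

Lemma det_corner m (A : 'M[int]_m) : \det (corner A) = \det A.
Proof. by rewrite det_ublock det1 mul1r. Qed.

Lemma unip_up_row m (r : 'rV[int]_m) : dvdmx r -> unip_up (row_unip r).
Proof. by move=> hr; apply: unip_up_block => //; exact: unip_up1. Qed.

Lemma unip_low_col m (c : 'cV[int]_m) : dvdmx c -> unip_low (col_unip c).
Proof. by move=> hc; apply: unip_low_block => //; exact: unip_low1. Qed.

(** Nothing is asked of the lower right block, so that in dimension 3 the conjugating group contains
    every corner of determinant 1. *)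
Definition semitame m (g : 'M[int]_(1 + m)) :=
  [/\ (q ^+ 2 %| ulsubmx g 0%R 0%R - 1)%Z, dvdmx (ursubmx g) & dvdmx (dlsubmx g)].

Lemma corner_reduction_block (k : nat) (A : 'M[int]_1) (B : 'rV[int]_(1 + k.+1))
    (C : 'cV[int]_(1 + k.+1)) (D : 'M[int]_(1 + k.+1)) :
  \det (block_mx A B C D) = 1 ->
  (q ^+ 2 %| A 0%R 0%R - 1)%Z -> dvdmx B -> dvdmx C ->
  exists (c1 c2 : 'cV[int]_(1 + k.+1)) (r1 r2 : 'rV[int]_(1 + k.+1))
         (Y : 'M[int]_(1 + k.+1)),
    [/\ [/\ dvdmx c1, dvdmx c2, dvdmx r1 & dvdmx r2], \det Y = 1,
        (tame (block_mx A B C D : 'M_(1 + (1 + k.+1))) -> tame Y) &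
        block_mx A B C D = col_unip c1 *m row_unip r1
          *m (col_unip c2 *m row_unip r2) *m corner Y].
Proof.
set g' := block_mx A B C D.
move=> dg hA hB hC; have [b bE] := dvdmxE hC.
have /dvdzP[s sE] := hA.
set a := A 0 0 in sE *; have AE : A = a%:M by exact: mx11_scalar.
have gu : g' \in unitmx by rewrite unitmxE dg unitr1.
have [c [w wE]] : exists (c : 'cV[int]_(1 + k.+1)) (w : 'rV[int]_(1 + k.+1)),
    w *m (b + a *: c) = 1%:M.
  apply: unimodular_shift; have := mulVmx gu.
  rewrite -[invmx g']submxK mulmx_block scalar_mx_block => /eq_block_mx[e _ _ _].
  (* The first row of the inverse gives a relation x a + q y b = 1, so a and the entries of b are
     unimodular. *)
  exists ((ulsubmx (invmx g')) 0 0), (q *: ursubmx (invmx g')).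
  rewrite -e bE; congr (_ + _); last by rewrite -scalemxAl -scalemxAr.
  by rewrite AE [X in X *m _]mx11_scalar mul_scalar_mx scale_scalar_mx.
pose b1 := q *: (b + a *: c).
(* Then [r *m b1] is - s q^2 = 1 - a. As r and [b1] each carry a factor q, the congruence of a has
   to hold modulo q^2. *)
pose r := - (s * q) *: w.
have e1 : col_unip (q *: c) *m g'
    = block_mx a%:M B b1 (q *: c *m B + D).
  rewrite /col_unip mulmx_block !mul1mx !mul0mx !addr0 AE.
  rewrite mul_mx_scalar bE /b1 scalerDr addrC; congr (block_mx _ _ (_ + _) _).
  by rewrite !scalerA mulrC.
pose B' := B + r *m (q *: c *m B + D).
have e2 : row_unip r *m (col_unip (q *: c) *m g')
    = block_mx 1%:M B' b1 (q *: c *m B + D).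
  rewrite e1 /row_unip mulmx_block !mul1mx !mul0mx !add0r; congr block_mx.
  rewrite /r /b1 -scalemxAl -scalemxAr wE !scale_scalar_mx -raddfD /=.
  have aE : a = s * q ^+ 2 + 1 by rewrite -sE subrK.
  by congr (_%:M); rewrite aE; ring.
pose Y := q *: c *m B + D - b1 *m B'.
have e3 : col_unip (- b1) *m (row_unip r *m (col_unip (q *: c) *m g'))
    = block_mx 1%:M B' 0 Y.
  rewrite e2 /col_unip mulmx_block !mul1mx !mul0mx !addr0 mulmx1 addNr.
  by rewrite mulNmx addrC.
have dY : \det Y = 1.
  have := congr1 determinant e3.
  by rewrite !det_mulmx det_row_unip !det_col_unip dg !mul1r det_ublock det1 mul1r.
have Yu : Y \in unitmx by rewrite unitmxE dY unitr1.
pose r' := - (B' *m invmx Y).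
have e4 : row_unip r' *m (col_unip (- b1) *m (row_unip r *m (col_unip (q *: c) *m g')))
    = corner Y.
  rewrite e3 /row_unip mulmx_block !mul1mx !mul0mx !mulmx0 !addr0 !add0r.
  by rewrite /r' mulNmx mulmxKV // subrr.
have hr : dvdmx r.
  by move=> i j; rewrite mxE -mulNr mulrAC dvdz_mull.
have hB' : dvdmx B' by apply: dvdmxD => //; exact: dvdmxMl.
have hr' : dvdmx r' by apply: dvdmxN; exact: dvdmxMl.
have hb1 : dvdmx b1 by exact: dvdmx_scale.
exists (- (q *: c)), b1, (- r), (- r'), Y; split.
- by split=> //; apply: dvdmxN => //; exact: dvdmx_scale.
- exact: dY.
- move=> tg; suff : tame (corner Y) by case/tame_block.
  have t1 := unip_up_tame (unip_up_row hr').
  have t2 := unip_low_tame (unip_low_col (dvdmxN hb1)).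
  have t3 := unip_up_tame (unip_up_row hr).
  have t4 := unip_low_tame (unip_low_col (@dvdmx_scale _ _ c)).
  by rewrite -e4; exact: (tameM t1 (tameM t2 (tameM t3 (tameM t4 tg)))).
rewrite -e4 -!mulmxA (mulmxA (row_unip (- r'))) row_unipN mul1mx.
rewrite -{1}[b1]opprK (mulmxA (col_unip (- - b1))) col_unipN mul1mx.
by rewrite (mulmxA (row_unip (- r))) row_unipN mul1mx mulmxA col_unipN mul1mx.
Qed.

Lemma corner_reduction (k : nat) (g : 'M[int]_(1 + (1 + k.+1))) :
  \det g = 1 -> semitame g ->
  exists (c1 c2 : 'cV[int]_(1 + k.+1)) (r1 r2 : 'rV[int]_(1 + k.+1))
         (Y : 'M[int]_(1 + k.+1)),
    [/\ [/\ dvdmx c1, dvdmx c2, dvdmx r1 & dvdmx r2], \det Y = 1,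
        (tame g -> tame Y) &
        g = col_unip c1 *m row_unip r1 *m (col_unip c2 *m row_unip r2) *m corner Y].
Proof.
move=> dg [hA hB hC]; rewrite -(submxK g) in dg.
by have := corner_reduction_block dg hA hB hC; rewrite submxK.
Qed.

Lemma cornerM m (A B : 'M[int]_m) : corner (A *m B) = corner A *m corner B.
Proof.
by rewrite /corner mulmx_block !mul1mx !mul0mx !mulmx0 !addr0 !add0r.
Qed.

Lemma corner_factors m (c : 'cV[int]_m) (r : 'rV[int]_m) (x y : 'M[int]_m) :
  block_mx 1%:M 0 c x *m block_mx 1%:M (r *m (x *m y)) 0 y
  = col_unip c *m row_unip r *m corner (x *m y).
Proof.
rewrite /col_unip /row_unip /corner !mulmx_block.
rewrite !mul1mx !mul0mx !mulmx0 !mulmx1 !addr0 !add0r.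
by rewrite mulmxDl mul1mx -(mulmxA c).
Qed.

Lemma corner_swap m (c : 'cV[int]_m) (r : 'rV[int]_m) (y : 'M[int]_m) :
  y \in unitmx ->
  corner y *m (col_unip (invmx y *m c) *m row_unip (r *m y))
  = col_unip c *m row_unip r *m corner y.
Proof.
move=> yu; rewrite /col_unip /row_unip /corner !mulmx_block.
rewrite !mul1mx !mul0mx !mulmx0 !mulmx1 !addr0 !add0r.
by rewrite mulmxDr mulmxDl mul1mx mulmx1 !mulmxA mulmxV // mul1mx.
Qed.

(* Iterating [corner_reduction] does not lengthen the word: the row and column groups of the first index are normalized by the corner. *)
Lemma corner_assembly m (c1 c2 : 'cV[int]_m) (r1 r2 : 'rV[int]_m)
    (x1 x2 x3 x4 : 'M[int]_m) : x1 *m x2 \in unitmx ->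
  block_mx 1%:M 0 c1 x1 *m block_mx 1%:M (r1 *m (x1 *m x2)) 0 x2
    *m (block_mx 1%:M 0 (invmx (x1 *m x2) *m c2) x3
        *m block_mx 1%:M (r2 *m (x1 *m x2) *m (x3 *m x4)) 0 x4)
  = col_unip c1 *m row_unip r1 *m (col_unip c2 *m row_unip r2)
    *m corner (x1 *m x2 *m (x3 *m x4)).
Proof.
move=> xu; rewrite !corner_factors (cornerM (x1 *m x2)).
move: (x1 *m x2) xu (x3 *m x4) => y yu z.
rewrite -[LHS]mulmxA (mulmxA (corner y)) corner_swap //.
by rewrite !mulmxA.
Qed.

Lemma det_unip_up n (A : 'M[int]_n) : unip_up A -> \det A = 1.
Proof.
move=> [h1 [h2 _]]; rewrite -det_tr det_trig.
  by rewrite big1 // => i _; rewrite mxE h2.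
by apply/is_trig_mxP => i j ij; rewrite mxE h1.
Qed.

Lemma det_unip_low n (A : 'M[int]_n) : unip_low A -> \det A = 1.
Proof. by rewrite -[A]trmxK -unip_up_tr det_tr; exact: det_unip_up. Qed.

Fixpoint pad (k : nat) (A : 'M[int]_3) : 'M[int]_(3 + k) :=
  match k with
  | 0 => A
  | k'.+1 => (corner (pad k' A) : 'M_(1 + (3 + k')))
  end.

Lemma pad_unip_up k (A : 'M[int]_3) : unip_up A -> unip_up (pad k A).
Proof.
move=> hA; elim: k => [//|k IH].
by apply: unip_up_block IH; exact: dvdmx0.
Qed.

Lemma pad_unip_low k (A : 'M[int]_3) : unip_low A -> unip_low (pad k A).
Proof.
move=> hA; elim: k => [//|k IH].
by apply: unip_low_block IH; exact: dvdmx0.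
Qed.

Lemma padM k (A B : 'M[int]_3) : pad k (A *m B) = pad k A *m pad k B.
Proof. by elim: k => [//|k IH]; rewrite [LHS]/= IH; exact: cornerM. Qed.

Lemma pad1 k : pad k 1%:M = 1%:M.
Proof. by elim: k => [//|k IH]; rewrite [LHS]/= IH /corner -scalar_mx_block. Qed.

Lemma semitame_tame m (g : 'M[int]_(1 + m)) : tame g -> semitame g.
Proof. by rewrite -{1}[g]submxK => /tame_block[]. Qed.

Lemma reduction_to_3 k (g : 'M[int]_(3 + k)) : \det g = 1 -> tame g ->
  exists l1 u1 l2 u2 (h : 'M[int]_3),
    [/\ [/\ unip_low l1, unip_up u1, unip_low l2 & unip_up u2],
        \det h = 1, tame h & g = l1 *m u1 *m (l2 *m u2) *m pad k h].
Proof.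
elim: k g => [|k IH] g dg tg.
  exists 1%:M, 1%:M, 1%:M, 1%:M, g; rewrite !mul1mx; split=> //.
  by split; solve [exact: unip_up1|exact: unip_low1].
have [c1 [c2 [r1 [r2 [Y [[hc1 hc2 hr1 hr2] dY tY gE]]]]]] :=
  @corner_reduction k.+1 g dg (semitame_tame tg).
have [l1 [u1 [l2 [u2 [h [[hl1 hu1 hl2 hu2] dh th YE]]]]]] := IH Y dY (tY tg).
have xu : l1 *m u1 \in unitmx.
  by rewrite unitmxE det_mulmx (det_unip_low hl1) (det_unip_up hu1) mulr1 unitr1.
exists (block_mx 1%:M 0 c1 l1), (block_mx 1%:M (r1 *m (l1 *m u1)) 0 u1),
  (block_mx 1%:M 0 (invmx (l1 *m u1) *m c2) l2),
  (block_mx 1%:M (r2 *m (l1 *m u1) *m (l2 *m u2)) 0 u2), h.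
split=> //.
  split.
  - exact: unip_low_block.
  - by apply: unip_up_block => //; exact: dvdmxMl.
  - by apply: unip_low_block => //; exact: dvdmxMr.
  - by apply: unip_up_block => //; do 2 apply: dvdmxMl.
rewrite [LHS]gE YE cornerM mulmxA; congr (_ *m _).
exact: esym (corner_assembly c1 c2 r1 r2 l2 u2 xu).
Qed.

Fixpoint word n (k : nat) (A : 'M[int]_n) : Prop :=
  match k with
  | 0 => A = 1%:M
  | k'.+1 => exists B C, [/\ unip_up B \/ unip_low B, word k' C & A = B *m C]
  end.

Lemma wordM n k l (A B : 'M[int]_n) : word k A -> word l B -> word (k + l) (A *m B).
Proof.
elim: k A => [|k IH] A /=; first by move=> ->; rewrite mul1mx.
by move=> [C [D [hC hD ->]]] hB; exists C, (D *m B); split; rewrite ?mulmxA //; exact: IH.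
Qed.

Lemma word_up n (A : 'M[int]_n) : unip_up A -> word 1 A.
Proof. by move=> hA; exists A, 1%:M; rewrite mulmx1; split=> //; left. Qed.

Lemma word_low n (A : 'M[int]_n) : unip_low A -> word 1 A.
Proof. by move=> hA; exists A, 1%:M; rewrite mulmx1; split=> //; right. Qed.

Lemma word_leq n k l (A : 'M[int]_n) : (k <= l)%N -> word k A -> word l A.
Proof.
move=> kl hA; rewrite -(subnK kl) -[A]mul1mx; apply: wordM => //.
elim: (l - k)%N => [//|m IH]; exists 1%:M, 1%:M; rewrite mulmx1; split=> //.
by left; exact: unip_up1.
Qed.

Lemma word_pad m k (A : 'M[int]_3) : word m A -> word m (pad k A).
Proof.
elim: m A => [|m IH] A /=; first by move=> ->; exact: pad1.
move=> [B [C [hB hC ->]]]; exists (pad k B), (pad k C); split.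
- by case: hB => h; [left; exact: pad_unip_up|right; exact: pad_unip_low].
- exact: IH.
- exact: padM.
Qed.

Lemma word_of_tame (K k : nat) :
  (forall h : 'M[int]_3, \det h = 1 -> tame h -> word K h) ->
  forall g : 'M[int]_(3 + k), \det g = 1 -> tame g -> word (4 + K) g.
Proof.
move=> H g dg tg.
have [l1 [u1 [l2 [u2 [h [[hl1 hu1 hl2 hu2] dh th ->]]]]]] := reduction_to_3 dg tg.
apply: wordM; last exact/word_pad/H.
apply: (@wordM _ 2 2); apply: (@wordM _ 1 1);
  solve [exact: word_up|exact: word_low].
Qed.

End Reduction.

(** * Bounded products of conjugates in dimension 3 *)

Section Ball.
Local Open Scope group_scope.
Context {G : groupType}.
Variables (H T : G -> Prop).
Hypothesis H1 : H 1.
Hypothesis HM : forall x y, H x -> H y -> H (x * y).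
Hypothesis HV : forall x, H x -> H x^-1.
Hypothesis TV : forall x, T x -> T x^-1.
Hypothesis TJ : forall h x, H h -> T x -> T (h * x * h^-1).

Inductive ball : nat -> G -> Prop :=
| ball0 : ball 0 1
| ball_skip k x of ball k x : ball k.+1 x
| ball_cons k t x of T t & ball k x : ball k.+1 (t * x).

Lemma ball_gen x : T x -> ball 1 x.
Proof. by move=> tx; rewrite -[x]mulg1; apply: ball_cons => //; exact: ball0. Qed.

Lemma ball_leq k l x : (k <= l)%N -> ball k x -> ball l x.
Proof.
move=> /subnK <- hx; elim: (l - k)%N => [//|m IH].
by rewrite addSn; exact: ball_skip.
Qed.

Lemma ballM k l x y : ball k x -> ball l y -> ball (k + l) (x * y).
Proof.
move=> hx hy; elim: hx => [|k' z _ IH|k' t z ht _ IH]; first by rewrite mul1g.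
  by rewrite addSn; exact: ball_skip.
by rewrite addSn -mulgA; exact: ball_cons.
Qed.

Lemma ballV k x : ball k x -> ball k x^-1.
Proof.
elim=> [|k' z _ IH|k' t z ht _ IH]; first by rewrite invg1; exact: ball0.
  exact: ball_skip.
by rewrite invgM -addn1; apply: ballM => //; exact/ball_gen/TV.
Qed.

Lemma ballJ k h x : H h -> ball k x -> ball k (h * x * h^-1).
Proof.
move=> hh; elim=> [|k' z _ IH|k' t z ht _ IH].
- by rewrite mulg1 mulgV; exact: ball0.
- exact: ball_skip.
have -> : h * (t * z) * h^-1 = (h * t * h^-1) * (h * z * h^-1).
  by rewrite !mulgA mulgKV.
by apply: ball_cons => //; exact: TJ.
Qed.

Lemma ballJV k h x : H h -> ball k (h * x * h^-1) -> ball k x.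
Proof.
move=> hh /(ballJ (HV hh)); rewrite invgK !mulgA mulVg mul1g.
by rewrite -mulgA mulVg mulg1.
Qed.

(* Equality up to a bounded factor on the left: all estimates below compare elements modulo [ball k]. *)
Definition near k x y := ball k (x * y^-1).

Lemma near_trans k l x y z : near k x y -> near l y z -> near (k + l) x z.
Proof. by move=> h1 h2; have := ballM h1 h2; rewrite mulgA mulgKV. Qed.

Lemma near_conj k h x y : H h -> near k x y ->
  near k (h * x * h^-1) (h * y * h^-1).
Proof.
move=> hh /(ballJ hh); rewrite /near !invgM invgK !mulgA.
by rewrite mulgKV.
Qed.

Lemma ball_near k l x y : near k x y -> ball l y -> ball (k + l) x.
Proof. by move=> h1 h2; have := ballM h1 h2; rewrite mulgKV. Qed.

End Ball.

Section Matrices3.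
Context {R : comUnitRingType}.
Implicit Types (a b c d e f g h i : R) (A : 'M[R]_3).

Definition m3 a b c d e f g h i : 'M[R]_3 :=
  \matrix_(r, s) nth 0 (nth [::] [:: [:: a; b; c]; [:: d; e; f]; [:: g; h; i]] r) s.

Lemma m3M a b c d e f g h i a' b' c' d' e' f' g' h' i' :
  m3 a b c d e f g h i *m m3 a' b' c' d' e' f' g' h' i' =
  m3 (a * a' + b * d' + c * g') (a * b' + b * e' + c * h') (a * c' + b * f' + c * i')
     (d * a' + e * d' + f * g') (d * b' + e * e' + f * h') (d * c' + e * f' + f * i')
     (g * a' + h * d' + i * g') (g * b' + h * e' + i * h') (g * c' + h * f' + i * i').
Proof.
apply/matrixP=> r s; rewrite !mxE !big_ord_recl big_ord0 !mxE /= addr0 addrA.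
by case: r => [[|[|[|//]]] ?]; case: s => [[|[|[|//]]] ?].
Qed.

Lemma m3E A :
  A = m3 (A 0 0) (A 0 1) (A 0 2%:R) (A 1 0) (A 1 1) (A 1 2%:R)
         (A 2%:R 0) (A 2%:R 1) (A 2%:R 2%:R).
Proof.
apply/matrixP=> r s; rewrite mxE.
by case: r => [[|[|[|//]]] ?]; case: s => [[|[|[|//]]] ?] /=;
  congr (A _ _); apply: val_inj.
Qed.

Lemma det_m3 a b c d e f g h i : \det (m3 a b c d e f g h i) =
  a * (e * i - f * h) - b * (d * i - f * g) + c * (d * h - e * g).
Proof.
rewrite (expand_det_row _ ord0) !big_ord_recl big_ord0 /cofactor.
rewrite !(expand_det_row _ ord0) !big_ord_recl !big_ord0 /cofactor !det_mx11 !mxE /=.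
by rewrite /bump /= !addr0; ring.
Qed.

Lemma m3_tr a b c d e f g h i :
  (m3 a b c d e f g h i)^T = m3 a d g b e h c f i.
Proof.
apply/matrixP=> r s; rewrite !mxE.
by case: r => [[|[|[|//]]] ?]; case: s => [[|[|[|//]]] ?].
Qed.

(* Junk value: [sl A = 1] when [\det A <> 1]. *)
Definition sl A : SL R 3 := insubd (1%g : SL R 3) A.

Lemma SLval_sl A : \det A = 1 -> SLval (sl A) = A.
Proof. by move=> dA; rewrite /sl [LHS]val_insubd dA eqxx. Qed.

Lemma SLval_inj : injective (@SLval R 3).
Proof. exact: val_inj. Qed.

Lemma SLvalM (x y : SL R 3) : SLval (x * y)%g = SLval x *m SLval y.
Proof. by []. Qed.

End Matrices3.

Section Identities.
Context {R : comUnitRingType}.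
Variable q : R.
Local Notation SL3 := (SL R 3).

Definition S3 (a b c d e f g h i : R) : SL3 := sl (m3 a b c d e f g h i).

(* [Rg], [Cg]: row and column elements; [M12 a b c d], [M13 a b c d]: the matrix [[a, q b], [q c, d]] placed in the planes (1,2) and (1,3). *)
Definition Rg (x y : R) : SL3 := S3 1 (q * x) (q * y) 0 1 0 0 0 1.
Definition Cg (x y : R) : SL3 := S3 1 0 0 (q * x) 1 0 (q * y) 0 1.
Definition E23 (t : R) : SL3 := S3 1 0 0 0 1 t 0 0 1.
Definition E32 (t : R) : SL3 := S3 1 0 0 0 1 0 0 t 1.
Definition M12 (a b c d : R) : SL3 := S3 a (q * b) 0 (q * c) d 0 0 0 1.
Definition M13 (a b c d : R) : SL3 := S3 a 0 (q * b) 0 1 0 (q * c) 0 d.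

Definition det1 (a b c d : R) : Prop := a * d = 1 + q ^+ 2 * b * c.

Lemma det_Rg x y : \det (m3 1 (q * x) (q * y) 0 1 0 0 0 1) = 1.
Proof. by rewrite det_m3; ring. Qed.
Lemma det_Cg x y : \det (m3 1 0 0 (q * x) 1 0 (q * y) 0 1) = 1.
Proof. by rewrite det_m3; ring. Qed.
Lemma det_E23 (t : R) : \det (m3 1 0 0 0 1 t 0 0 1) = 1.
Proof. by rewrite det_m3; ring. Qed.
Lemma det_E32 (t : R) : \det (m3 1 0 0 0 1 0 0 t 1) = 1.
Proof. by rewrite det_m3; ring. Qed.
Lemma det_M12 a b c d : det1 a b c d ->
  \det (m3 a (q * b) 0 (q * c) d 0 0 0 1) = 1.
Proof. by rewrite /det1 => e; rewrite det_m3; ring: e. Qed.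
Lemma det_M13 a b c d : det1 a b c d ->
  \det (m3 a 0 (q * b) 0 1 0 (q * c) 0 d) = 1.
Proof. by rewrite /det1 => e; rewrite det_m3; ring: e. Qed.

Ltac sl3 :=
  rewrite /M12 /M13 /Rg /Cg /E23 /E32 /S3; apply: SLval_inj;
  rewrite ?SLvalM !SLval_sl ?det_Rg ?det_Cg ?det_E23 ?det_E32 //.

(** The commutator of a column and a row element multiplies their entries, hence the q^2. *)
Lemma E23_commutator t :
  E23 (q ^+ 2 * t) = (Cg 1 0 * (Rg 0 t * Cg (-1) 0 * Rg 0 (- t)))%g.
Proof. by sl3; rewrite !m3M; congr m3; ring. Qed.

Lemma E32_commutator t :
  E32 (q ^+ 2 * t) = (Cg 0 1 * (Rg t 0 * Cg 0 (-1) * Rg (- t) 0))%g.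
Proof. by sl3; rewrite !m3M; congr m3; ring. Qed.

(** For a congruent to 1 modulo q^2, [E23 (r * (a - 1))] is a short product although r is arbitrary:
    conjugation by [E23 r] changes [M12] by a bounded factor. *)
Lemma E23_conj a b c d r : det1 a b c d ->
  (E23 r * M12 a b c d
   = M12 a b c d * (Rg 0 (- (b * r)) * E23 (r * (a - 1))) * E23 r)%g.
Proof.
move=> e; sl3; rewrite ?(det_M12 e) //.
by rewrite /det1 in e; rewrite !m3M; congr m3; ring: e.
Qed.

Lemma E32_conj a b c d r : det1 a b c d ->
  (E32 r * M12 a b c d
   = Cg 0 (r * c) * E32 (r * (1 - a)) * M12 a b c d * E32 r)%g.
Proof.
move=> e; sl3; rewrite ?(det_M12 e) //.
by rewrite /det1 in e; rewrite !m3M; congr m3; ring: e.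
Qed.

(** A signed exchange of the last two coordinates, factored so that [E23_conj] and [E32_conj] apply
    to it. *)
Definition weyl : SL3 := (E23 (-1) * (E32 1 * E23 (-1)))%g.

Lemma weyl_M12 a b c d : det1 a b c d ->
  (M13 a b c d * weyl = weyl * M12 a b c d)%g.
Proof.
move=> e; rewrite /weyl; sl3; rewrite ?(det_M12 e) ?(det_M13 e) //.
by rewrite !m3M; congr m3; ring.
Qed.

Definition block23 (x y z t : R) : SL3 := S3 1 0 0 0 x y 0 z t.

(* Both matrices below are [[a, q b, 0], [0, 1, beta], [q c', 0, delta]] with [beta = q^2 b1 c]: its first row is that of a matrix in the plane (1,2), its first column that of a matrix in the plane (1,3). *)
Lemma mennicke1 a b1 b2 c d : det1 a (b1 * b2) c d ->
  (Cg (- c) (b2 * c * d)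
     * block23 a (q ^+ 2 * b1 * c) (- (q ^+ 2 * b1 * b2 ^+ 2 * c)) (d * (2 - a * d))
     * M12 a (b1 * b2) c d
   = M13 a b1 (b2 * c) d
     * (E32 (- (q ^+ 2 * b1 * b2 ^+ 2 * c)) * E23 (q ^+ 2 * b1 * c))
     * Rg (b1 * b2 * d) (- (b1 * (d * (2 - a * d)))))%g.
Proof.
move=> e; have e' : det1 a b1 (b2 * c) d by rewrite /det1 e; ring.
rewrite /block23; sl3; rewrite ?(det_M12 e) ?(det_M13 e') //;
  rewrite /det1 in e.
  by rewrite !m3M; congr m3; ring: e.
by rewrite det_m3; ring: e.
Qed.

(** This is [mennicke1] for the factorization 1 * b2 with c replaced by b1 c. The block and the
    product [E32 * E23] do not change, so the block can be eliminated between the two identities. *)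
Lemma mennicke2 a b1 b2 c d : det1 a (b1 * b2) c d ->
  (Cg (- (b1 * c)) (b1 * b2 * c * d)
     * block23 a (q ^+ 2 * b1 * c) (- (q ^+ 2 * b1 * b2 ^+ 2 * c)) (d * (2 - a * d))
     * M12 a b2 (b1 * c) d
   = M13 a 1 (b1 * b2 * c) d
     * (E32 (- (q ^+ 2 * b1 * b2 ^+ 2 * c)) * E23 (q ^+ 2 * b1 * c))
     * Rg (b2 * d) (- (d * (2 - a * d))))%g.
Proof.
move=> e; have e1 : det1 a b2 (b1 * c) d by rewrite /det1 e; ring.
have e2 : det1 a 1 (b1 * b2 * c) d by rewrite /det1 e; ring.
rewrite /block23; sl3; rewrite ?(det_M12 e1) ?(det_M13 e2) //;
  rewrite /det1 in e.
  by rewrite !m3M; congr m3; ring: e.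
by rewrite det_m3; ring: e.
Qed.

(** One column operation with the entry q b turns the upper left entry into 1; a column element
    times a row element remains. *)
Lemma M12_word b c d s : det1 (1 + q ^+ 2 * b * s) b c d ->
  M12 (1 + q ^+ 2 * b * s) b c d = (Cg (c - s * d) 0 * Rg b 0 * Cg s 0)%g.
Proof.
move=> e; sl3; rewrite ?(det_M12 e) //.
have e1 : d = 1 + q ^+ 2 * b * (c - s * d).
  by rewrite /det1 in e; rewrite mulrBr; rewrite -[LHS]mul1r;
    apply: (addrI (q ^+ 2 * b * s * d)); rewrite -mulrDl addrC e; ring.
have e2 : c = s + (c - s * d) * (1 + q ^+ 2 * b * s).
  have -> : s + (c - s * d) * (1 + q ^+ 2 * b * s)
     = s + c + q ^+ 2 * b * c * s - s * ((1 + q ^+ 2 * b * s) * d) by ring.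
  by rewrite e; ring.
rewrite !m3M; congr m3; [ring|ring|ring| |  |ring|ring|ring|ring].
  by rewrite {1}e2; ring.
by rewrite {1}e1; ring.
Qed.

Lemma M12_Cg a b c d t : det1 a b c d ->
  (M12 a b c d * Cg t 0 = M12 (a + q ^+ 2 * b * t) b (c + t * d) d)%g.
Proof.
move=> e; have e' : det1 (a + q ^+ 2 * b * t) b (c + t * d) d.
  by rewrite /det1 mulrDl e; ring.
by sl3; rewrite ?(det_M12 e) ?(det_M12 e') // !m3M; congr m3; ring.
Qed.

Lemma M12_Rg a b c d t : det1 a b c d ->
  (M12 a b c d * Rg t 0 = M12 a (b + a * t) c (d + q ^+ 2 * c * t))%g.
Proof.
move=> e; have e' : det1 a (b + a * t) c (d + q ^+ 2 * c * t).
  by rewrite /det1 mulrDr e; ring.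
by sl3; rewrite ?(det_M12 e) ?(det_M12 e') // !m3M; congr m3; ring.
Qed.

Lemma Cg_M12 a b c d t : det1 a b c d ->
  (Cg t 0 * M12 a b c d = M12 a b (c + t * a) (d + q ^+ 2 * t * b))%g.
Proof.
move=> e; have e' : det1 a b (c + t * a) (d + q ^+ 2 * t * b).
  by rewrite /det1 mulrDr e; ring.
by sl3; rewrite ?(det_M12 e) ?(det_M12 e') // !m3M; congr m3; ring.
Qed.

Lemma det1M a b c d a' b' c' d' : det1 a b c d -> det1 a' b' c' d' ->
  det1 (a * a' + q ^+ 2 * b * c') (a * b' + b * d')
   (c * a' + d * c') (q ^+ 2 * c * b' + d * d').
Proof. by rewrite /det1 => e e'; ring: e e'. Qed.

Lemma M12M a b c d a' b' c' d' : det1 a b c d -> det1 a' b' c' d' ->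
  (M12 a b c d * M12 a' b' c' d'
   = M12 (a * a' + q ^+ 2 * b * c') (a * b' + b * d') (c * a' + d * c')
         (q ^+ 2 * c * b' + d * d'))%g.
Proof.
move=> e e'; have e2 := det1M e e'.
by sl3; rewrite ?(det_M12 e) ?(det_M12 e') ?(det_M12 e2) // !m3M; congr m3; ring.
Qed.

(** By Cayley-Hamilton the power is y times the matrix plus a scalar, so b, c and a - d are all
    multiplied by y. Modulo q^2 b the upper left entries multiply, hence the form of A. *)
Lemma M12_expg a b c d m : det1 a b c d -> exists A y D s,
  [/\ (M12 a b c d ^+ m = M12 A (b * y) (c * y) D)%g,
      A - D = y * (a - d), det1 A (b * y) (c * y) D
    & A = a ^+ m + q ^+ 2 * b * s].
Proof.
move=> e; elim: m => [|m [A [y [D [s [E AD e' sE]]]]]].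
  exists 1, 0, 1, 0; rewrite expg0 !mulr0; split; [|ring|by rewrite /det1; ring|].
    by sl3; rewrite ?det_m3; [rewrite [LHS]m3E !mxE /=; congr m3; ring|ring].
  by rewrite addr0.
have AE : A = D + y * (a - d) by rewrite -AD; ring.
exists (A * a + q ^+ 2 * (b * y) * c), (A + y * d),
  (q ^+ 2 * (c * y) * b + D * d), (s * a + y * c).
split.
- by rewrite expgSr E M12M //; congr M12; rewrite ?AE; ring.
- by rewrite AE; ring.
- have := det1M e' e; congr det1; rewrite ?AE; ring.
by rewrite sE (exprSr a); ring.
Qed.

(** Conjugation by diag(1, -1) changes the signs of b and c; the third coordinate restores
    determinant 1. *)
Definition flip : SL3 := S3 1 0 0 0 (-1) 0 0 0 (-1).

Lemma flip_M12 a b c d : det1 a b c d ->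
  (flip * M12 a b c d = M12 a (- b) (- c) d * flip)%g.
Proof.
move=> e; have e' : det1 a (- b) (- c) d by rewrite /det1 e; ring.
rewrite /flip; sl3; rewrite ?(det_M12 e) ?(det_M12 e') //; last by rewrite det_m3; ring.
by rewrite !m3M; congr m3; ring.
Qed.

End Identities.

(** * Conjugates of row and column elements in dimension 3 *)

Section Corner.
Variable q : int.

Lemma semitameM m (A B : 'M[int]_(1 + m)) :
  semitame q A -> semitame q B -> semitame q (A *m B).
Proof.
rewrite -[A]submxK -[B]submxK mulmx_block /semitame.
rewrite !block_mxKul !block_mxKur !block_mxKdl.
move: (ulsubmx A) (ursubmx A) (dlsubmx A) (drsubmx A) => a r c D.
move: (ulsubmx B) (ursubmx B) (dlsubmx B) (drsubmx B) => a' r' c' D'.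
move=> [ha hr hc] [ha' hr' hc']; split.
- rewrite !mxE big_ord1 addrAC rpredD //.
    have -> : a 0 0 * a' 0 0 - 1 = (a 0 0 - 1) * a' 0 0 + (a' 0 0 - 1) by ring.
    by rewrite rpredD // dvdz_mulr.
  by rewrite rpred_sum // => k _; rewrite expr2 dvdz_mul.
- by apply: dvdmxD; [exact: dvdmxMr|exact: dvdmxMl].
- by apply: dvdmxD; [exact: dvdmxMl|exact: dvdmxMr].
Qed.

(** In a y + r W = 0 the entry a is 1 and the row r is 0 modulo q, so q divides y; likewise z. The
    upper left entry of the inverse then follows modulo q^2, because r z is divisible by q^2. *)
Lemma semitameV m (A B : 'M[int]_(1 + m)) : A *m B = 1%:M -> B *m A = 1%:M ->
  semitame q A -> semitame q B.
Proof.
rewrite -[A]submxK -[B]submxK !mulmx_block /semitame.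
rewrite !block_mxKul !block_mxKur !block_mxKdl.
move: (ulsubmx A) (ursubmx A) (dlsubmx A) (drsubmx A) => a r c D.
move: (ulsubmx B) (ursubmx B) (dlsubmx B) (drsubmx B) => x y z W.
rewrite scalar_mx_block => /eq_block_mx[e1 e2 _ _] /eq_block_mx[_ _ e3 _].
move=> [ha hr hc]; have qa : (q %| a 0%R 0%R - 1)%Z.
  by apply: dvdz_trans ha; rewrite dvdz_exp.
have aE : a = (a 0 0)%:M by exact: mx11_scalar.
have hy : dvdmx q y.
  move=> i j; have := congr1 (fun X : 'rV_m => X i j) e2.
  rewrite /= aE mul_scalar_mx !mxE => e.
  have -> : y i j = - (\sum_k r i k * W k j) - (a 0 0 - 1) * y i j by move: e; lra.
  by rewrite rpredB ?rpredN ?dvdz_mulr // rpred_sum // => k _; rewrite dvdz_mulr.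
have hz : dvdmx q z.
  move=> i j; rewrite [j]ord1; have := congr1 (fun X : 'cV_m => X i 0) e3.
  rewrite /= aE mul_mx_scalar !mxE => e.
  have -> : z i 0 = - (\sum_k W i k * c k 0) - (a 0 0 - 1) * z i 0 by move: e; lra.
  by rewrite rpredB ?rpredN ?dvdz_mulr // rpred_sum // => k _; rewrite dvdz_mull.
split=> //; have := congr1 (fun X : 'M_1 => X 0 0) e1.
rewrite /= aE mul_scalar_mx !mxE eqxx mulr1n => e.
have -> : x 0 0 - 1 = - (\sum_k r 0 k * z k 0) - (a 0 0 - 1) * x 0 0 by move: e; lra.
by rewrite rpredB ?rpredN ?dvdz_mulr // rpred_sum // => k _; rewrite expr2 dvdz_mul.
Qed.

Local Notation SL3 := (SL int 3).

Definition Gam (g : SL3) : Prop := semitame q (SLval g : 'M_(1 + 2)).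

Lemma Gam1 : Gam 1%g.
Proof.
rewrite /Gam /= (scalar_mx_block 1 2); split.
- by rewrite block_mxKul mxE eqxx subrr dvdz0.
- by rewrite block_mxKur; exact: dvdmx0.
- by rewrite block_mxKdl; exact: dvdmx0.
Qed.

Lemma GamM x y : Gam x -> Gam y -> Gam (x * y)%g.
Proof. exact: semitameM. Qed.

Lemma GamV x : Gam x -> Gam (x^-1)%g.
Proof.
apply: semitameV.
  by have := congr1 (@SLval int 3) (mulgV x).
by have := congr1 (@SLval int 3) (mulVg x).
Qed.

Definition gens (x : SL3) : Prop :=
  (exists2 r, dvdmx q r & SLval x = row_unip r :> 'M_(1 + 2)) \/
  (exists2 c, dvdmx q c & SLval x = col_unip c :> 'M_(1 + 2)).

Definition cgens (x : SL3) : Prop :=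
  exists h r, [/\ Gam h, gens r & x = (h * r * h^-1)%g].

Lemma gensV x : gens x -> gens (x^-1)%g.
Proof.
case=> -[r hr xE]; [left; exists (- r)|right; exists (- r)];
  rewrite ?dvdmxN //; first exact: dvdmxN; last 2 first.
- exact: dvdmxN.
- have e : (col_unip (- r) *m SLval x) *m SLval x^-1%g = SLval x^-1%g.
    by rewrite xE col_unipN mul1mx.
  rewrite -e -mulmxA (_ : SLval x *m SLval x^-1%g = 1%:M) ?mulmx1 //.
  by have := congr1 (@SLval int 3) (mulgV x).
have e : (row_unip (- r) *m SLval x) *m SLval x^-1%g = SLval x^-1%g.
  by rewrite xE row_unipN mul1mx.
rewrite -e -mulmxA (_ : SLval x *m SLval x^-1%g = 1%:M) ?mulmx1 //.
by have := congr1 (@SLval int 3) (mulgV x).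
Qed.

Lemma cgensV x : cgens x -> cgens (x^-1)%g.
Proof.
case=> h [r [hh hr ->]]; exists h, (r^-1)%g; split=> //; first exact: gensV.
by rewrite !invgM invgK mulgA.
Qed.

Lemma cgensJ h x : Gam h -> cgens x -> cgens (h * x * h^-1)%g.
Proof.
move=> hh [g [r [hg hr ->]]]; exists (h * g)%g, r; split=> //; first exact: GamM.
by rewrite invgM !mulgA.
Qed.

Lemma gens_cgens x : gens x -> cgens x.
Proof.
by move=> hx; exists 1%g, x; rewrite invg1 mulg1 mul1g; split=> //; exact: Gam1.
Qed.

Lemma gens_row r : dvdmx q r -> gens (sl (row_unip r : 'M_(1 + 2))).
Proof. by move=> hr; left; exists r => //; rewrite SLval_sl // det_row_unip. Qed.

Lemma gens_col c : dvdmx q c -> gens (sl (col_unip c : 'M_(1 + 2))).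
Proof. by move=> hc; right; exists c => //; rewrite SLval_sl // det_col_unip. Qed.

Lemma gens_corner_conj (y r : SL3) (Y : 'M[int]_2) : SLval y = corner Y :> 'M_(1 + 2) ->
  gens r -> gens (y * r * y^-1)%g.
Proof.
move=> yE hr; have dY : \det Y = 1 by rewrite -det_corner -yE SL_det.
have Yu : Y \in unitmx by rewrite unitmxE dY unitr1.
have yV : corner Y *m SLval (y^-1)%g = 1%:M.
  by rewrite -yE; have := congr1 (@SLval int 3) (mulgV y).
case: hr => -[v hv rE].
  left; exists (v *m invmx Y); first exact: dvdmxMl.
  rewrite !SLvalM rE yE.
  have -> : corner Y *m row_unip v = row_unip (v *m invmx Y) *m corner Y.
    rewrite /corner /row_unip !mulmx_block.
    by rewrite !mul1mx !mul0mx !mulmx0 !mulmx1 !addr0 !add0r mulmxKV.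
  by rewrite -mulmxA yV mulmx1.
right; exists (Y *m v); first exact: dvdmxMr.
rewrite !SLvalM rE yE.
have -> : corner Y *m col_unip v = col_unip (Y *m v) *m corner Y.
  rewrite /corner /col_unip !mulmx_block.
  by rewrite !mul1mx !mul0mx !mulmx0 !mulmx1 !addr0 !add0r.
by rewrite -mulmxA yV mulmx1.
Qed.

(* By [corner_reduction], [h] is a short word times a corner matrix, and corner matrices normalize the row and the column groups. *)
Lemma cgens_word x : cgens x -> ball gens 9 x.
Proof.
case=> h [r [hh hr ->]].
have [c1 [c2 [r1 [r2 [Y [[hc1 hc2 hr1 hr2] dY _ hE]]]]]] :=
  @corner_reduction q 0 (SLval h) (SL_det h) hh.
pose w := ((sl (col_unip c1 : 'M_(1 + 2)) * sl (row_unip r1 : 'M_(1 + 2)))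
  * (sl (col_unip c2 : 'M_(1 + 2)) * sl (row_unip r2 : 'M_(1 + 2))))%g.
pose y := sl (corner Y : 'M_(1 + 2)).
have yE : SLval y = corner Y by rewrite SLval_sl // det_corner.
have {}hE : h = (w * y)%g.
  apply: val_inj; rewrite [LHS]hE /w [val _]/= yE.
  by rewrite !SLval_sl ?det_col_unip ?det_row_unip.
have -> : (h * r * h^-1 = w * (y * r * y^-1) * w^-1)%g by rewrite hE invgM !mulgA.
have hw : ball gens 4 w.
  apply: (@ballM _ gens 2 2); apply: (@ballM _ gens 1 1);
    apply: ball_gen; solve [exact: gens_row|exact: gens_col].
apply: (@ballM _ gens 5 4); last exact: ballV gensV _ _ hw.
apply: (@ballM _ gens 4 1) => //; apply: ball_gen.
exact: gens_corner_conj yE hr.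
Qed.

Lemma ball_cgens_word k x : ball cgens k x -> ball gens (9 * k) x.
Proof.
elim=> [|k' z _ IH|k' t z ht _ IH]; first by rewrite muln0; exact: ball0.
  by apply: ball_leq IH; rewrite leq_mul2l leqW.
by rewrite mulnS; apply: ballM => //; exact: cgens_word.
Qed.

(** Transposition reverses products and exchanges row and column elements; it carries bounds
    obtained from b over to c. *)
Definition trg (x : SL3) : SL3 := sl (SLval x)^T.

Lemma SLval_trg x : SLval (trg x) = (SLval x)^T.
Proof. by rewrite SLval_sl // det_tr SL_det. Qed.

Lemma trgM x y : trg (x * y)%g = (trg y * trg x)%g.
Proof. by apply: val_inj; rewrite [LHS]SLval_trg /= trmx_mul !SLval_trg. Qed.

Lemma trgK : involutive trg.
Proof. by move=> x; apply: val_inj; rewrite [LHS]SLval_trg SLval_trg trmxK. Qed.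

Lemma trg1 : trg 1%g = 1%g.
Proof. by apply: val_inj; rewrite [LHS]SLval_trg /= trmx1. Qed.

Lemma trgV x : trg (x^-1)%g = ((trg x)^-1)%g.
Proof.
by apply: (mulIg (trg x)); rewrite mulVg -trgM mulgV trg1.
Qed.

Lemma semitame_tr m (A : 'M[int]_(1 + m)) : semitame q A -> semitame q A^T.
Proof.
rewrite /semitame -trmx_ulsub -trmx_ursub -trmx_dlsub => -[h1 h2 h3].
by split=> [|i j|i j]; rewrite mxE.
Qed.

Lemma tr_row_unip m (r : 'rV[int]_m) : (row_unip r)^T = col_unip r^T.
Proof. by rewrite /row_unip tr_block_mx !trmx1 trmx0. Qed.

Lemma tr_col_unip m (c : 'cV[int]_m) : (col_unip c)^T = row_unip c^T.
Proof. by rewrite /col_unip tr_block_mx !trmx1 trmx0. Qed.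

Lemma Gam_trg x : Gam x -> Gam (trg x).
Proof.
rewrite /Gam SLval_trg; exact: semitame_tr.
Qed.

Lemma gens_trg x : gens x -> gens (trg x).
Proof.
case=> -[v hv xE]; [right|left]; exists v^T.
- by move=> i j; rewrite mxE.
- by rewrite SLval_trg xE; exact: tr_row_unip.
- by move=> i j; rewrite mxE.
- by rewrite SLval_trg xE; exact: tr_col_unip.
Qed.

Lemma ball_trg k x : ball cgens k x -> ball cgens k (trg x).
Proof.
elim=> [|k' z _ IH|k' t z [h [r [hh hr ->]]] _ IH].
- by rewrite trg1; exact: ball0.
- exact: ball_skip.
rewrite trgM; have := ballM IH (_ : ball cgens 1 (trg (h * r * h^-1)%g)).
rewrite addn1; apply; apply: ball_gen.
exists (trg h^-1)%g, (trg r); split; first exact/Gam_trg/GamV.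
  exact: gens_trg.
by rewrite !trgM trgV invgK mulgA.
Qed.

End Corner.

(** * Mennicke symbols *)

Section Symbols.
Variable q : int.
Local Notation SL3 := (SL int 3).
Local Notation ball := (ball (cgens q)).
Local Notation near := (near (cgens q)).
Local Notation M12 := (M12 q).
Local Notation M13 := (M13 q).
Local Notation Rg := (Rg q).
Local Notation Cg := (Cg q).

Definition adm (a b c d : int) : Prop :=
  det1 q a b c d /\ (q ^+ 2 %| (a - 1)%R)%Z.

Lemma Gam_S3 a b c d e f g h i : \det (m3 a b c d e f g h i) = 1 ->
  (q ^+ 2 %| (a - 1)%R)%Z -> (q %| b)%Z -> (q %| c)%Z -> (q %| d)%Z -> (q %| g)%Z ->
  Gam q (S3 a b c d e f g h i).
Proof.
move=> dt ha hb hc hd hg; rewrite /Gam /S3 SLval_sl //; split.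
- by rewrite !mxE.
- by move=> r s; rewrite !mxE (ord1 r); case: s => [[|[|//]] ?].
- by move=> r s; rewrite !mxE (ord1 s); case: r => [[|[|//]] ?].
Qed.

Lemma gens_Rg x y : gens q (Rg x y).
Proof.
left; exists (\row_j (q * if j == 0 :> 'I_2 then x else y)).
  by move=> r s; rewrite mxE dvdz_mulr.
rewrite SLval_sl ?det_Rg // -[LHS](@submxK _ 1 2 1 2) /row_unip.
congr block_mx; apply/matrixP => r s; rewrite !mxE ?(ord1 r) ?(ord1 s) //=.
- by case: s => [[|[|//]] ?].
- by case: r => [[|[|//]] ?].
- by case: r => [[|[|//]] ?]; case: s => [[|[|//]] ?].
Qed.

Lemma gens_Cg x y : gens q (Cg x y).
Proof.
right; exists (\col_i (q * if i == 0 :> 'I_2 then x else y)).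
  by move=> r s; rewrite mxE dvdz_mulr.
rewrite SLval_sl ?det_Cg // -[LHS](@submxK _ 1 2 1 2) /col_unip.
congr block_mx; apply/matrixP => r s; rewrite !mxE ?(ord1 r) ?(ord1 s) //=.
- by case: s => [[|[|//]] ?].
- by case: r => [[|[|//]] ?].
- by case: r => [[|[|//]] ?]; case: s => [[|[|//]] ?].
Qed.

Lemma ball_Rg x y : ball 1 (Rg x y).
Proof. exact/ball_gen/gens_cgens/gens_Rg. Qed.

Lemma ball_Cg x y : ball 1 (Cg x y).
Proof. exact/ball_gen/gens_cgens/gens_Cg. Qed.

Lemma Gam_E23 t : Gam q (E23 t).
Proof. by apply: Gam_S3; rewrite ?det_E23 ?subrr ?dvdz0. Qed.

Lemma Gam_E32 t : Gam q (E32 t).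
Proof. by apply: Gam_S3; rewrite ?det_E32 ?subrr ?dvdz0. Qed.

Lemma Gam_M12 a b c d : adm a b c d -> Gam q (M12 a b c d).
Proof.
by move=> [e ha]; apply: Gam_S3; rewrite ?(det_M12 e) ?dvdz_mulr ?dvdz0.
Qed.

Lemma Gam_M13 a b c d : adm a b c d -> Gam q (M13 a b c d).
Proof.
by move=> [e ha]; apply: Gam_S3; rewrite ?(det_M13 e) ?dvdz_mulr ?dvdz0.
Qed.

Let ballM := @ballM _ (cgens q).
Let ballJ := @ballJ _ _ _ (@cgensJ q).
Let ballJV := @ballJV _ _ _ (@GamV q) (@cgensJ q).
Let ballV := @ballV _ _ (@cgensV q).
Let near_conj := @near_conj _ _ _ (@cgensJ q).

Lemma ball_E23 t : ball 4 (E23 (q ^+ 2 * t)).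
Proof.
rewrite E23_commutator; apply: (ballM (k := 1) (l := 3)); first exact: ball_Cg.
apply: (ballM (k := 2) (l := 1)); last exact: ball_Rg.
by apply: (ballM (k := 1) (l := 1)); [exact: ball_Rg|exact: ball_Cg].
Qed.

Lemma ball_E32 t : ball 4 (E32 (q ^+ 2 * t)).
Proof.
rewrite E32_commutator; apply: (ballM (k := 1) (l := 3)); first exact: ball_Cg.
apply: (ballM (k := 2) (l := 1)); last exact: ball_Rg.
by apply: (ballM (k := 1) (l := 1)); [exact: ball_Rg|exact: ball_Cg].
Qed.

Lemma near_E23 a b c d r : adm a b c d ->
  near 5 (E23 r * M12 a b c d * (E23 r)^-1)%g (M12 a b c d).
Proof.
move=> h; have [e /dvdzP[s sE]] := h.
rewrite /near (E23_conj r e) mulgK; apply: ballJ; first exact: Gam_M12.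
apply: (ballM (k := 1) (l := 4)); first exact: ball_Rg.
by rewrite sE mulrA mulrC; exact: ball_E23.
Qed.

Lemma near_E32 a b c d r : adm a b c d ->
  near 5 (E32 r * M12 a b c d * (E32 r)^-1)%g (M12 a b c d).
Proof.
move=> h; have [e /dvdzP[s sE]] := h.
rewrite /near (E32_conj r e) !mulgK.
apply: (ballM (k := 1) (l := 4)); first exact: ball_Cg.
by rewrite -opprB sE -mulNr mulrA mulrC; exact: ball_E32.
Qed.

Lemma M13_conj a b c d : adm a b c d ->
  M13 a b c d = (weyl * M12 a b c d * weyl^-1)%g.
Proof. by move=> [e _]; rewrite -(weyl_M12 e) mulgK. Qed.

Lemma Gam_weyl : Gam q (weyl : SL3).
Proof.
apply: GamM; first exact: Gam_E23.
by apply: GamM; [exact: Gam_E32|exact: Gam_E23].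
Qed.

Lemma near_M13 a b c d : adm a b c d -> near 15 (M13 a b c d) (M12 a b c d).
Proof.
move=> h; rewrite M13_conj // /weyl !invgM !mulgA.
(* Each of the three elementary factors of [weyl] is removed at cost 5. *)
have n1 := near_E23 (-1) h; have n2 := near_E32 1 h.
have n3 := near_conj (Gam_E32 1) n1.
have n4 := near_trans n3 n2.
have n5 := near_conj (Gam_E23 (-1)) n4.
by have := near_trans n5 n1; rewrite !mulgA.
Qed.

Lemma ball_M12_word a b c d s : adm a b c d -> a = 1 + q ^+ 2 * b * s ->
  ball 3 (M12 a b c d).
Proof.
move=> [e _] aE; rewrite aE in e *; rewrite (M12_word e).
apply: (ballM (k := 2) (l := 1)); last exact: ball_Cg.
by apply: (ballM (k := 1) (l := 1)); [exact: ball_Cg|exact: ball_Rg].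
Qed.

Lemma adm_split a b1 b2 c d : adm a (b1 * b2) c d ->
  [/\ adm a b1 (b2 * c) d, adm a b2 (b1 * c) d & adm a 1 (b1 * b2 * c) d].
Proof.
move=> [e ha]; rewrite /adm /det1 in e *.
by split; split=> //; rewrite e; ring.
Qed.

(** By [mennicke1] the block [Y] carries the left side close to [M13 a b1], and [mennicke2]
    identifies [Y] up to a short factor. The cost is 27 for [Y], 10 for the first identity and 15
    for the change of plane. *)
Lemma near_mennicke a b1 b2 c d : adm a (b1 * b2) c d ->
  near 52 (M12 a (b1 * b2) c d) (M12 a b2 (b1 * c) d * M12 a b1 (b2 * c) d)%g.
Proof.
move=> h; have [h1 h2 h0] := adm_split h; have [e ha] := h.
have := mennicke1 e; have := mennicke2 e.
set Y := block23 _ _ _ _; set Y' := (E32 _ * E23 _)%g.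
set C1 := Cg _ _; set C2 := Cg _ _; set R1 := Rg _ _; set R2 := Rg _ _ => e2 e1.
have hY' : ball 8 Y'.
  apply: (ballM (k := 4) (l := 4)).
    have -> : - (q ^+ 2 * b1 * b2 ^+ 2 * c) = q ^+ 2 * - (b1 * b2 ^+ 2 * c).
      by ring.
    exact: ball_E32.
  by rewrite -mulrA; exact: ball_E23.
(* [Y] is close to the inverse of [M2], since [M0] is a short word *)
have n2 : ball 27 (Y * M12 a b2 (b1 * c) d)%g.
  have -> : (Y * M12 a b2 (b1 * c) d = C1^-1 * (M13 a 1 (b1 * b2 * c) d * Y' * R1))%g.
    by rewrite -e2 !mulgA mulVg mul1g.
  apply: (ballM (k := 1) (l := 26)).
    exact/ballV/ball_Cg.
  apply: (ballM (k := 25) (l := 1)); last exact: ball_Rg.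
  apply: (ballM (k := 17) (l := 8)) => //.
  have /dvdzP[s sE] := ha.
  apply: (@ball_leq _ _ 3) => //; rewrite M13_conj //; apply: ballJ.
    exact: Gam_weyl.
  by apply: (@ball_M12_word _ _ _ _ s h0); rewrite -(subrK 1 a) sE; ring.
have n1 : near 10 (Y * M12 a (b1 * b2) c d)%g (M13 a b1 (b2 * c) d).
  have -> : (Y * M12 a (b1 * b2) c d = C2^-1 * (M13 a b1 (b2 * c) d * Y' * R2))%g.
    by rewrite -e1 !mulgA mulVg mul1g.
  rewrite /near -mulgA; apply: (ballM (k := 1) (l := 9)); first exact/ballV/ball_Cg.
  rewrite -(mulgA _ Y'); apply: ballJ; first exact: Gam_M13.
  by apply: (ballM (k := 8) (l := 1)) => //; exact: ball_Rg.
have n3 := near_trans n1 (near_M13 h1).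
have -> : near 52 (M12 a (b1 * b2) c d)
     (M12 a b2 (b1 * c) d * M12 a b1 (b2 * c) d)%g
  = ball 52 (M12 a b2 (b1 * c) d * ((Y * M12 a b2 (b1 * c) d)^-1
     * (Y * M12 a (b1 * b2) c d * (M12 a b1 (b2 * c) d)^-1))
     * (M12 a b2 (b1 * c) d)^-1)%g.
  by rewrite /near !invgM !mulgA mulgV mul1g mulVg mul1g.
apply: ballJ; first exact: Gam_M12.
exact: (ballM (k := 27) (l := 25) (ballV n2) n3).
Qed.

(* Two elementary operations turn the first row into [(b - 1, q)]. *)
Lemma ball_M12_trace a b c d y z : adm a b c d -> b = 2 + q ^+ 2 * y ->
  a = b * (1 + q ^+ 2 * z) - 1 -> ball 5 (M12 a b c d).
Proof.
move=> [e ha] bE aE.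
have e1 := M12_Cg (- z) e.
set a1 := a + _ in e1; set c1 := c + _ in e1.
have a1E : a1 = b - 1 by rewrite /a1 aE; ring.
have h1 : adm a1 b c1 d.
  split; first by rewrite /det1 /a1 /c1 mulrDl e; ring.
  have -> : a1 - 1 = q ^+ 2 * y by rewrite a1E bE; ring.
  exact: dvdz_mulr.
have e2 := M12_Rg (- 1) (proj1 h1).
have b1E : b + a1 * - 1 = 1 by rewrite a1E; ring.
rewrite b1E in e2; set d2 := d + _ in e2.
have h2 : adm a1 1 c1 d2.
  split; last by case: h1.
  have : det1 q a1 (b + a1 * - 1) c1 d2.
    by rewrite /det1 /d2 mulrDr (proj1 h1); ring.
  by rewrite b1E.
have h3 : ball 3 (M12 a1 1 c1 d2).
  apply: (@ball_M12_word _ _ _ _ y h2); rewrite a1E bE; ring.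
rewrite -(mulgK (Cg (- z) 0) (M12 a b c d)) e1.
rewrite -(mulgK (Rg (- 1) 0) (M12 a1 b c1 d)) e2.
apply: (ballM (k := 4) (l := 1)); last exact/ballV/ball_Cg.
by apply: (ballM (k := 3) (l := 1)) => //; exact/ballV/ball_Rg.
Qed.

Lemma adm_d a b c d : adm a b c d -> exists s, d = 1 + q ^+ 2 * s.
Proof.
move=> [e /dvdzP[s sE]]; exists (b * c - d * s).
have aE : a = 1 + q ^+ 2 * s by rewrite -(subrK 1 a) sE; ring.
by rewrite -[LHS](addrK (q ^+ 2 * s * d)) -{1}[d]mul1r -mulrDl -aE e; ring.
Qed.

(* With [V = A + D], the even power is a matrix with upper left entry [A V - 1] and upper right entry [y V b], whose three factors can be treated separately by [near_mennicke]. *)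
Lemma M12_even_power a b c d m : adm a b c d -> exists A y D s,
  [/\ (M12 a b c d ^+ m.*2
        = M12 (A * (A + D) - 1) (y * ((A + D) * b)) (c * (y * (A + D)))
              (D * (A + D) - 1))%g,
      adm (A * (A + D) - 1) (y * ((A + D) * b)) (c * (y * (A + D)))
              (D * (A + D) - 1),
      A * (A + D) - 1 = 1 + q ^+ 2 * y * s,
      (exists t, A + D = 2 + q ^+ 2 * t) /\ (exists t, A = 1 + q ^+ 2 * t)
    & exists t, A * (A + D) - 1 = a ^+ m.*2 + q ^+ 2 * b * t].
Proof.
move=> h; have [e /dvdzP[s sE]] := h; have [s2 dE] := adm_d h.
have aE : a = 1 + q ^+ 2 * s by rewrite -(subrK 1 a) sE; ring.
have [A [y [D [s1 [E AD e' A1]]]]] := M12_expg m e.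
have [t tE] : exists t, a ^+ m = 1 + q ^+ 2 * t.
  have : (q ^+ 2 %| (a ^+ m - 1)%R)%Z.
    by rewrite subrX1 sE; apply: dvdz_mulr; exact: dvdz_mull.
  by move=> /dvdzP[t tE]; exists t; rewrite -(subrK 1 (a ^+ m)) tE; ring.
have A2 : A = 1 + q ^+ 2 * (t + b * s1) by rewrite A1 tE; ring.
have D2 : D = 1 + q ^+ 2 * (t + b * s1 - y * (s - s2)).
  by rewrite -[D](subKr A) AD {1}A2 aE dE; ring.
have detE : A * D - 1 = q ^+ 2 * (b * y) * (c * y) by rewrite e'; ring.
exists A, y, D, (A * (s - s2) + 2 * (b * c * y)).
have adE : A * (A + D) - 1 = 1 + q ^+ 2 * y * (A * (s - s2) + 2 * (b * c * y)).
  have -> : A * (A + D) - 1 = 1 + A * (A - D) + 2 * (A * D - 1) by ring.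
  by rewrite AD detE aE dE; ring.
have M2 : (M12 a b c d ^+ m.*2
        = M12 (A * (A + D) - 1) (y * ((A + D) * b)) (c * (y * (A + D)))
              (D * (A + D) - 1))%g.
  rewrite -addnn expgD E M12M //; congr (M12 _ _ _ _).
  - by rewrite mulrDr -addrA detE.
  - by ring.
  - by ring.
  - by rewrite mulrDr addrAC (mulrC D A) detE; ring.
split=> //.
- split; last by rewrite adE addrC addKr -mulrA dvdz_mulr.
  have := det1M e' e'; congr det1.
  + by rewrite mulrDr -addrA detE.
  + by ring.
  + by ring.
  + by rewrite mulrDr addrAC (mulrC D A) detE; ring.
- split; first by exists (2 * (t + b * s1) - y * (s - s2)); rewrite {1}A2 D2; ring.
  by exists (t + b * s1).
exists (s1 * (a ^+ m + A) + c * y ^+ 2).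
have -> : A * (A + D) - 1 = A * A + (A * D - 1) by ring.
by rewrite detE -addnn exprD {1}A1 {1 2}A1; ring.
Qed.

(** With V = A + D, the entry y V b is split twice, at 52 each. The factor y costs 3 because A V - 1
    is 1 modulo q^2 y, V costs 5 by [ball_M12_trace], and b costs 3 by the hypothesis on the
    exponent. *)
Lemma ball_even_power a b c d m : adm a b c d ->
  (q ^+ 2 * b %| (a ^+ m.*2 - 1)%R)%Z -> ball 115 (M12 a b c d ^+ m.*2)%g.
Proof.
move=> h /dvdzP[k kE].
have [A [y [D [s [-> h' e1 [[t tE] [z zE]] [u uE]]]]]] := M12_even_power m h.
have n1 := near_mennicke h'; have [h1 h2 _] := adm_split h'.
have n2 := near_mennicke h2; have [h3 h4 _] := adm_split h2.
apply: (ball_near (k := 52) (l := 63) n1).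
apply: (ballM (k := 60) (l := 3)); last exact: (ball_M12_word h1 e1).
apply: (ball_near (k := 52) (l := 8) n2).
apply: (ballM (k := 3) (l := 5)).
  apply: (@ball_M12_word _ _ _ _ (k + u) h4).
  by rewrite uE -(subrK 1 (a ^+ m.*2)) kE; ring.
apply: (@ball_M12_trace _ _ _ _ t z h3 tE).
by rewrite -zE mulrC.
Qed.

Lemma trg_M12 a b c d : det1 q a b c d -> trg (M12 a b c d) = M12 a c b d.
Proof.
move=> e; have e' : det1 q a c b d by rewrite /det1 e mulrAC.
apply: SLval_inj; rewrite SLval_trg /(M12 _ _ _ _) /S3 !SLval_sl ?(det_M12 e) ?(det_M12 e') //.
exact: m3_tr.
Qed.

Lemma trg_expg (x : SL3) m : trg (x ^+ m)%g = (trg x ^+ m)%g.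
Proof.
elim: m => [|m IH]; first by rewrite !expg0 trg1.
by rewrite expgS expgSr trgM IH.
Qed.

Lemma adm_tr a b c d : adm a b c d -> adm a c b d.
Proof. by move=> [e ha]; split=> //; rewrite /det1 e mulrAC. Qed.

Lemma ball_even_power_col a b c d m : adm a b c d ->
  (q ^+ 2 * c %| (a ^+ m.*2 - 1)%R)%Z -> ball 115 (M12 a b c d ^+ m.*2)%g.
Proof.
move=> h hc.
have -> : (M12 a b c d ^+ m.*2)%g = trg (M12 a c b d ^+ m.*2)%g.
  by rewrite trg_expg trg_M12 //; case: (adm_tr h).
apply: ball_trg; exact: ball_even_power (adm_tr h) hc.
Qed.

Lemma ball_flip k a b c d : adm a b c d ->
  ball k (M12 a (- b) (- c) d) -> ball k (M12 a b c d).
Proof.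
move=> [e ha] hb; have gf : Gam q (flip : SL3).
  by apply: Gam_S3; rewrite ?subrr ?dvdz0 // det_m3; ring.
by apply: (ballJV gf); rewrite (flip_M12 e) mulgK.
Qed.

End Symbols.

(** * Congruences and primes in prescribed classes *)

Lemma dvdz_sub_mod (p m n : nat) :
  (p%:Z %| (m%:Z - n%:Z)%R)%Z = (m == n %[mod p]).
Proof. by rewrite -eqz_mod_dvd !modz_nat. Qed.

Lemma eq_mod_dvd_trans (d n a b : nat) : (d %| n)%N -> a = b %[mod n] -> a = b %[mod d].
Proof. by move=> dn e; rewrite -(modn_dvdm a dn) e modn_dvdm. Qed.

(** An even power does not see the sign of a, so Euler's theorem for [absz a] applies. *)
Lemma euler_even (a : int) (n m : nat) : coprime `|a| n -> (totient n %| m.*2)%N ->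
  (n%:Z %| (a ^+ m.*2 - 1)%R)%Z.
Proof.
move=> an /dvdnP[k kE].
have ge0 : 0 <= a ^+ m.*2 by rewrite exprn_even_ge0 ?odd_double.
rewrite -(gez0_abs ge0) abszX -[1]/(1%N%:Z) dvdz_sub_mod kE mulnC expnM.
by rewrite -modnXm Euler_exp_totient // modnXm exp1n.
Qed.

Lemma coprimez_eq_mod (h m : nat) (a : int) :
  (h%:Z = a %[mod m])%Z -> coprimez a m -> coprime h m.
Proof.
move=> e; rewrite -[coprime _ _]/(coprimez h%:Z m%:Z) /coprimez.
by rewrite -[gcdz h _]gcdz_modl e gcdz_modl.
Qed.

Lemma prime_crt (m n : nat) (a b : int) : (0 < m)%N -> (0 < n)%N -> coprime m n ->
  coprimez a m -> coprimez b n ->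
  exists p : nat, [/\ prime p, (m%:Z %| (p%:Z - a)%R)%Z & (n%:Z %| (p%:Z - b)%R)%Z].
Proof.
move=> m0 n0 mn am bn.
have [z [zm zn]] : exists z : int, (z = a %[mod m])%Z /\ (z = b %[mod n])%Z.
  exists (zchinese m n a b); split; [exact: zchinese_modl|exact: zchinese_modr].
have mn0 : (0 < m * n)%N by rewrite muln_gt0 m0.
pose h := `|(z %% (m * n)%N)%Z|%N.
have hz : h%:Z = (z %% (m * n)%N)%Z.
  by rewrite /h gez0_abs // modz_ge0 // eqz_nat -lt0n.
have hm : (h%:Z = a %[mod m])%Z.
  rewrite hz -zm; apply/eqP; rewrite eqz_mod_dvd.
  have : ((m * n)%N%:Z %| ((z %% (m * n)%N)%Z - z)%R)%Z.
    by rewrite -eqz_mod_dvd modz_mod.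
  by apply: dvdz_trans; rewrite dvdzE /= dvdn_mulr.
have hn : (h%:Z = b %[mod n])%Z.
  rewrite hz -zn; apply/eqP; rewrite eqz_mod_dvd.
  have : ((m * n)%N%:Z %| ((z %% (m * n)%N)%Z - z)%R)%Z.
    by rewrite -eqz_mod_dvd modz_mod.
  by apply: dvdz_trans; rewrite dvdzE /= dvdn_mull.
have cop : coprime h (m * n)%N.
  by rewrite coprimeMr (coprimez_eq_mod hm am) (coprimez_eq_mod hn bn).
have [p pp ph] := dirichlet_primes mn0 cop.
have pm : (p%:Z = h%:Z %[mod m])%Z.
  by rewrite !modz_nat; congr Posz; apply: eq_mod_dvd_trans ph; rewrite dvdn_mulr.
have pn : (p%:Z = h%:Z %[mod n])%Z.
  by rewrite !modz_nat; congr Posz; apply: eq_mod_dvd_trans ph; rewrite dvdn_mull.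
exists p; split=> //; rewrite -eqz_mod_dvd; apply/eqP.
  by rewrite pm.
by rewrite pn.
Qed.

Lemma bezout_coprime (m l : nat) : (0 < m)%N -> coprime m l ->
  exists u v, (u * m = v * l + 1)%N.
Proof.
move=> m0 ml; case: (egcdnP l m0) => u v e _.
by exists u, v; rewrite e (eqP ml).
Qed.

(** * Bounding every symbol *)

Section SquareBound.
Variable q : int.
Hypothesis q0 : q != 0.
Local Notation ball := (ball (cgens q)).
Local Notation near := (near (cgens q)).
Local Notation M12 := (M12 q).
Local Notation Rg := (Rg q).
Local Notation Cg := (Cg q).
Let ballM := @ballM _ (cgens q).
Let ballV := @ballV _ _ (@cgensV q).
Let ballJ := @ballJ _ _ _ (@cgensJ q).

Lemma prime_ndvd_bezout (p : nat) (y d : int) : prime p -> - p%:Z * d = 1 + y ->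
  ~ (p%:Z %| y)%Z.
Proof.
move=> pp e py; have : (p%:Z %| 1)%Z.
  have -> : Posz 1 = - p%:Z * d - y by rewrite e addrK.
  by apply: rpredB => //; rewrite mulNr rpredN dvdz_mulr.
by rewrite dvdz1 /= => /eqP p1; rewrite p1 in pp.
Qed.

Lemma adm_Cg a b c d t : adm q a b c d ->
  adm q a b (c + t * a) (d + q ^+ 2 * t * b).
Proof. by move=> [e ha]; split=> //; rewrite /det1 mulrDr e; ring. Qed.

(* The square is a quotient of two bounded even powers, of half-exponents [u m] and [v k] with [u m = v k + 1]: [m] is a multiple of the totient of [q ^ 2 x], and [l = 2 k + 1] is a prime, congruent to [c] modulo [p], chosen so that [k] is coprime to [m]. *)
Lemma ball_square (p : nat) (x c d : int) : prime p -> odd p ->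
  adm q (- p%:Z) x c d -> ball 232 (M12 (- p%:Z) x c d * M12 (- p%:Z) x c d)%g.
Proof.
move=> pp p_odd h; have [e /dvdzP[s sE]] := h.
have np := prime_ndvd_bezout pp e.
pose n1 := absz (q ^+ 2 * x).
have x0 : x != 0 by apply/eqP => x0; apply: np; rewrite x0 mulr0 mul0r dvdz0.
have n1_gt0 : (0 < n1)%N by rewrite absz_gt0 mulf_neq0 // expf_neq0.
(* The factor [absz q] puts the primes of q among those of m; by [mW] below, l is then prime to
   q. *)
pose m := (totient n1 * absz q)%N.
have m_gt0 : (0 < m)%N by rewrite muln_gt0 totient_gt0 n1_gt0 absz_gt0.
have pn1 : coprime p n1.
  rewrite prime_coprime //; apply/negP => pn; apply: np; apply: dvdz_mulr.
  by rewrite dvdzE.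
have power_row u : (q ^+ 2 * x %| ((- p%:Z) ^+ (u * m).*2 - 1)%R)%Z.
  have : (n1%:Z %| ((- p%:Z) ^+ (u * m).*2 - 1)%R)%Z.
    apply: euler_even; first by rewrite abszN absz_nat.
    by rewrite -muln2 /m -!mulnA mulnCA mulnA mulnC dvdn_mull // dvdn_mulr.
  by rewrite !dvdzE.
(* If c is 1 modulo p, so is l = 2k + 1, and p divides k, which spoils coprimality when p divides m.
   But then c can be made equal to 1, and the matrix is a short word. *)
have [pc|pc] := boolP (p%:Z %| (c - 1)%R)%Z.
  have /dvdzP[t tE] := pc.
  have e1 := Cg_M12 t e; have h1 := adm_Cg t h.
  have cE : c + t * - p%:Z = 1 by rewrite -[c](subrK 1) tE; ring.
  rewrite cE in e1 h1; set d1 := d + _ in e1 h1.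
  have b3 : ball 3 (M12 (- p%:Z) x 1 d1).
    have h2 := adm_tr h1.
    rewrite -[M12 _ _ _ _](trgK); apply: ball_trg; rewrite trg_M12; last by case: h1.
    by apply: (ball_M12_word (s := s) h2); rewrite -[LHS](subrK 1) sE; ring.
  have b4 : ball 4 (M12 (- p%:Z) x c d).
    rewrite -[M12 _ _ _ _](mulKg (Cg t 0)) e1.
    by apply: (ballM (k := 1) (l := 3)) => //; exact/ballV/ball_Cg.
  by apply: (ball_leq (k := 8)) => //; exact: (ballM b4 b4).
have p4W : coprime p (4 * m`_p^').
  rewrite coprimeMr; apply/andP; split.
    by rewrite (@coprimeXr 2 p 2) // coprime_sym coprime2n.
  by rewrite prime_coprime // -p'natE // part_pnat.
have ndvd_c : ~ (p%:Z %| c)%Z by move=> pc'; apply: np; exact: dvdz_mull.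
(* A common prime of m and k = (l - 1)/2 other than p divides both l + 1 and l - 1, hence is 2; but
   k is odd since 4 divides l + 1. The prime p does not divide k because l = c is not 1 modulo p. *)
have [l [lp lc lW]] : exists r : nat, [/\ prime r, (p%:Z %| (r%:Z - c)%R)%Z
    & ((4 * m`_p^')%N%:Z %| (r%:Z - (-1))%R)%Z].
  apply: prime_crt => //; [exact: prime_gt0|by rewrite muln_gt0 part_gt0| |].
    by rewrite coprimezE absz_nat coprime_sym prime_coprime //; apply/negP.
  by rewrite coprimeNz coprimezE coprime1n.
have {}lW : (4 * m`_p^' %| l.+1)%N.
  by move: lW; rewrite opprK -[1]/(1%N%:Z) -PoszD addn1 dvdzE.
have l4 : (4 %| l.+1)%N by apply: dvdn_trans lW; rewrite dvdn_mulr.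
have mW r : prime r -> r != p -> (r %| m)%N -> (r %| l.+1)%N.
  move=> rp rnp; rewrite -{1}(partnC p m_gt0) Euclid_dvdM // => /orP[|rW].
    by rewrite p_part Euclid_dvdX // dvdn_prime2 // (negPf rnp).
  by apply: dvdn_trans lW; rewrite dvdn_mull.
have l_gt1 := prime_gt1 lp.
pose k := l./2.
have kE : (l = k.*2 + 1)%N by move: l4; rewrite /k; clear; lia.
have mk : coprime m k.
  rewrite /coprime -[_ == 1%N]negbK; apply/negP => g1.
  have rp := pdiv_prime (n := gcdn m k); set r := pdiv _ in rp.
  have {g1}rp : prime r.
    by apply: rp; rewrite ltn_neqAle eq_sym g1 gcdn_gt0 m_gt0.
  have rm : (r %| m)%N := dvdn_trans (pdiv_dvd _) (dvdn_gcdl _ _).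
  have rk : (r %| k)%N := dvdn_trans (pdiv_dvd _) (dvdn_gcdr _ _).
  have [rE|rnp] := eqVneq r p.
    move/negP: pc; apply.
    have -> : c - 1 = (k.*2)%:Z - (l%:Z - c) by rewrite kE PoszD; ring.
    by apply: rpredB => //; rewrite dvdzE /= -rE -muln2 dvdn_mulr.
  have rl := mW r rp rnp rm.
  have : (r %| 2)%N.
    have -> : (2 = l.+1 - k.*2)%N by move: kE; clear; lia.
    by rewrite dvdn_sub // -muln2 dvdn_mulr.
  rewrite dvdn_prime2 // => /eqP rE; rewrite rE in rk.
  by move: l4 kE rk; clear; lia.
have [u [v uv]] := bezout_coprime m_gt0 mk.
have lp' : l != p.
  apply/eqP => lE; apply: ndvd_c.
  have -> : c = l%:Z - (l%:Z - c) by ring.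
  by apply: rpredB => //; rewrite lE dvdzz.
have lq : coprime l (absz q ^ 2).
  rewrite coprimeXr // prime_coprime //; apply/negP => lq.
  have /(mW l lp lp') : (l %| m)%N by rewrite dvdn_mull.
  by rewrite -addn1 dvdn_addr // dvdn1 => /eqP l1; rewrite l1 in l_gt1.
have power_col : (q ^+ 2 * l%:Z %| ((- p%:Z) ^+ (v * k).*2 - 1)%R)%Z.
  rewrite Gauss_dvdz; last by rewrite coprimezE abszX coprime_sym.
  apply/andP; split.
    by rewrite subrX1 sE; apply: dvdz_mulr; exact: dvdz_mull.
  apply: euler_even.
    by rewrite abszN absz_nat coprime_sym prime_coprime // dvdn_prime2.
  by rewrite totient_prime // kE addn1 /= doubleMr dvdn_mull.
have /dvdzP[t tE] := lc.
have e1 := Cg_M12 (- t) e; have h1 := adm_Cg (- t) h.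
have cE : c + - t * - p%:Z = l%:Z by rewrite -[l%:Z](subrK c) tE; ring.
rewrite cE in e1 h1; set d1 := d + _ in e1 h1.
set N1 := M12 _ x l d1 in e1.
have b230 : ball 230 (N1 * N1)%g.
  have -> : (N1 * N1 = (N1 ^+ (v * k).*2)^-1 * N1 ^+ (u * m).*2)%g.
    have -> : ((u * m).*2 = (v * k).*2 + 2)%N by rewrite uv addn1 doubleS addn2.
    by rewrite expgD mulKg.
  apply: (ballM (k := 115) (l := 115)).
    by apply/ballV/ball_even_power_col.
  exact: ball_even_power.
have NE : M12 (- p%:Z) x c d = ((Cg (- t) 0)^-1 * N1)%g by rewrite -e1 mulKg.
rewrite NE; set C := (_^-1)%g.
have -> : (C * N1 * (C * N1) = C * ((N1 * C * N1^-1) * (N1 * N1)))%g.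
  by rewrite !mulgA mulgKV.
have bC : ball 1 C by exact/ballV/ball_Cg.
apply: (ballM (k := 1) (l := 231)) => //.
by apply: (ballM (k := 1) (l := 230)) => //; apply: ballJ => //; exact: Gam_M12.
Qed.
Lemma ball_M12_Cg k a b c d t : adm q a b c d ->
  ball k (M12 (a + q ^+ 2 * b * t) b (c + t * d) d) -> ball k.+1 (M12 a b c d).
Proof.
move=> [e _] hb; rewrite -[M12 _ _ _ _](mulgK (Cg t 0)) (M12_Cg t e) -(addn1 k).
by apply: ballM => //; exact/ballV/ball_Cg.
Qed.

Lemma ball_M12_Rg k a b c d t : adm q a b c d ->
  ball k (M12 a (b + a * t) c (d + q ^+ 2 * c * t)) -> ball k.+1 (M12 a b c d).
Proof.
move=> [e _] hb; rewrite -[M12 _ _ _ _](mulgK (Rg t 0)) (M12_Rg t e) -(addn1 k).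
by apply: ballM => //; exact/ballV/ball_Rg.
Qed.

Lemma adm_M12_Rg a b c d t : adm q a b c d ->
  adm q a (b + a * t) c (d + q ^+ 2 * c * t).
Proof. by move=> [e ha]; split=> //; rewrite /det1 mulrDr e; ring. Qed.

Lemma ball_M12_square (p : nat) (x c d : int) : prime p -> odd p ->
  adm q (- p%:Z) (x * x) c d -> ball 284 (M12 (- p%:Z) (x * x) c d).
Proof.
move=> pp po h; have [h1 _ _] := adm_split h.
by apply: (ball_near (k := 52) (l := 232) (near_mennicke h)); exact: ball_square.
Qed.

(* [x = b ^ ((p + 1) / 4)], since [b ^ ((p - 1) / 2) = ±1] modulo [p]. *)
Lemma square_mod_sign (p : nat) (b : int) : prime p -> p = 3 %[mod 4] ->
  coprimez b p -> exists x t : int, b + - p%:Z * t = x * x \/ b + - p%:Z * t = - (x * x).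
Proof.
move=> pp p4 bp.
have [k kE] : exists k, p = (4 * k + 3)%N by exists (p %/ 4)%N; rewrite {1}(divn_eq p 4) p4 mulnC.
have /euler_even -/(_ (2 * k + 1)%N) : coprime (absz b) p := bp.
rewrite totient_prime //.
have -> : p.-1 = (2 * k + 1).*2 by move: kE; clear; lia.
move=> /(_ (dvdnn _)) hp.
pose x := b ^+ (k + 1).
have : (p%:Z %| ((b - x * x) * (b + x * x))%R)%Z.
  have -> : (b - x * x) * (b + x * x) = - (b ^+ 2 * (b ^+ (2 * k + 1).*2 - 1)).
    have -> : (b - x * x) * (b + x * x) = b ^+ 2 - (x * x) ^+ 2 by ring.
    rewrite /x -exprD -exprM mulrBr -exprD mulr1 opprB; congr (_ - _ ^+ _); lia.
  by rewrite rpredN; apply: dvdz_mull.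
rewrite dvdzE abszM Euclid_dvdM // => /orP[] hd.
  have /dvdzP[t tE] : (p%:Z %| (b - x * x)%R)%Z by rewrite dvdzE.
  by exists x, t; left; rewrite -[b](subrK (x * x)) tE; ring.
have /dvdzP[t tE] : (p%:Z %| (b + x * x)%R)%Z by rewrite dvdzE.
by exists x, t; right; rewrite -[b](addrK (x * x)) tE; ring.
Qed.

Lemma ball_M12_prime (p : nat) (b c d : int) : prime p -> p = 3 %[mod 4] ->
  adm q (- p%:Z) b c d -> ball 285 (M12 (- p%:Z) b c d).
Proof.
move=> pp p4 h; have po : odd p by move: p4; clear; lia.
have bp : coprimez b p.
  rewrite coprimezE absz_nat coprime_sym prime_coprime //; apply/negP => pb.
  apply: (prime_ndvd_bezout pp (proj1 h)).
  by apply: dvdz_mulr; apply: dvdz_mull; rewrite dvdzE.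
have [x [t xE]] := square_mod_sign pp p4 bp.
apply: (ball_M12_Rg (t := t) h); have := adm_M12_Rg t h.
case: xE => -> h'; first exact: ball_M12_square.
apply: ball_flip => //; rewrite opprK; apply: ball_M12_square => //.
by case: h' => e1 e2; split=> //; rewrite /det1 e1; ring.
Qed.

(** The prime p must be -a modulo q^2 b and 3 modulo 4. If q is odd, the two moduli are coprime
    because b is odd. If q is even, 4 divides q^2, and a = 1 modulo q^2 already gives -a = 3 modulo
    4. *)
Lemma ball_M12_odd (a b c d : int) : odd `|b|%N ->
  adm q a b c d -> ball 286 (M12 a b c d).
Proof.
move=> bo h; have [e ha] := h.
pose n := absz (q ^+ 2 * b).
have n0 : (0 < n)%N.
  rewrite absz_gt0 mulf_neq0 ?expf_neq0 //.
  by apply/eqP => b0; rewrite b0 in bo.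
have an : coprimez (- a) n.
  rewrite coprimezE absz_nat -[coprime _ _]/(coprimez (- a) (q ^+ 2 * b)).
  apply/coprimezP; exists (- d, - c); rewrite /= mulrNN mulrC e mulNr.
  by rewrite (mulrC c) addrK.
have [p [pp pa p4]] : exists p : nat, [/\ prime p, (n%:Z %| (p%:Z - - a)%R)%Z
    & p = 3 %[mod 4]].
  have [qo|qe] := boolP (odd (absz q)).
    have n4 : coprime n 4.
      by rewrite (@coprimeXr 2 n 2) // coprimen2 /n abszM abszX oddM oddX qo.
    have [p [pp pa p4]] := prime_crt (n := 4) (b := 3) n0 isT n4 an isT.
    by exists p; split => //; apply/eqP; rewrite -dvdz_sub_mod.
  have [p [pp pa _]] := prime_crt (n := 1) (b := 3) n0 isT (coprimen1 n) an isT.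
  exists p; split=> //; apply/eqP; rewrite -dvdz_sub_mod.
  have q4 : (4 %| q ^+ 2)%Z.
    have /dvdzP[r ->] : (2 %| q)%Z by rewrite dvdzE dvdn2.
    by rewrite exprMn dvdz_mull.
  have -> : p%:Z - 3%N%:Z = (p%:Z - - a) - (a - 1) - 4 by ring.
  apply: rpredB => //; apply: rpredB; last exact: dvdz_trans ha.
  by apply: dvdz_trans pa; rewrite dvdzE absz_nat /n abszM dvdn_mulr.
have {}pa : (q ^+ 2 * b %| (p%:Z - - a)%R)%Z by rewrite dvdzE.
have /dvdzP[t tE] := pa.
apply: (ball_M12_Cg (t := - t) h).
have aE : a + q ^+ 2 * b * - t = - p%:Z.
  have -> : p%:Z = (p%:Z - - a) - a by ring.
  by rewrite tE; ring.
rewrite aE; apply: ball_M12_prime => //; split.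
  by rewrite -aE /det1 mulrDl e; ring.
rewrite -aE addrAC; apply: rpredD => //.
by rewrite -mulrA dvdz_mulr.
Qed.

(** If b is even, the determinant makes a odd, and adding a to b makes b odd. *)
Lemma ball_M12 (a b c d : int) : adm q a b c d -> ball 287 (M12 a b c d).
Proof.
move=> h; have [e _] := h.
apply: (ball_M12_Rg (t := (~~ odd `|b|%N)%:Z) h).
apply: ball_M12_odd; last exact: adm_M12_Rg.
have [bo|be] := boolP (odd `|b|%N); first by rewrite mulr0 addr0.
rewrite mulr1 -[odd _]negbK -dvdn2 -[(_ %| _)%N]/(2%:Z %| (b + a)%R)%Z.
have {}be : (2%:Z %| b)%Z by rewrite dvdzE dvdn2.
apply/negP => /(rpredB)/(_ be); rewrite addrC addKr => ae.
have : (2%:Z %| (a * d - q ^+ 2 * b * c)%R)%Z.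
  by apply: rpredB; [exact: dvdz_mulr|apply: dvdz_mulr; exact: dvdz_mull].
by rewrite e addrK.
Qed.

End SquareBound.

(** * Words in unipotent matrices *)

Section Dimension3.
Variable q : int.

Lemma unip_up_m3 x y z : (q %| x)%Z -> (q %| y)%Z -> (q %| z)%Z ->
  unip_up q (m3 1 x y 0 1 z 0 0 1).
Proof.
move=> hx hy hz; split; [|split].
- by move=> [[|[|[|//]]] ?] [[|[|[|//]]] ?] //=; rewrite !mxE.
- by move=> [[|[|[|//]]] ?]; rewrite !mxE.
- by move=> [[|[|[|//]]] ?] [[|[|[|//]]] ?] //= _; rewrite !mxE ?dvdz0.
Qed.

Lemma unip_low_m3 x y z : (q %| x)%Z -> (q %| y)%Z -> (q %| z)%Z ->
  unip_low q (m3 1 0 0 x 1 0 y z 1).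
Proof.
move=> hx hy hz; rewrite -[m3 _ _ _ _ _ _ _ _ _]trmxK -unip_up_tr m3_tr.
exact: unip_up_m3.
Qed.

Lemma row_unip_m3 (r : 'rV[int]_2) :
  row_unip r = m3 1 (r 0 0) (r 0 1) 0 1 0 0 0 1 :> 'M_(1 + 2).
Proof.
rewrite -[RHS](@submxK _ 1 2 1 2); congr block_mx; apply/matrixP => i j;
  rewrite !mxE ?(ord1 i) ?(ord1 j) //=.
- by case: j => [[|[|//]] ?]; congr (r _ _); apply/val_inj.
- by case: i => [[|[|//]] ?].
- by case: i => [[|[|//]] ?]; case: j => [[|[|//]] ?].
Qed.

Lemma col_unip_m3 (c : 'cV[int]_2) :
  col_unip c = m3 1 0 0 (c 0 0) 1 0 (c 1 0) 0 1 :> 'M_(1 + 2).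
Proof. by rewrite -[col_unip c]trmxK tr_col_unip row_unip_m3 m3_tr !mxE. Qed.

Lemma corner_m3 (Y : 'M[int]_2) :
  corner Y = m3 1 0 0 0 (Y 0 0) (Y 0 1) 0 (Y 1 0) (Y 1 1) :> 'M_(1 + 2).
Proof.
rewrite -[RHS](@submxK _ 1 2 1 2); congr block_mx; apply/matrixP => i j;
  rewrite !mxE ?(ord1 i) ?(ord1 j) //=.
- by case: j => [[|[|//]] ?].
- by case: i => [[|[|//]] ?].
- by case: i => [[|[|//]] ?]; case: j => [[|[|//]] ?]; congr (Y _ _); apply/val_inj.
Qed.

(* Moves the plane (1,2) carrying [M12] to the plane (2,3) carrying [corner]. *)
Definition cyc : 'M[int]_3 := m3 0 0 1 1 0 0 0 1 0.

Lemma cyc_conj a b c d e f g h i :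
  cyc *m m3 a b c d e f g h i *m cyc^T = m3 i g h c a b f d e.
Proof. by rewrite m3_tr !m3M; congr m3; ring. Qed.

Lemma m3_1 : (1%:M : 'M[int]_3) = m3 1 0 0 0 1 0 0 0 1.
Proof. by rewrite [LHS]m3E !mxE. Qed.

Lemma cyc_orth : cyc^T *m cyc = 1%:M.
Proof. by rewrite m3_1 m3_tr m3M; congr m3; ring. Qed.

(** After the permutation of coordinates one entry of a row or column element lies above the
    diagonal and the other below: hence two factors. *)
Lemma word_gens x : gens q x -> word q 2 (cyc *m SLval x *m cyc^T).
Proof.
case=> -[r hr ->].
  rewrite row_unip_m3 cyc_conj.
  have -> : m3 1 0 0 (r 0 1) 1 (r 0 0) 0 0 1
      = m3 1 0 0 0 1 (r 0 0) 0 0 1 *m m3 1 0 0 (r 0 1) 1 0 0 0 1.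
    by rewrite m3M; congr m3; ring.
  apply: (@wordM _ _ 1 1); first by apply/word_up/unip_up_m3; rewrite ?dvdz0.
  by apply/word_low/unip_low_m3; rewrite ?dvdz0.
rewrite col_unip_m3 cyc_conj.
have -> : m3 1 (r 1 0) 0 0 1 0 0 (r 0 0) 1
    = m3 1 (r 1 0) 0 0 1 0 0 0 1 *m m3 1 0 0 0 1 0 0 (r 0 0) 1.
  by rewrite m3M; congr m3; ring.
apply: (@wordM _ _ 1 1); first by apply/word_up/unip_up_m3; rewrite ?dvdz0.
by apply/word_low/unip_low_m3; rewrite ?dvdz0.
Qed.

Lemma word_ball_gens k x : ball (gens q) k x -> word q (2 * k) (cyc *m SLval x *m cyc^T).
Proof.
elim=> [|k' y _ IH|k' t y ht _ IH].
- by rewrite mulmx1; apply: mulmx1C cyc_orth.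
- by apply: word_leq IH; rewrite leq_mul.
rewrite mulnS SLvalM.
have -> : cyc *m (SLval t *m SLval y) *m cyc^T
    = (cyc *m SLval t *m cyc^T) *m (cyc *m SLval y *m cyc^T).
  by rewrite !mulmxA -(mulmxA _ cyc^T cyc) cyc_orth mulmx1.
by apply: wordM => //; exact: word_gens.
Qed.

Lemma word_dim3 (h : 'M[int]_3) : q != 0 -> \det h = 1 -> tame q h -> 
  word q (4 + 2 * (9 * 287)) h.
Proof.
move=> q0 dh th.
have [c1 [c2 [r1 [r2 [Y [[hc1 hc2 hr1 hr2] dY tY ->]]]]]] :=
  @corner_reduction q 0 h dh (semitame_tame th).
have {}tY := tY th.
apply: (@wordM _ _ 4).
  apply: (@wordM _ _ 2 2); apply: (@wordM _ _ 1 1);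
  by [apply/word_up/unip_up_row|apply/word_low/unip_low_col].
rewrite (corner_m3 Y); case: tY => hdiag hoff.
have /dvdzP[b bE] := hoff 0 1 isT; have /dvdzP[c cE] := hoff 1 0 isT.
have hY : adm q (Y 0 0) b c (Y 1 1).
  split; last exact: hdiag.
  move: dY; rewrite -det_corner (corner_m3 Y) det_m3 bE cE /det1 => <-; ring.
have := ball_cgens_word (ball_M12 q0 hY).
move/word_ball_gens; rewrite /M12 /S3 SLval_sl; last exact: (det_M12 (proj1 hY)).
by rewrite cyc_conj bE cE !(mulrC q).
Qed.

End Dimension3.

Section TameGroup.
Variables (n : nat) (q : int).
Local Notation X := (mul_set (U_group n q) (L_group n q)).
Local Notation SLn := (SL int n).

Lemma SLvalVM (g h : SLn) : SLval g^-1%g *m (SLval g *m SLval h) = SLval h.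
Proof. by have := congr1 (@SLval int n) (mulKg g h). Qed.

Lemma tameV (g : SLn) : tame q g -> tame q (g^-1)%g.
Proof.
move=> [h1 h2]; have e : SLval g^-1%g *m SLval g = 1%:M.
  by have := congr1 (@SLval int n) (mulVg g).
set B := SLval g^-1%g in e *.
have off i j : i != j -> (q %| B i j)%Z.
  move=> ij; have := congr1 (fun M : 'M_n => M i j) e.
  rewrite !mxE (negPf ij) (bigD1 j) //= => s0.
  have -> : B i j = - (B i j * (g j j - 1))
      - \sum_(k < n | k != j) B i k * g k j.
    by move/eqP: s0; rewrite addr_eq0 => /eqP s0; rewrite -s0; ring.
  apply: rpredB; first by rewrite rpredN dvdz_mull // (dvdz_trans _ (h1 j)) // dvdz_exp.
  by apply: rpred_sum => k kj; rewrite dvdz_mull // h2.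
split=> // i; have := congr1 (fun M : 'M_n => M i i) e.
rewrite !mxE eqxx (bigD1 i) //= => s1.
have -> : B i i - 1 = - (B i i * (g i i - 1))
    - \sum_(k < n | k != i) B i k * g k i.
  by move: s1 => /(congr1 (fun t => B i i - t)) <-; ring.
apply: rpredB; first by rewrite rpredN dvdz_mull.
by apply: rpred_sum => k ki; rewrite expr2 dvdz_mul ?h2 // off // eq_sym.
Qed.

Lemma exp_set_tame (k : nat) (g : SLn) : exp_set X k g -> tame q g.
Proof.
case=> x hx ->; elim/big_ind: _ => [|y z|i _]; first exact: tame1.
  exact: tameM.
case: (hx i) => [[u hu [l hl <-]]|/= ->]; last exact: tame1.
by apply: (tameM (A := SLval u)); [exact: unip_up_tame|exact: unip_low_tame].
Qed.

(** A single factor from U or from L lies in U L, the other factor being 1. *)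
Lemma word_exp_set (k : nat) (g : SLn) : word q k (SLval g) -> exp_set X k g.
Proof.
elim: k g => [|k IH] g /=.
  move=> ge; exists (fun=> 1%g) => [[]//|].
  by rewrite big_ord0; apply/val_inj.
case=> B [C [hB hC gE]].
have dB : \det B == 1 by case: hB => [/det_unip_up ->|/det_unip_low ->].
pose b : SLn := MkSL dB.
have gbE : g = (b * (b^-1 * g))%g by rewrite mulKVg.
have CE : SLval (b^-1 * g)%g = C.
  have -> : SLval (b^-1 * g)%g = SLval b^-1%g *m SLval g by [].
  rewrite gE.
  have dC : \det C == 1.
    by have := SL_det g; rewrite gE det_mulmx (eqP dB) mul1r => ->.
  exact: (SLvalVM b (MkSL dC)).
have [x hx xE] : exp_set X k (b^-1 * g)%g by apply: IH; rewrite CE.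
exists (fun i => if unlift ord0 i is Some j then x j else b).
  move=> i; case: unliftP => [j _|_]; first exact: hx.
  left; case: hB => hB.
    exists b => //; exists 1%g; last by rewrite mulg1.
    exact: unip_low1.
  exists 1%g; last by exists b; rewrite ?mul1g.
  exact: unip_up1.
rewrite big_ord_recl unlift_none [LHS]gbE; congr (_ * _)%g; rewrite [LHS]xE.
by apply: eq_bigr => j _; rewrite liftK.
Qed.

Lemma tame_congruent (g h : SLn) : (forall i j, (q ^+ 2 %| (g i j - h i j)%R)%Z) ->
  tame q (g^-1 * h)%g.
Proof.
move=> gh; have -> : SLval (g^-1 * h)%g = 1%:M - SLval g^-1%g *m (SLval g - SLval h).
  have -> : SLval g^-1%g *m (SLval g - SLval h) = 1%:M - SLval (g^-1 * h)%g.
    by rewrite mulmxBr; have := congr1 (@SLval int n) (mulVg g) => /= ->.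
  by rewrite opprB addrC subrK.
have hD : dvdmx (q ^+ 2) (SLval g^-1%g *m (SLval g - SLval h)).
  by apply: dvdmxMr => i j; rewrite !mxE.
split=> [i|i j ij].
  by rewrite !mxE eqxx addrAC subrr add0r rpredN; have := hD i i; rewrite mxE.
rewrite !mxE (negPf ij) sub0r rpredN; have := hD i j; rewrite mxE.
by apply: dvdz_trans; rewrite dvdz_exp.
Qed.

Lemma left_coset_eq (G : groupType) (H : set G) (g h : G) : is_subgroup H ->
  H (g^-1 * h)%g -> left_coset g H = left_coset h H.
Proof.
move=> [/set_mem H1 HB] gh.
have HD x y : H x -> H y -> H (x * y^-1)%g.
  by move=> hx hy; apply: set_mem; apply: HB; apply: mem_set.
have HV x : H x -> H x^-1%g by move=> hx; rewrite -[_^-1%g]mul1g; exact: HD.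
have HM x y : H x -> H y -> H (x * y)%g.
  by move=> hx /HV hy; rewrite -[y]invgK; exact: HD.
apply/seteqP; split=> _ [x hx <-].
  exists ((g^-1 * h)^-1 * x)%g; first by apply: HM => //; exact: HV.
  by rewrite invgM invgK !mulgA mulgV mul1g.
exists ((g^-1 * h) * x)%g; first exact: HM.
by rewrite !mulgA mulgV mul1g.
Qed.

Lemma tame_finite_index : q != 0 -> is_subgroup [set g : SLn | tame q g]%classic ->
  finite_index [set g : SLn | tame q g]%classic.
Proof.
move=> q0 sub; pose N := absz (q ^+ 2).
pose F (g : SLn) : {ffun 'I_n * 'I_n -> 'I_N.-1.+1} :=
  [ffun ij => inord (absz (g ij.1 ij.2 %% q ^+ 2)%Z)].
(* The residues modulo q^2 recorded by [F] determine the coset. [G] picks a matrix with given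
   residues; its default 1 occurs only for residues of no matrix. *)
pose G t := xget (1%g : SLn) [set g | F g = t]%classic.
set H := [set g : SLn | _]%classic.
apply: (@sub_finite_set _ _ [set left_coset (G t) H | t in [set: {ffun 'I_n * 'I_n -> 'I_N.-1.+1}]]%classic).
  move=> _ [g _ <-]; exists (F g) => //; apply: left_coset_eq => //.
  have : F (G (F g)) = F g by apply: (@xgetI _ 1%g [set h | F h = F g]%classic g).
  move: (G (F g)) => h hg; apply: tame_congruent => i j.
  have := congr1 (fun f : {ffun _ -> _} => val (f (i, j))) hg.
  have q2 : q ^+ 2 != 0 by rewrite expf_neq0.
  have Fij (f : SLn) : (absz (f i j %% q ^+ 2)%Z < N.-1.+1)%N.
    rewrite prednK ?absz_gt0 // -ltz_nat gez0_abs ?modz_ge0 //.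
    exact: ltz_mod.
  rewrite !ffunE /= !inordK // => /(congr1 Posz).
  rewrite !gez0_abs ?modz_ge0 // => /eqP.
  by rewrite eqz_mod_dvd.
apply: finite_image; exact: finite_finset.
Qed.

Lemma tame_subgroup : is_subgroup [set g : SLn | tame q g]%classic.
Proof.
split; first by rewrite inE; exact: tame1.
move=> x y; rewrite !inE => hx hy; exact: tameM hx (tameV hy).
Qed.
End TameGroup.

Theorem theorem1p7 :
  exists C : nat, forall (n : nat) (q : int), (3 <= n)%N -> q <> 0%R ->
    is_subgroup (exp_set (mul_set (U_group n q) (L_group n q)) C)
    /\ finite_index (exp_set (mul_set (U_group n q) (L_group n q)) C).
Proof.
(* Four factors lower n to 3 and four more clear the first row and column there. The remaining
   corner takes 287 conjugates, each of 9 row or column elements, each of 2 unipotents. *)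
exists (4 + (4 + 2 * (9 * 287)))%N => -[|[|[|n]]] // q _ /eqP q0.
set C := (4 + _)%N; set X := mul_set _ _.
have -> : exp_set X C = [set g : SL int (3 + n) | tame q g]%classic.
  apply/seteqP; split=> g; first exact: exp_set_tame.
  move=> tg; apply: word_exp_set; apply: (@word_of_tame q _ n) => //.
    by move=> h; exact: word_dim3.
  exact: SL_det.
by split; [exact: tame_subgroup|apply: tame_finite_index => //; exact: tame_subgroup].
Qed.
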